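(* Let $p\in(0,1)$ and $p<t\le1$, let $h=h_p=\log\frac{p}{1-p}$ and $(\beta,\alpha)\in[0,+\infty)\times[0,1]$. Suppose that $$\sup_{0\le u\le1}\left[\frac\beta6u^{3\alpha}-\phi_p(u)-\frac12\log(1-p)\right]=\frac\beta6t^{3\alpha}-\phi_p(t)-\frac12\log(1-p),$$ where $\phi_p(u)=\inf\{\mathcal{I}_p(f):f\in\mathcal{W},\ \mathcal{T}(f)=u^3\}$. Then the importance sampling scheme (for the event $\mathcal{W}_t$ under $\mathbb{P}_{n,p}$) based on the triangle tilt $\mathbb{Q}_n^{h_p,\beta,\alpha}$ is asymptotically optimal.
   Context: **Graphons.** $\mathcal{W}$ is the set of measurable symmetric functions $f:[0,1]^2\to[0,1]$, modulo identifying $f$ and $g$ when $f(x,y)=g(\sigma x,\sigma y)$ for a measure-preserving bijection $\sigma$ of $[0,1]$. For $f\in\mathcal{W}$: $\mathcal{E}(f)=\int\int f(x,y)\,dx\,dy$, $\mathcal{T}(f)=\int\int\int f(x,y)f(y,z)f(x,z)\,dx\,dy\,dz$ (integrals over $[0,1]$), and $\mathcal{W}_t=\{f\in\mathcal{W}:\mathcal{T}(f)\ge t^3\}$. **Rate function.** $I_p(u)=\frac12\left(u\log\frac up+(1-u)\log\frac{1-u}{1-p}\right)$ for $u\in[0,1]$ (with $0\log 0=0$), and $\mathcal{I}_p(f)=\int_0^1\int_0^1I_p(f(x,y))\,dx\,dy$. **Graphs.** $\Omega_n=\{0,1\}^{\binom n2}$ is the set of simple graphs $X$ on $n$ vertices.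 $X$ is identified with the graphon equal to $X_{ij}$ on $[\frac{i-1}n,\frac in)\times[\frac{j-1}n,\frac jn)$ ($X_{ji}=X_{ij}$, $X_{ii}=0$), so $\mathcal{E}(X)=\frac2{n^2}\#\{\text{edges}\}$ and $\mathcal{T}(X)=\frac6{n^3}\#\{\text{triangles}\}$. $\mathbb{P}_{n,p}$ is the law of the Erdős–Rényi graph $\mathcal{G}_{n,p}$ (independent edges with probability $p$). **Gibbs tilt.** $\mathbb{Q}_n^{h,\beta,\alpha}$ is the probability measure on $\Omega_n$ with $\mathbb{Q}_n^{h,\beta,\alpha}(X)\propto\exp\left(n^2\left(\frac h2\mathcal{E}(X)+\frac\beta6\mathcal{T}(X)^\alpha\right)\right)$ (convention $0^0=1$ if $\alpha=0$). A triangle tilt is the case $h=h_p$. **Asymptotic optimality.** Importance sampling based on $\mathbb{Q}_n$ estimates $\mathbb{P}_{n,p}(\mathcal{W}_t)$ by averaging $\mathbf{1}_{\mathcal{W}_t}(\tilde X)\frac{d\mathbb{P}_{n,p}}{d\mathbb{Q}_n}(\tilde X)$ over i.i.d. samples $\tilde X\sim\mathbb{Q}_n$. The scheme based on $\mathbb{Q}_n$ is asymptotically optimal if $$\lim_{n\to\infty}\frac1{n^2}\log\mathbb{E}_{\mathbb{Q}_n}\left[\left(\mathbf{1}_{\mathcal{W}_t}\frac{d\mathbb{P}_{n,p}}{d\mathbb{Q}_n}\right)^2\right]=-2\inf_{f\in\mathcal{W}_t}\mathcal{I}_p(f)$$ (with $\log0=-\infty$). *)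

(* Defs.v *)
From HB Require Import structures.
From mathcomp Require Import all_boot all_order all_algebra.
From mathcomp Require Import all_classical all_reals all_analysis.

Set Implicit Arguments.
Unset Strict Implicit.
Unset Printing Implicit Defensive.

Import Order.TTheory GRing.Theory Num.Theory.
Import numFieldNormedType.Exports.

Local Open Scope classical_set_scope.
Local Open Scope ring_scope.

Notation I01 R := [set` `[0%R : R, 1%R]].

Section graphons.
Context {R : realType}.
Implicit Types (f : R -> R -> R) (p t u : R).
Local Notation mu := (@lebesgue_measure R).

(* Representatives of the elements of W. All the functionals below are
   invariant under measure-preserving relabelling and only see the values on
   the unit square, so infima over W are infima over representatives. *)
Definition graphon : set (R -> R -> R) :=
  [set f : R -> R -> R | [/\ measurable_fun (I01 R `*` I01 R) (fun z : R * R => f z.1 z.2 : R),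
               forall x y, I01 R x -> I01 R y -> f x y = f y x
             & forall x y, I01 R x -> I01 R y -> 0 <= f x y <= 1]].

Definition edge_density f : R :=
  \int[mu]_(x in I01 R) \int[mu]_(y in I01 R) f x y.

Definition triangle_density f : R :=
  \int[mu]_(x in I01 R) \int[mu]_(y in I01 R) \int[mu]_(z in I01 R)
    (f x y * f y z * f x z).

Definition W_ t : set (R -> R -> R) :=
  [set f | graphon f /\ t ^+ 3 <= triangle_density f].

(* The convention 0 log 0 = 0 holds since 0 is absorbing. *)
Definition I_ p u : R :=
  2^-1 * (u * ln (u / p) + (1 - u) * ln ((1 - u) / (1 - p))).

Definition rate p f : R :=
  \int[mu]_(x in I01 R) \int[mu]_(y in I01 R) I_ p (f x y).

Definition phi p u : \bar R :=
  ereal_inf [set (rate p f)%:E |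
             f in [set f | graphon f /\ triangle_density f = u ^+ 3]].

End graphons.

(* {0,1}^(n choose 2), coordinates being indexed by the pairs i < j. *)
Definition vpair (n : nat) := {e : 'I_n * 'I_n | (e.1 < e.2)%N}.
Definition Omega (n : nat) := {ffun vpair n -> bool}.

Definition adj (n : nat) (X : Omega n) (i j : 'I_n) : bool :=
  [exists e : vpair n, X e && ((val e == (i, j)) || (val e == (j, i)))].

Section random_graphs.
Context {R : realType}.

(* Vertices are numbered from 0: vertex i occupies [i/n, (i+1)/n[. *)
Definition cell (n : nat) (i : 'I_n) : set R :=
  [set` `[(i%:R / n%:R : R), (i.+1%:R / n%:R : R)[].

Definition graphon_of (n : nat) (X : Omega n) (x y : R) : R :=
  \sum_(i < n) \sum_(j < n)
    (adj X i j)%:R * (\1_(cell i) x * \1_(cell j) y).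

(* Probability measures on the finite set Omega n are given by their mass
   functions. *)
Definition gnp (n : nat) (p : R) (X : Omega n) : R :=
  \prod_(e : vpair n) (if X e then p else 1 - p).

(* powR satisfies 0 `^ 0 = 1. *)
Definition gibbs_weight (h beta alpha : R) (n : nat) (X : Omega n) : R :=
  expR (n%:R ^+ 2 * (h / 2 * edge_density (graphon_of X)
                     + beta / 6 * (triangle_density (graphon_of X) `^ alpha))).

Definition gibbs (h beta alpha : R) (n : nat) (X : Omega n) : R :=
  gibbs_weight h beta alpha X /
  \sum_(Y : Omega n) gibbs_weight h beta alpha Y.

Definition second_moment (p t : R) (n : nat) (Q : Omega n -> R) : R :=
  \sum_(X : Omega n)
    Q X * (\1_(W_ t) (graphon_of X) * (gnp p X / Q X)) ^+ 2.

(* lne 0 = -oo *)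
Definition asymptotically_optimal (p t : R)
    (Q : forall n : nat, Omega n -> R) : Prop :=
  ((((n%:R ^+ 2)^-1)%:E * lne (second_moment p t (Q n))%:E)%E
     @[n --> \oo]
   --> (- (2%:E * ereal_inf [set (rate p f)%:E | f in W_ t]))%E).

Definition logit (p : R) : R := ln (p / (1 - p)).

End random_graphs.

(* Main.v *)
Require Import Defs.
From mathcomp Require Import all_boot all_order all_algebra.
From mathcomp Require Import all_classical all_reals all_analysis.
From mathcomp Require Import measurable_realfun ring lra.
Set Implicit Arguments.
Unset Strict Implicit.
Unset Printing Implicit Defensive.
Import Order.TTheory GRing.Theory Num.Theory.
Import numFieldNormedType.Exports.
Local Open Scope ring_scope.

(** Write P for the law of the random graph, T for the triangle density,
    psi(s) = beta / 6 * s ^ alpha and Q for the tilted measure. Since h is the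
    logit of p, Q is P weighted by exp (n^2 psi(T)), so that the second moment
    is the product of Z = E_P [exp (n^2 psi(T))] and
    V = E_P [exp (- n^2 psi(T)); T >= t^3] ([second_momentE]). Write phi for the
    variational function and I for the infimum of the rate on the event.

    Lower bound. By Cauchy-Schwarz the second moment is at least P(T >= t^3)^2
    whatever the tilt, so the lower half of the large deviation principle
    suffices ([large_deviation_lower_bound]): for each graphon f with
    T(f) >= t^3, P(T >= t^3) is at least exp (- n^2 (rate f + o(1))). The graphon
    f is replaced by a function G of finitely many measurable classes of vertices
    with values in ]0, 1[, with T(G) > t^3 and almost the same rate
    ([coded_approximation]), and G is blown up to n vertices ([blow_up]). Under
    the inhomogeneous random graph with these edge probabilities the mean of T
    exceeds t^3 by a constant; as T <= 1, the event T >= t^3 then has probability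
    bounded below, which is enough because the log-likelihood ratio, a sum of
    independent terms, concentrates at scale o(n^2) ([tilting_lower_bound]).

    Upper bound. A superadditivity argument for relative entropy shows that, for
    any set A of graphs, P(A) <= exp (- H(y)), where y is the mean adjacency
    matrix of P conditioned on A and H(y) is the relative entropy of the product
    measure with edge probabilities y ([relative_entropy_bound]). Up to O(n),
    H(y) is n^2 times the rate of the step graphon of y. The weak regularity
    lemma covers the graphs by exp (O(n)) cut-norm balls of a fixed small radius
    ([weak_regularity], [sum_cells]). A ball is convex, so the mean y of a cell
    stays in its ball, and T is Lipschitz in cut norm; hence T(y) is close to
    T(X) for each X in the cell ([cut_cell_bound]). So each cell contributes to Z
    at most exp (n^2 (psi(T(y)) - rate y + o(1))), and similarly for V. The
    hypothesis says precisely that psi(T(g)) - rate g <= psi(t^3) - phi(t) for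
    every graphon g ([maximizer_inequality]). It yields
    Z <= exp (n^2 (psi(t^3) - phi(t) + o(1))) and
    V <= exp (- n^2 (psi(t^3) + phi(t) - o(1))), hence the bound
    exp (- 2 n^2 (phi(t) - o(1))) for the product
    ([second_moment_upper_bound]), and phi(t) >= I.

    The value t = 1 is special, since no finite graph has T = 1. There the
    hypothesis cannot hold ([no_maximum_at_1]): the slope of I_p is infinite at 1
    while psi(u^3) has a bounded slope there, so u slightly below 1 does better
    than 1. *)

(** * Cut norm and weak regularity *)

Section cut_norm.
Context {R : realType} {n : nat}.
Implicit Types (M A B : 'I_n -> 'I_n -> R) (e : R).

Definition cut_sum M (S T : {set 'I_n}) : R :=
  \sum_(i in S) \sum_(j in T) M i j.

(** The normalized cut norm of [M] is at most [e]. It is defined through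
    index sets rather than as a norm, because the bound for all pairs of sets is
    what is both provided by the greedy algorithm and consumed by the counting
    estimate. *)
Definition cut_small e M :=
  forall S T, `|cut_sum M S T| <= e * n%:R ^+ 2.

Definition triangles M : R :=
  \sum_i \sum_j \sum_k M i j * M j k * M i k.

(** A linear function on the cube is largest at a vertex; this replaces the
    weights in a bilinear form by index sets. *)
Lemma sum_weight_le (I : finType) (a r : I -> R) :
  (forall i, 0 <= a i <= 1) ->
  exists S : {set I}, \sum_i a i * r i <= \sum_(i in S) r i.
Proof.
move=> a01; exists [set i | 0 <= r i]; rewrite [leRHS]big_mkcond /=.
apply: ler_sum => i _; rewrite inE; have /andP[a0 a1] := a01 i.
case: ifPn => [r0|]; first by rewrite ler_piMl.
by rewrite -ltNge => /ltW; exact: mulr_ge0_le0.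
Qed.

Lemma cut_small_bilinear e M (a b : 'I_n -> R) : cut_small e M ->
  (forall i, 0 <= a i <= 1) -> (forall i, 0 <= b i <= 1) ->
  \sum_i \sum_j M i j * (a i * b j) <= e * n%:R ^+ 2.
Proof.
move=> Me a01 b01.
have [S leS] := sum_weight_le (fun i => \sum_j M i j * b j) a01.
have [T leT] := sum_weight_le (fun j => \sum_(i in S) M i j) b01.
have h := le_trans (ler_norm _) (Me S T); apply: le_trans _ h.
rewrite /cut_sum [leRHS]exchange_big /=; apply: le_trans leT.
have -> : \sum_i \sum_j M i j * (a i * b j) = \sum_i a i * \sum_j M i j * b j.
  by apply: eq_bigr => i _; rewrite mulr_sumr; apply: eq_bigr => j _; ring.
apply: (le_trans leS); rewrite exchange_big /= le_eqVlt; apply/orP; left.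
by apply/eqP; apply: eq_bigr => j _; rewrite mulr_sumr; apply: eq_bigr => i _; ring.
Qed.

(** Counting lemma: exchange [A] for [B] in one factor at a time. For a fixed
    value of the index that the exchanged factor lacks, the other two factors are
    weights in [0, 1], one per remaining index, so the cut norm bounds the sum. *)
Lemma triangles_cut_le e A B : cut_small e (fun i j => A i j - B i j) ->
  (forall i j, 0 <= A i j <= 1) -> (forall i j, 0 <= B i j <= 1) ->
  triangles A <= triangles B + 3 * e * n%:R ^+ 3.
Proof.
move=> De A01 B01; rewrite -lerBlDl.
have -> : triangles A - triangles B =
   \sum_k \sum_i \sum_j (A i j - B i j) * (A i k * A j k)
   + \sum_i \sum_j \sum_k (A j k - B j k) * (B i j * A i k)
   + \sum_j \sum_i \sum_k (A i k - B i k) * (B i j * B j k).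
  rewrite [X in X + _ + _]exchange_big /=.
  under [X in X + _ + _]eq_bigr do rewrite exchange_big /=.
  rewrite [X in _ + _ + X]exchange_big /=.
  rewrite -sumrB -!big_split; apply: eq_bigr => i _ /=.
  rewrite -sumrB -!big_split; apply: eq_bigr => j _ /=.
  rewrite -sumrB -!big_split; apply: eq_bigr => k _ /=; ring.
have bound (F : 'I_n -> R) : (forall i, F i <= e * n%:R ^+ 2) ->
    \sum_i F i <= e * n%:R ^+ 3.
  move=> Fe; apply: le_trans (ler_sum _ (fun i _ => Fe i)) _.
  by rewrite sumr_const card_ord -[leLHS]mulr_natr -mulrA -exprSr.
have -> : 3 * e * n%:R ^+ 3 = e * n%:R ^+ 3 + e * n%:R ^+ 3 + e * n%:R ^+ 3.
  by ring.
by apply: lerD; [apply: lerD|]; apply: bound => k; apply: cut_small_bilinear.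
Qed.

Lemma cut_small_sym e A B : cut_small e (fun i j => A i j - B i j) ->
  cut_small e (fun i j => B i j - A i j).
Proof.
move=> De S T; rewrite -normrN; apply: le_trans (De S T); rewrite /cut_sum.
rewrite -sumrN; under eq_bigr => i _ do rewrite -sumrN.
by under eq_bigr => i _ do under eq_bigr => j _ do rewrite opprB.
Qed.

Lemma cut_sumD M A S T :
  cut_sum (fun i j => M i j + A i j) S T = cut_sum M S T + cut_sum A S T.
Proof.
rewrite /cut_sum -big_split; apply: eq_bigr => i _ /=.
by rewrite -big_split.
Qed.

Lemma cut_small_trans e1 e2 A B C :
  cut_small e1 (fun i j => A i j - B i j) ->
  cut_small e2 (fun i j => B i j - C i j) ->
  cut_small (e1 + e2) (fun i j => A i j - C i j).
Proof.
move=> h1 h2 S T; rewrite mulrDl; apply: le_trans (lerD (h1 S T) (h2 S T)).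
apply: le_trans (ler_normD _ _); rewrite -cut_sumD le_eqVlt; apply/orP; left.
by apply/eqP; congr `|_|; apply: eq_bigr => i _; apply: eq_bigr => j _; ring.
Qed.

(** An elementary signed rectangle; the sign is a boolean so that rectangles form
    a finite type and lists of them can be counted. *)
Definition rect (o : {set 'I_n} * {set 'I_n} * bool) i j : R :=
  (-1) ^+ o.2 * ((i \in o.1.1) && (j \in o.1.2))%:R.

Definition rect_sum e (s : seq ({set 'I_n} * {set 'I_n} * bool)) i j : R :=
  e * \sum_(o <- s) rect o i j.

Lemma sum_rectM M S T b :
  \sum_i \sum_j M i j * rect (S, T, b) i j = (-1) ^+ b * cut_sum M S T.
Proof.
rewrite /cut_sum [in RHS]big_mkcond mulr_sumr; apply: eq_bigr => i _ /=.
case: (boolP (i \in S)) => iS; last first.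
  by rewrite mulr0; apply: big1 => j _; rewrite /rect /= (negPf iS) /= !mulr0.
rewrite [in RHS]big_mkcond mulr_sumr; apply: eq_bigr => j _ /=.
by rewrite /rect /= iS /=; case: ifP => _ /=; ring.
Qed.

Lemma sum_rect_sqr o : \sum_i \sum_j rect o i j ^+ 2 <= n%:R ^+ 2.
Proof.
apply: (@le_trans _ _ (\sum_(i < n) \sum_(j < n) 1)).
  apply: ler_sum => i _; apply: ler_sum => j _.
  by rewrite /rect exprMn sqrr_sign mul1r; case: (_ && _); rewrite ?expr1n ?expr0n.
by rewrite !sumr_const !card_ord -mulrnA mulnn natrX.
Qed.

(** Frieze-Kannan: as long as some rectangle has a large sum, subtracting [e]
    times its signed indicator lowers the squared L2 norm by at least
    [e ^+ 2 * n%:R ^+ 2], which bounds the number of steps. The fixed step [e]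
    (instead of the optimal one) leaves only finitely many sums of [m]
    rectangles. *)
Lemma weak_regularity e (m : nat) M : 0 < e ->
  \sum_i \sum_j M i j ^+ 2 <= m%:R * e ^+ 2 * n%:R ^+ 2 ->
  exists s : m.-tuple ({set 'I_n} * {set 'I_n} * bool),
    cut_small e (fun i j => M i j - rect_sum e s i j).
Proof.
move=> e0; elim: m M => [|m IH] M.
  rewrite !mul0r => M0; exists [tuple] => S T.
  have M00 i j : M i j = 0.
    apply/eqP; rewrite -sqrf_eq0; move: M0.
    rewrite le_eqVlt ltNge sumr_ge0 ?orbF; last first.
      by move=> k _; apply: sumr_ge0 => l _; exact: sqr_ge0.
    rewrite psumr_eq0; last by move=> k _; apply: sumr_ge0 => l _; exact: sqr_ge0.
    move=> /allP/(_ i (mem_index_enum _))/=.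
    rewrite psumr_eq0; last by move=> l _; exact: sqr_ge0.
    by move=> /allP/(_ j (mem_index_enum _)).
  rewrite /cut_sum big1 ?normr0; first by rewrite mulr_ge0 ?sqr_ge0 ?ltW.
  move=> i _; apply: big1 => j _; rewrite M00 /rect_sum big_nil mulr0 subrr //.
move=> leM; have [Me|] := pselect (cut_small e M).
  (* Empty rectangles pad the list to its fixed length. *)
  exists [tuple of nseq m.+1 (finset.set0, finset.set0, false)] => S T.
  have <- : cut_sum M S T = cut_sum (fun i j => M i j -
     rect_sum e (nseq m.+1 (finset.set0, finset.set0, false)) i j) S T; last exact: Me.
  apply: eq_bigr => i _; apply: eq_bigr => j _.
  rewrite /rect_sum big1_seq ?mulr0 ?subr0// => o /andP[_].
  by rewrite mem_nseq /= => /eqP ->; rewrite /rect /= inE /= mulr0.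
move=> /existsNP[S /existsNP[T /negP]]; rewrite -ltNge => big.
(* The sign for which the rectangle is positively correlated with M. *)
pose b := cut_sum M S T < 0.
pose M' i j := M i j - e * rect (S, T, b) i j.
have [|s Hs] := IH M'.
  have -> : \sum_i \sum_j M' i j ^+ 2 = \sum_i \sum_j M i j ^+ 2
      - 2 * e * (\sum_i \sum_j M i j * rect (S, T, b) i j)
      + e ^+ 2 * (\sum_i \sum_j rect (S, T, b) i j ^+ 2).
    rewrite !mulr_sumr -sumrB -big_split; apply: eq_bigr => i _ /=.
    rewrite !mulr_sumr -sumrB -big_split; apply: eq_bigr => j _ /=.
    by rewrite /M'; ring.
  rewrite sum_rectM.
  have -> : (-1) ^+ b * cut_sum M S T = `|cut_sum M S T|.
    rewrite /b; case: ltP => [/ltr0_norm ->|/ger0_norm ->].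
      by rewrite expr1 mulN1r.
    by rewrite expr0 mul1r.
  have h1 := sum_rect_sqr (S, T, b).
  have h2 : e ^+ 2 * \sum_i \sum_j rect (S, T, b) i j ^+ 2 <= e ^+ 2 * n%:R ^+ 2.
    by rewrite ler_wpM2l ?sqr_ge0.
  have h3 : e * (e * n%:R ^+ 2) <= e * `|cut_sum M S T|.
    by rewrite ler_pM2l // ltW.
  move: leM h2 h3; rewrite -natr1; set a := \sum_i _; set b' := e ^+ 2 * \sum_i _.
  move=> leM h2 h3; nra.
exists [tuple of (S, T, b) :: s] => S' T'.
apply: le_trans (Hs S' T'); rewrite le_eqVlt; apply/orP; left; apply/eqP.
congr `|_|; apply: eq_bigr => i _; apply: eq_bigr => j _.
by rewrite /M' /rect_sum big_cons; ring.
Qed.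

End cut_norm.

(** * Products of Bernoulli laws: entropy and tilting *)

Section bernoulli_products.
Context {R : realType} {E : finType}.
Implicit Types (y : E -> R) (p : R) (X : {ffun E -> bool}).

Definition bern (u : R) (b : bool) : R := if b then u else 1 - u.

Definition bern_prod y X : R := \prod_e bern (y e) (X e).

Lemma sum_prod_ffun (F : E -> bool -> R) :
  \sum_(X : {ffun E -> bool}) \prod_e F e (X e) = \prod_e (F e true + F e false).
Proof.
rewrite -(bigA_distr_bigA F); apply: eq_bigr => e _.
by rewrite big_bool.
Qed.

Lemma bern_ge0 u b : 0 <= u <= 1 -> 0 <= bern u b.
Proof. by case: b => /= /andP[] //; rewrite subr_ge0. Qed.

Lemma bern_gt0 u b : 0 < u < 1 -> 0 < bern u b.
Proof. by case: b => /= /andP[] //; rewrite subr_gt0. Qed.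

Lemma bern_prod_ge0 y X : (forall e, 0 <= y e <= 1) -> 0 <= bern_prod y X.
Proof. by move=> y01; apply: prodr_ge0 => e _; exact: bern_ge0. Qed.

Lemma bern_prod_gt0 y X : (forall e, 0 < y e < 1) -> 0 < bern_prod y X.
Proof. by move=> y01; apply: prodr_gt0 => e _; exact: bern_gt0. Qed.

Lemma sum_bern_prod y : \sum_X bern_prod y X = 1.
Proof.
by rewrite (sum_prod_ffun (fun e => bern (y e))) big1 // => e _ /=; rewrite addrC subrK.
Qed.

Lemma ln_prod_gt0 (F : E -> R) : (forall e, 0 < F e) ->
  ln (\prod_e F e) = \sum_e ln (F e).
Proof.
move=> F0; apply: (@proj2 (0 < \prod_e F e)).
elim/big_rec2 : _ => [|e x z _ [z0 IH]]; first by rewrite ln1.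
by split; [exact: mulr_gt0|rewrite lnM ?posrE// IH].
Qed.

Lemma I_bernE p u : 0 < p < 1 -> 0 <= u <= 1 ->
  2 * I_ p u = u * (ln u - ln p) + (1 - u) * (ln (1 - u) - ln (1 - p)).
Proof.
move=> /andP[p0 p1] /andP[u0 u1]; rewrite /I_ mulrA divff ?pnatr_eq0// mul1r.
have lnd a b : 0 <= a -> 0 < b -> a * ln (a / b) = a * (ln a - ln b).
  rewrite le_eqVlt => /predU1P[<-|a0] b0; first by rewrite !mul0r.
  by rewrite ln_div ?posrE.
by rewrite !lnd ?subr_ge0 ?subr_gt0.
Qed.

(** The bound is [ln (1 / P(A)) = KL(nu || P) >= sum_e KL(nu_e || P_e)], where
    [nu] is [P] conditioned on [A] and [nu_e] is the marginal of [nu] at [e], a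
    Bernoulli law of parameter [y e]. The inequality holds because the difference
    of the two sides is the relative entropy of [nu] with respect to the product
    of its marginals. *)
Lemma relative_entropy_bound p (A : {set {ffun E -> bool}}) :
  0 < p < 1 -> A != finset.set0 ->
  let P := bern_prod (fun=> p) in
  let y e := (\sum_(X in A) P X)^-1 * \sum_(X in A) P X * (X e)%:R in
  (forall e, 0 <= y e <= 1) /\
  \sum_(X in A) P X <= expR (- \sum_e 2 * I_ p (y e)).
Proof.
move=> p01 /finset.set0Pn[X0 X0A] P y.
have P0 X : 0 < P X by exact: bern_prod_gt0.
set PA := \sum_(X in A) P X in y *.
have PA0 : 0 < PA.
  rewrite /PA (bigD1 X0) //= ltr_pwDl // sumr_ge0 // => X _; exact: ltW.
pose nu X := PA^-1 * P X.
have nu0 X : 0 < nu X by rewrite mulr_gt0 ?invr_gt0.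
have nu1 : \sum_(X in A) nu X = 1.
  by rewrite -mulr_sumr mulVf ?gt_eqF.
have yE e : y e = \sum_(X in A) nu X * (X e)%:R.
  by rewrite /y mulr_sumr; apply: eq_bigr => X _; rewrite mulrA.
have yCE e : 1 - y e = \sum_(X in A) nu X * (~~ X e)%:R.
  rewrite yE -[X in X - _]nu1 -sumrB; apply: eq_bigr => X _.
  by case: (X e) => /=; ring.
have y01 e : 0 <= y e <= 1.
  rewrite -[_ <= 1]subr_ge0 yCE yE !sumr_ge0// => X _; by rewrite mulr_ge0 // ltW.
split=> //.
have bE e b : bern (y e) b = \sum_(X in A) nu X * (X e == b)%:R.
  case: b => /=; [rewrite yE|rewrite yCE]; apply: eq_bigr => X _;
   by case: (X e).
(* Members of A have positive mass under the product of the marginals, so their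
   logarithms below are genuine. *)
have q0 X : X \in A -> 0 < bern_prod y X.
  move=> XA; apply: prodr_gt0 => e _; rewrite bE (bigD1 X) //= eqxx mulr1.
  by rewrite ltr_pwDl // sumr_ge0 // => Y _; rewrite mulr_ge0 // ltW.
have avg (g : E -> bool -> R) : \sum_(X in A) nu X * \sum_e g e (X e) =
    \sum_e (y e * g e true + (1 - y e) * g e false).
  under eq_bigr do rewrite mulr_sumr.
  rewrite exchange_big; apply: eq_bigr => e _ /=.
  rewrite yCE yE !mulr_suml -big_split; apply: eq_bigr => X _ /=.
  by case: (X e) => /=; ring.
(* This is ln r <= r - 1 for the ratio r of the two masses. *)
have ineq X : X \in A ->
    nu X * (ln (bern_prod y X) - ln (P X) + ln PA) <= bern_prod y X - nu X.
  move=> XA.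
  have -> : ln (bern_prod y X) - ln (P X) + ln PA = ln (bern_prod y X / nu X).
    rewrite ln_div ?posrE ?q0 // /nu lnM ?posrE ?invr_gt0// lnV ?posrE//.
    ring.
  rewrite -[X in _ <= X](mulfVK (lt0r_neq0 (nu0 X))) mulrC ler_pM2r // mulrBl.
  rewrite divff ?lt0r_neq0 //.
  have := @le_ln1Dx _ (bern_prod y X / nu X - 1).
  rewrite (addrC 1) subrK; apply; rewrite ltrBrDr addrC subrr.
  by rewrite divr_gt0 ?q0.
have le0 : \sum_(X in A) nu X * (ln (bern_prod y X) - ln (P X) + ln PA) <= 0.
  apply: le_trans (ler_sum _ ineq) _; rewrite sumrB nu1 subr_le0.
  rewrite [leLHS]big_mkcond -[leRHS](sum_bern_prod y) /=; apply: ler_sum => X _.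
  by case: ifP => // _; apply: bern_prod_ge0.
have decomp : \sum_(X in A) nu X * (ln (bern_prod y X) - ln (P X) + ln PA) =
    \sum_e 2 * I_ p (y e) + ln PA.
  under eq_bigr do rewrite mulrDr; rewrite big_split /=; congr (_ + _); last first.
    by rewrite -mulr_suml nu1 mul1r.
  under [RHS]eq_bigr do rewrite I_bernE //.
  rewrite -(avg (fun e b => ln (bern (y e) b) - ln (bern p b))).
  apply: eq_bigr => X XA; congr (_ * _); rewrite sumrB.
  rewrite -!ln_prod_gt0 // => e; first exact: bern_gt0.
  have := q0 X XA; rewrite /bern_prod (bigD1 e) //= => h.
  have := bern_ge0 (X e) (y01 e); rewrite le_eqVlt => /predU1P[h0|//].
  by rewrite -h0 mul0r ltxx in h.
rewrite -[leLHS]lnK ?posrE // ler_expR; move: le0; rewrite decomp => h; rewrite lerNr; lra.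
Qed.

(** Obtained by inverting [1 - x <= expR (- x)]. *)
Lemma expR_le_quadratic (x : R) : x <= 2^-1 -> expR x <= 1 + x + 2 * x ^+ 2.
Proof.
move=> x2; have := expR_ge1Dx (- x); rewrite expRN => h.
have x1 : 0 < 1 - x by lra.
have : expR x * (1 - x) <= 1.
  have e0 := expR_gt0 x.
  by rewrite -[leRHS](divff (lt0r_neq0 e0)) ler_pM2l.
have : 1 <= (1 + x + 2 * x ^+ 2) * (1 - x) by nra.
by move=> h1 h2; rewrite -(ler_pM2r x1); exact: le_trans h2 h1.
Qed.

(** Change of measure: on the event that the log-likelihood ratio exceeds its
    mean, which is the sum of the [2 * I_ p (y e)], by at most [d], passing from
    the tilted law to [P] costs at most the factor
    [expR (- d - \sum_e 2 * I_ p (y e))]. The complement of this event has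
    a Chernoff bound with parameter [th]; the ratio is a sum of independent terms
    bounded by [C]. *)
Lemma tilting_lower_bound p y (A : {set {ffun E -> bool}}) (C th d : R) :
  0 < p < 1 -> (forall e, 0 < y e < 1) ->
  (forall e b, `|ln (bern (y e) b / bern p b)| <= C) ->
  0 <= th -> 4 * C * th <= 1 ->
  (\sum_(X in A) bern_prod y X
     - expR (8 * C ^+ 2 * th ^+ 2 * #|E|%:R - th * d))
  * expR (- d - \sum_e 2 * I_ p (y e))
  <= \sum_(X in A) bern_prod (fun=> p) X.
Proof.
move=> p01 y01 sC th0 Cth.
pose s e b := ln (bern (y e) b / bern p b).
pose H := \sum_e 2 * I_ p (y e).
pose S (X : {ffun E -> bool}) := \sum_e s e (X e).
have mE e : 2 * I_ p (y e) = y e * s e true + (1 - y e) * s e false.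
  have /andP[p0 p1] := p01; have /andP[y0 y1] := y01 e.
  by rewrite /s /= I_bernE // ?(ltW y0) ?(ltW y1)// !ln_div ?posrE ?subr_gt0.
have PE X : bern_prod (fun=> p) X = bern_prod y X * expR (- S X).
  rewrite /bern_prod /S -sumrN expR_sum -big_split; apply: eq_bigr => e _ /=.
  have b0 := bern_gt0 (X e) p01; have b1 := bern_gt0 (X e) (y01 e).
  rewrite expRN lnK ?posrE ?divr_gt0// invf_div mulrCA divff ?mulr1//.
  by rewrite gt_eqF.
have Q0 X : 0 < bern_prod y X by exact: bern_prod_gt0.
(* Chernoff bound; the exponential moment factorizes over e. *)
have tail : \sum_(X | S X > H + d) bern_prod y X <=
    expR (8 * C ^+ 2 * th ^+ 2 * #|E|%:R - th * d).
  apply: (@le_trans _ _ (\sum_X bern_prod y X * expR (th * (S X - H - d)))).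
    rewrite big_mkcond /=; apply: ler_sum => X _; case: ifPn => h.
      rewrite ler_peMr ?(ltW (Q0 X))// -expR0 ler_expR mulr_ge0//; lra.
    by rewrite mulr_ge0 ?expR_ge0// ltW.
  have -> : \sum_X bern_prod y X * expR (th * (S X - H - d)) =
     expR (- th * d) * \sum_(X : {ffun E -> bool}) \prod_e (bern (y e) (X e) *
        expR (th * (s e (X e) - 2 * I_ p (y e)))).
    rewrite mulr_sumr; apply: eq_bigr => X _.
    rewrite big_split /= -/(bern_prod y X) -expR_sum mulrCA -expRD.
    congr (_ * expR _); rewrite -mulr_sumr sumrB -/(S X) -/H; ring.
  rewrite (sum_prod_ffun (fun e b => bern (y e) b *
     expR (th * (s e b - 2 * I_ p (y e))))).
  rewrite [X in _ <= expR X]addrC -mulNr expRD ler_pM2l ?expR_gt0 //.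
  rewrite mulr_natr -sumr_const expR_sum; apply: ler_prod => e _.
  have yy := y01 e; have /andP[y0 y1] := yy.
  apply/andP; split.
    by rewrite addr_ge0// mulr_ge0 ?expR_ge0// ltW// subr_gt0.
  apply: le_trans (expR_ge1Dx _).
  have C0 : 0 <= C by exact: le_trans (normr_ge0 _) (sC e true).
  have := sC e true; have := sC e false; rewrite -/(s e true) -/(s e false).
  rewrite !ler_norml => /andP[f1 f2] /andP[t1 t2].
  have mC : - C <= 2 * I_ p (y e) <= C by rewrite mE; apply/andP; split; nra.
  have /andP[m1 m2] := mC.
  have bnd b : `|s e b - 2 * I_ p (y e)| <= 2 * C.
    by rewrite ler_norml; case: b; apply/andP; split; lra.
  have term b : expR (th * (s e b - 2 * I_ p (y e))) <=
      1 + th * (s e b - 2 * I_ p (y e)) + 8 * C ^+ 2 * th ^+ 2.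
    have := bnd b; set z := s e b - _ => zb.
    have zz : th * z <= 2^-1.
      apply: (@le_trans _ _ (th * (2 * C))); last by nra.
      by rewrite ler_wpM2l// (le_trans (ler_norm _)).
    apply: le_trans (expR_le_quadratic zz) _; rewrite lerD2l.
    have : z ^+ 2 <= (2 * C) ^+ 2.
      by rewrite -real_normK ?num_real// lerXn2r// nnegrE// mulr_ge0.
    have : 0 <= th ^+ 2 by exact: sqr_ge0.
    rewrite exprMn; nra.
  apply: (@le_trans _ _ (y e * (1 + th * (s e true - 2 * I_ p (y e)) + 8 * C ^+ 2 * th ^+ 2) +
     (1 - y e) * (1 + th * (s e false - 2 * I_ p (y e)) + 8 * C ^+ 2 * th ^+ 2))).
    by apply: lerD; rewrite ler_wpM2l// ?ltW// subr_gt0.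
  rewrite le_eqVlt; apply/orP; left; apply/eqP; rewrite mE; ring.
apply: (@le_trans _ _ (expR (- d - H) * \sum_(X in A | ~~ (S X > H + d)) bern_prod y X)).
  rewrite mulrC ler_pM2l ?expR_gt0// lerBlDr.
  rewrite [leLHS](bigID (fun X => S X > H + d)) /= addrC lerD2l.
  apply: le_trans tail; rewrite big_mkcondl; apply: ler_sum => X _.
  by case: ifP => // _; exact: ltW.
rewrite [leRHS](bigID (fun X => S X > H + d)) /=.
rewrite -[leLHS]add0r; apply: lerD.
  by apply: sumr_ge0 => X _; apply: bern_prod_ge0 => e; have/andP[p0 p1] := p01; rewrite !ltW.
rewrite mulr_sumr; apply: ler_sum => X /andP[_]; rewrite -leNgt => h.
by rewrite PE mulrC ler_pM2l// ler_expR; lra.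
Qed.

End bernoulli_products.

(** * The entropy function and the modulus of powers *)

Section entropy_function.
Context {R : realType}.
Implicit Types p u v w : R.

(** The derivative of [I_ p] at [w]. *)
Definition I_slope p w : R := 2^-1 * (ln (w / p) - ln ((1 - w) / (1 - p))).

(** At [v = 0] this relies on [0 * ln 0 = 0]. *)
Lemma subr_le_mul_ln v w : 0 <= v -> 0 < w -> v - w <= v * (ln v - ln w).
Proof.
rewrite le_eqVlt => /predU1P[<-|v0] w0; first by rewrite mul0r sub0r oppr_le0 ltW.
have := @le_ln1Dx _ (w / v - 1).
rewrite (addrC 1) subrK ln_div ?posrE // => h.
have {}h : ln w - ln v <= w / v - 1.
  by apply: h; rewrite ltrBrDr addrC subrr divr_gt0.
rewrite -(ler_pM2l v0) in h.
have e : v * (w / v - 1) = w - v by field; rewrite gt_eqF.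
by rewrite e in h; lra.
Qed.

(** The gap between the two sides is half the relative entropy of the Bernoulli
    law of parameter [v] with respect to that of parameter [w]. All convexity of
    [I_ p] is used in this form, which covers the end points [v = 0] and
    [v = 1]. *)
Lemma I_tangent p w v : 0 < p < 1 -> 0 < w < 1 -> 0 <= v <= 1 ->
  I_ p w + I_slope p w * (v - w) <= I_ p v.
Proof.
move=> p01 w01 v01; have /andP[p0 p1] := p01; have /andP[w0 w1] := w01.
have /andP[v0 v1] := v01.
have E u : 0 <= u <= 1 ->
   I_ p u = 2^-1 * (u * (ln u - ln p) + (1 - u) * (ln (1 - u) - ln (1 - p))).
  by move=> u01; rewrite -I_bernE// mulrA mulVf ?mul1r ?pnatr_eq0.
rewrite !E // ?(ltW w0) ?(ltW w1)// /I_slope !ln_div ?posrE ?subr_gt0//.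
have h1 := subr_le_mul_ln v0 w0.
have v0' : 0 <= 1 - v by rewrite subr_ge0.
have w0' : 0 < 1 - w by rewrite subr_gt0.
have h2 := subr_le_mul_ln v0' w0'.
move: h1 h2; set a := ln v; set b := ln w; set c := ln (1 - v); set d := ln (1 - w).
set e := ln p; set f := ln (1 - p) => h1 h2.
rewrite -mulrA -mulrDr ler_pM2l ?invr_gt0// .
have -> : w * (b - e) + (1 - w) * (d - f) + (b - e - (d - f)) * (v - w) =
  v * (b - e) + (1 - v) * (d - f) by ring.
by lra.
Qed.

Lemma I_pp p : 0 < p < 1 -> I_ p p = 0.
Proof.
move=> /andP[p0 p1]; rewrite /I_ !divff ?gt_eqF ?subr_gt0//.
by rewrite ln1 !mulr0 addr0 mulr0.
Qed.

Lemma I_ge0 p v : 0 < p < 1 -> 0 <= v <= 1 -> 0 <= I_ p v.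
Proof.
move=> p01 v01; have /andP[p0 p1] := p01.
have := I_tangent p01 p01 v01; rewrite I_pp // /I_slope !divff ?gt_eqF ?subr_gt0//.
by rewrite ln1 subrr mulr0 mul0r addr0.
Qed.

(** Convexity of [I_ p] for a mixture of [v], [1] and [0] with weights [a], [b]
    and [c]. *)
Lemma I_mix_le p v (a b c : R) : 0 < p < 1 -> 0 <= v <= 1 ->
  0 <= a -> 0 <= b -> 0 <= c -> a + b + c = 1 -> 0 < a * v + b < 1 ->
  I_ p (a * v + b) <= I_ p v + b * I_ p 1 + c * I_ p 0.
Proof.
move=> p01 v01 a0 b0 c0 abc w01; set w := a * v + b in w01 *.
have Tv := I_tangent p01 w01 v01.
have T1 : I_ p w + I_slope p w * (1 - w) <= I_ p 1.
  by apply: I_tangent; rewrite ?ler01 ?lexx.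
have T0 : I_ p w + I_slope p w * (0 - w) <= I_ p 0.
  by apply: I_tangent; rewrite ?ler01 ?lexx.
have Iv := I_ge0 p01 v01.
have aIv : a * I_ p v <= I_ p v by rewrite ler_piMl//; lra.
have -> : I_ p w = a * (I_ p w + I_slope p w * (v - w)) +
   b * (I_ p w + I_slope p w * (1 - w)) + c * (I_ p w + I_slope p w * (0 - w)).
  have -> : c = 1 - a - b by lra.
  by rewrite /w; ring.
have := ler_wpM2l a0 Tv; have := ler_wpM2l b0 T1; have := ler_wpM2l c0 T0; lra.
Qed.

(** Both [a / (a + b)] and [b / (a + b)] are at most their own powers of
    exponent [al], and they add up to 1. *)
Lemma powR_subadditive (al a b : R) : 0 < al <= 1 -> 0 <= a -> 0 <= b ->
  (a + b) `^ al <= a `^ al + b `^ al.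
Proof.
move=> /andP[al0 al1] a0 b0.
have [s0|s0] := ltP 0 (a + b); last first.
  have -> : a = 0 by lra.
  have -> : b = 0 by lra.
  by rewrite addr0 lerDl powR_ge0.
have key x : 0 <= x -> x <= a + b -> x / (a + b) * (a + b) `^ al <= x `^ al.
  move=> x0 xs.
  have {2}-> : x = x / (a + b) * (a + b) by field; rewrite gt_eqF.
  rewrite powRM ?divr_ge0 ?(ltW s0)// ler_pM2r ?powR_gt0//.
  move: x0; rewrite le_eqVlt => /predU1P[<-|x0]; first by rewrite mul0r powR0 ?gt_eqF.
  by apply: ger1_powR; rewrite // divr_gt0//= ler_pdivrMr// mul1r.
have -> : (a + b) `^ al = a / (a + b) * (a + b) `^ al + b / (a + b) * (a + b) `^ al.
  by rewrite -mulrDl -mulrDl divff ?gt_eqF// mul1r.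
by apply: lerD; apply: key => //; lra.
Qed.

(** A one-sided uniform modulus of continuity on the half-line. For [al = 0] the
    power is constantly 1, also at 0; for [al > 0] subadditivity applies. *)
Lemma powR_modulus (al eta : R) : 0 <= al <= 1 -> 0 < eta ->
  exists2 e : R, 0 < e & forall s s', 0 <= s -> 0 <= s' ->
    s <= s' + e -> s `^ al <= s' `^ al + eta.
Proof.
move=> /andP[]; rewrite le_eqVlt => /predU1P[<-|al0] al1 eta0.
  by exists 1 => // s s' _ _ _; rewrite !powRr0 lerDl ltW.
(* The solution of e ^ al = eta. *)
exists (eta `^ al^-1); first by rewrite powR_gt0.
move=> s s' s0 s'0 h.
have -> : eta = (eta `^ al^-1) `^ al.
  by rewrite -powRrM mulVf ?gt_eqF// powRr1 ?ltW.
apply: le_trans (@powR_subadditive _ _ _ _ s'0 (powR_ge0 _ _)); last by rewrite al0.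
by apply: ge0_ler_powR => //; rewrite ?ltW// nnegrE addr_ge0 ?powR_ge0.
Qed.

End entropy_function.

Local Open Scope classical_set_scope.
Local Open Scope ring_scope.

(** * Bounded measurable functions and their means over the unit interval *)

Section bounded_measurable.
Context d {T : measurableType d} {R : realType}.
Implicit Types f g : T -> R.

(** The class of integrands for which all the means below behave as they do for
    finite sums: it is stable under sums, products, compositions and partial
    means, and its members are integrable over the unit interval. *)
Definition bounded_measurable f :=
  measurable_fun [set: T] f /\ exists C : R, forall x, `|f x| <= C.

Lemma bounded_measurable_cst c : bounded_measurable (fun=> c).
Proof. by split; [exact: measurable_cst|exists `|c|]. Qed.

Lemma bounded_measurableD f g : bounded_measurable f -> bounded_measurable g ->
  bounded_measurable (fun x => f x + g x).
Proof.
move=> [mf [C hC]] [mg [D hD]]; split; first exact: measurable_funD.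
by exists (C + D) => x; rewrite (le_trans (ler_normD _ _))// lerD.
Qed.

Lemma bounded_measurableM f g : bounded_measurable f -> bounded_measurable g ->
  bounded_measurable (fun x => f x * g x).
Proof.
move=> [mf [C hC]] [mg [D hD]]; split; first exact: measurable_funM.
by exists (C * D) => x; rewrite normrM ler_pM.
Qed.

Lemma bounded_measurableN f : bounded_measurable f ->
  bounded_measurable (fun x => - f x).
Proof.
move=> [mf [C hC]]; split; first exact: measurableT_comp.
by exists C => x; rewrite normrN.
Qed.

Lemma bounded_measurableB f g : bounded_measurable f -> bounded_measurable g ->
  bounded_measurable (fun x => f x - g x).
Proof.
by move=> bf bg; apply: bounded_measurableD => //; exact: bounded_measurableN.
Qed.

Lemma bounded_measurable_norm f : bounded_measurable f ->
  bounded_measurable (fun x => `|f x|).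
Proof.
move=> [mf [C hC]]; split; first exact: measurableT_comp.
by exists C => x; rewrite normr_id.
Qed.

Lemma bounded_measurable_sum (I : Type) (s : seq I) (F : I -> T -> R) :
  (forall i, bounded_measurable (F i)) ->
  bounded_measurable (fun x => \sum_(i <- s) F i x).
Proof.
move=> bF; elim: s => [|i s IH].
  under eq_fun do rewrite big_nil; exact: bounded_measurable_cst.
by under eq_fun do rewrite big_cons; exact: bounded_measurableD.
Qed.

Lemma bounded_measurable_unit f : measurable_fun [set: T] f ->
  (forall x, 0 <= f x <= 1) -> bounded_measurable f.
Proof.
move=> mf f01; split => //; exists 1 => x.
by have /andP[f0 f1] := f01 x; rewrite ger0_norm.
Qed.

Lemma bounded_measurable_indic (A : set T) :
  measurable A -> bounded_measurable (\1_A : T -> R).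
Proof.
move=> mA; split; first exact: measurable_indic.
by exists 1 => x; rewrite indicE; case: (_ \in _); rewrite ?normr1 ?normr0.
Qed.

End bounded_measurable.

Lemma bounded_measurable_comp d d' {T : measurableType d} {T' : measurableType d'}
    {R : realType} (f : T' -> R) (h : T -> T') :
  bounded_measurable f -> measurable_fun [set: T] h ->
  bounded_measurable (fun x => f (h x)).
Proof.
move=> [mf [C hC]] mh; split; first exact: (measurableT_comp mf mh).
by exists C => x.
Qed.

Section unit_interval_mean.
Context {R : realType}.
Local Notation mu := (@lebesgue_measure R).
Local Notation J h := (\int[mu]_(x in I01 R) h x).

Lemma measurable_I01 : measurable (I01 R). Proof. exact: measurable_itv. Qed.

Lemma mu_I01 : mu (I01 R) = 1%E.
Proof. by rewrite lebesgue_measure_itv /= lte_fin ltr01 -EFinB subr0. Qed.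

Lemma integrable_I01 (h : R -> R) : bounded_measurable h ->
  mu.-integrable (I01 R) (EFin \o h).
Proof.
move=> [mh [C hC]]; apply: measurable_bounded_integrable.
- exact: measurable_I01.
- by change (mu (I01 R) < +oo)%E; rewrite mu_I01 ltry.
- exact: measurable_funTS.
- exists C; split; first exact: num_real.
  by move=> M CM x _; apply: (le_trans (hC x)); exact: ltW.
Qed.

Lemma mean_cst (c : R) : J (fun=> c) = c.
Proof. by rewrite Rintegral_cst// [X in fine X](_ : _ = 1%E) ?mulr1//; exact: mu_I01. Qed.

Lemma mean_le (f g : R -> R) : bounded_measurable f -> bounded_measurable g ->
  (forall x, I01 R x -> f x <= g x) -> J f <= J g.
Proof.
by move=> bf bg fg; apply: le_Rintegral => //; exact: integrable_I01.
Qed.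

Lemma meanD (f g : R -> R) : bounded_measurable f -> bounded_measurable g ->
  J (fun x => f x + g x) = J f + J g.
Proof. by move=> bf bg; rewrite RintegralD //; exact: integrable_I01. Qed.

Lemma meanZ c (f : R -> R) : bounded_measurable f ->
  J (fun x => c * f x) = c * J f.
Proof. by move=> bf; rewrite RintegralZl//; exact: integrable_I01. Qed.

Lemma mean_sum (I : Type) (s : seq I) (F : I -> R -> R) :
  (forall i, bounded_measurable (F i)) ->
  J (fun x => \sum_(i <- s) F i x) = \sum_(i <- s) J (F i).
Proof.
move=> bF; elim: s => [|i s IH].
  rewrite big_nil; under eq_Rintegral do rewrite big_nil; exact: mean_cst.
rewrite big_cons; under eq_Rintegral do rewrite big_cons.
by rewrite meanD ?IH//; exact: bounded_measurable_sum.
Qed.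

Lemma mean_bound (f : R -> R) C : bounded_measurable f ->
  (forall x, `|f x| <= C) -> `|J f| <= C.
Proof.
move=> bf hC; have bC : bounded_measurable (fun _ : R => C) := bounded_measurable_cst C.
have bN : bounded_measurable (fun _ : R => - C) := bounded_measurable_cst (- C).
rewrite ler_norml; apply/andP; split.
  rewrite -[leLHS]mean_cst; apply: mean_le => // x _.
  by have := hC x; rewrite ler_norml => /andP[].
rewrite -[leRHS]mean_cst; apply: mean_le => // x _.
by have := hC x; rewrite ler_norml => /andP[].
Qed.

Lemma bounded_measurable_section d {T : measurableType d} (F : T * R -> R) t :
  bounded_measurable F -> bounded_measurable (fun y => F (t, y)).
Proof. by move=> bF; apply: bounded_measurable_comp => //; exact: measurable_fun_pair. Qed.

Lemma fin_num_mean (h : R -> R) : bounded_measurable h ->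
  (J h)%:E = (\int[mu]_(x in I01 R) (h x)%:E)%E.
Proof.
by move=> bh; rewrite fineK//; apply: integrable_fin_num => //; exact: integrable_I01.
Qed.

Lemma mean_section_measurable_ge0 d {T : measurableType d} (F : T * R -> R) :
  bounded_measurable F -> (forall z, 0 <= F z) ->
  measurable_fun [set: T] (fun t => J (fun y => F (t, y))).
Proof.
move=> bF F0.
(* Restricting the integrand rather than the domain of integration. *)
pose F1 (z : T * R) := (F z * \1_(I01 R) z.2)%:E.
have mF1 : measurable_fun setT F1.
  apply/measurable_EFinP; apply: measurable_funM; first by case: bF.
  by apply: measurableT_comp => //; exact: measurable_indic.
have F10 z : (0 <= F1 z)%E by rewrite lee_fin mulr_ge0.
have := measurable_fun_fubini_tonelli_F (m2 := mu) F1 mF1 F10.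
rewrite /fubini_F => mG.
have -> : (fun t => J (fun y => F (t, y))) =
   (fun t => fine (\int[mu]_y F1 (t, y))%E).
  apply/funext => t; rewrite /Rintegral; congr fine.
  rewrite integral_mkcond; apply: eq_integral => y _.
  rewrite /F1 /= patchE indicE; case: (y \in I01 R) => /=.
    by rewrite mulr1.
  by rewrite mulr0.
by apply: measurableT_comp mG.
Qed.

Lemma bounded_measurable_mean d {T : measurableType d} (F : T * R -> R) :
  bounded_measurable F -> bounded_measurable (fun t => J (fun y => F (t, y))).
Proof.
move=> bF; have [mF [C hC]] := bF.
split; last first.
  exists C => t; apply: mean_bound => //.
  exact: bounded_measurable_section.
have bFC : bounded_measurable (fun z => F z + C).
  by apply: bounded_measurableD => //; exact: bounded_measurable_cst.
(* Shifting by a bound reduces to a nonnegative integrand. *)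
have -> : (fun t => J (fun y => F (t, y))) =
    (fun t => J (fun y => F (t, y) + C) - C).
  apply/funext => t; rewrite meanD ?mean_cst ?addrK//.
    exact: bounded_measurable_section.
  exact: bounded_measurable_cst.
apply: measurable_funB; last exact: measurable_cst.
apply: (mean_section_measurable_ge0 bFC) => z.
by have := hC z; rewrite ler_norml => /andP[h _]; rewrite -lerBlDr sub0r.
Qed.

(** The integrand over the whole plane that stands for [F] on the unit square, so
    that Tonelli's theorem applies. *)
Definition on_square (F : R * R -> R) (z : R * R) : \bar R :=
  (F z * (\1_(I01 R) z.1 * \1_(I01 R) z.2))%:E.

Lemma measurable_on_square F : bounded_measurable F ->
  measurable_fun [set: R * R] (on_square F).
Proof.
move=> [mF _]; apply/measurable_EFinP; apply: measurable_funM => //.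
by apply: measurable_funM; apply: measurableT_comp => //; exact: measurable_indic.
Qed.

Lemma on_square_ge0 F : (forall z, 0 <= F z) -> forall z, (0 <= on_square F z)%E.
Proof. by move=> F0 z; rewrite lee_fin !mulr_ge0. Qed.

Lemma iterated_meanE (F : R * R -> R) : bounded_measurable F ->
  (J (fun x => J (fun y => F (x, y))))%:E =
  (\int[mu]_x \int[mu]_y on_square F (x, y))%E.
Proof.
move=> bF; rewrite fin_num_mean; last exact: bounded_measurable_mean.
rewrite integral_mkcond; apply: eq_integral => x _.
rewrite patchE; case: ifPn => xI; last first.
  apply/esym; apply: integral0_eq => y _.
  by rewrite /on_square /= !indicE (negPf xI) mul0r mulr0.
rewrite fin_num_mean; last exact: bounded_measurable_section.
rewrite integral_mkcond; apply: eq_integral => y _.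
rewrite patchE /on_square /= !indicE xI; case: (y \in _) => /=.
  by rewrite !mulr1.
by rewrite !mulr0.
Qed.

Lemma mean_exchange (F : R * R -> R) : bounded_measurable F ->
  (forall z, 0 <= F z) ->
  J (fun x => J (fun y => F (x, y))) = J (fun y => J (fun x => F (x, y))).
Proof.
move=> bF F0; apply: EFin_inj; rewrite iterated_meanE//.
rewrite (iterated_meanE (F := fun z => F (z.2, z.1))); last first.
  by apply: bounded_measurable_comp => //; exact: measurable_fun_pair.
rewrite (fubini_tonelli (m1 := mu) (m2 := mu) (on_square F)); last 2 first.
- exact: measurable_on_square.
- exact: on_square_ge0.
apply: eq_integral => y _; apply: eq_integral => x _.
by rewrite /on_square /= [in RHS]mulrC [in LHS]mulrC (mulrC (\1__ y)).
Qed.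

Lemma mean_indic_square (A : set (R * R)) : measurable A ->
  (J (fun x => J (fun y => \1_A (x, y))))%:E =
  (mu \x mu)%E (A `&` (I01 R `*` I01 R)).
Proof.
move=> mA; have bA : bounded_measurable (\1_A : R * R -> R).
  exact: bounded_measurable_indic.
rewrite iterated_meanE// -(fubini_tonelli1 (m1 := mu) (m2 := mu) (on_square _)).
- rewrite -[in RHS](setIT (A `&` _)) -integral_indic//; last first.
    by apply: measurableI => //; apply: measurableX; exact: measurable_I01.
  apply: eq_integral => -[x y] _; congr (_%:E).
  rewrite /= !indicE.
  have -> : ((x, y) \in A `&` (I01 R `*` I01 R)) =
      [&& (x, y) \in A, x \in I01 R & y \in I01 R].
    apply/idP/and3P => [/set_mem[? []]|[/set_mem ? /set_mem ? /set_mem ?]].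
      by split; exact/mem_set.
    by apply/mem_set; split.
  by case: (_ \in A); case: (x \in _); case: (y \in _); rewrite /= ?(mulr0, mul0r, mulr1).
- exact: measurable_on_square.
- by apply: on_square_ge0 => z; rewrite indicE.
Qed.

End unit_interval_mean.

(** * Graphons that factor through a finite partition *)

Section coded_graphons.
Context {R : realType} {K : finType}.
Implicit Types (c : R -> K) (g : K -> R) (G : K -> K -> R) (p : R).
Local Notation mu := (@lebesgue_measure R).
Local Notation J h := (\int[mu]_(x in I01 R) h x).

(** A measurable partition of the line into classes labelled by [K]. *)
Definition measurable_code c := forall a, measurable (c @^-1` [set a]).

Definition code_weight c a : R := J (\1_(c @^-1` [set a]) : R -> R).

Lemma sum_code_indic c g x : g (c x) = \sum_a g a * \1_(c @^-1` [set a]) x.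
Proof.
rewrite (bigD1 (c x)) //= indicE mem_set// mulr1 big1 ?addr0// => a ac.
by rewrite indicE memNset ?mulr0//= => cx; rewrite cx eqxx in ac.
Qed.

Lemma bounded_measurable_code c g : measurable_code c ->
  bounded_measurable (fun x => g (c x)).
Proof.
move=> mc; under eq_fun do rewrite sum_code_indic.
apply: bounded_measurable_sum => a; apply: bounded_measurableM.
  exact: bounded_measurable_cst.
exact: bounded_measurable_indic (mc _).
Qed.

Lemma bounded_measurable_code2 c G : measurable_code c ->
  bounded_measurable (fun z : R * R => G (c z.1) (c z.2)).
Proof.
move=> mc; under eq_fun do rewrite (sum_code_indic c (fun a => G a _)).
apply: bounded_measurable_sum => a; apply: bounded_measurableM.
  exact: (bounded_measurable_comp (bounded_measurable_code _ mc)).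
by apply: bounded_measurable_comp => //; exact: bounded_measurable_indic (mc _).
Qed.

Lemma mean_code c g : measurable_code c ->
  J (fun x => g (c x)) = \sum_a code_weight c a * g a.
Proof.
move=> mc; under eq_Rintegral do rewrite sum_code_indic.
have bI a := bounded_measurable_indic (mc a).
rewrite mean_sum => [|a]; last first.
  by apply: bounded_measurableM => //; exact: bounded_measurable_cst.
by apply: eq_bigr => a _; rewrite meanZ// mulrC.
Qed.

Lemma code_weight_ge0 c a : 0 <= code_weight c a.
Proof. by apply: Rintegral_ge0. Qed.

Lemma sum_code_weight c : measurable_code c -> \sum_a code_weight c a = 1.
Proof.
move=> mc; have := mean_code (fun=> 1) mc; rewrite mean_cst => ->.
by apply: eq_bigr => a _; rewrite mulr1.
Qed.

(** Iterated integrals of functions of the classes are finite weighted sums, the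
    weight of a class being its measure in the unit interval. *)
Lemma mean_code2 c G : measurable_code c ->
  J (fun x => J (fun y => G (c x) (c y))) =
  \sum_a \sum_b code_weight c a * code_weight c b * G a b.
Proof.
move=> mc; under eq_Rintegral do rewrite mean_code//.
rewrite (mean_code (fun a => \sum_b code_weight c b * G a b))//.
by apply: eq_bigr => a _; rewrite mulr_sumr; apply: eq_bigr => b _; rewrite mulrA.
Qed.

Lemma edge_density_code c G : measurable_code c ->
  edge_density (fun x y => G (c x) (c y)) =
  \sum_a \sum_b code_weight c a * code_weight c b * G a b.
Proof. exact: mean_code2. Qed.

Lemma rate_code p c G : measurable_code c ->
  rate p (fun x y => G (c x) (c y)) =
  \sum_a \sum_b code_weight c a * code_weight c b * I_ p (G a b).
Proof. exact: (mean_code2 (fun a b => I_ p (G a b))). Qed.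

Lemma triangle_density_code c G : measurable_code c ->
  triangle_density (fun x y => G (c x) (c y)) =
  \sum_a \sum_b \sum_d code_weight c a * code_weight c b * code_weight c d *
    (G a b * G b d * G a d).
Proof.
move=> mc; rewrite /triangle_density.
under eq_Rintegral do under eq_Rintegral do
  rewrite (mean_code (fun d => G (c _) (c _) * G (c _) d * G (c _) d))//.
rewrite (mean_code2 (fun a b =>
   \sum_d code_weight c d * (G a b * G b d * G a d)))//.
apply: eq_bigr => a _; apply: eq_bigr => b _; rewrite mulr_sumr.
by apply: eq_bigr => d _; rewrite !mulrA.
Qed.

Lemma graphon_code c G : measurable_code c -> (forall a b, G a b = G b a) ->
  (forall a b, 0 <= G a b <= 1) -> graphon (fun x y => G (c x) (c y)).
Proof.
move=> mc Gs G01; split => //.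
by apply: measurable_funTS; case: (bounded_measurable_code2 G mc).
Qed.

End coded_graphons.

(** * Step graphons of matrices *)

Section step_graphons.
Context {R : realType} {n : nat}.
Context (n0 : (0 < n)%N).
Implicit Types (M : 'I_n -> 'I_n -> R) (p : R).
Local Notation mu := (@lebesgue_measure R).

(** The graphon of a weighted graph: the construction of [graphon_of] for an
    arbitrary matrix. *)
Definition step_fun M (x y : R) : R :=
  \sum_(i < n) \sum_(j < n) M i j * (\1_(cell i) x * \1_(cell j) y).

(** The cell of a point. The value [None] covers the points outside of all the
    cells, among them the right end point of the unit interval. *)
Definition cell_code (x : R) : option 'I_n := [pick i | x \in @cell R n i].

Definition extend0 M (a b : option 'I_n) : R :=
  if a is Some i then if b is Some j then M i j else 0 else 0.

Let n0' : 0 < n%:R :> R. Proof. by rewrite ltr0n. Qed.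

Lemma in_cell (i : 'I_n) (x : R) : (x \in @cell R n i) = (i%:R <= x * n%:R < i.+1%:R).
Proof.
rewrite /cell mem_setE in_itv /= ler_pdivrMr// ltr_pdivlMr//.
Qed.

Lemma cell_inj (i j : 'I_n) (x : R) : x \in @cell R n i -> x \in @cell R n j -> i = j.
Proof.
rewrite !in_cell => /andP[i1 i2] /andP[j1 j2]; apply/val_inj/eqP => /=.
have := le_lt_trans i1 j2; have := le_lt_trans j1 i2.
by rewrite !ltr_nat !ltnS => h1 h2; rewrite eqn_leq h1 h2.
Qed.

Lemma cell_codeP x (i : 'I_n) : (cell_code x == Some i) = (x \in @cell R n i).
Proof.
rewrite /cell_code; case: pickP => [j xj|/(_ i) ->] //.
apply/eqP/idP => [[<-]//|xi]; by rewrite (cell_inj xi xj).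
Qed.

Lemma cell_code_preimage i : cell_code @^-1` [set Some i] = @cell R n i.
Proof.
apply/seteqP; split=> x /=; first by move/eqP; rewrite cell_codeP => /set_mem.
by move=> xi; apply/eqP; rewrite cell_codeP; exact/mem_set.
Qed.

Lemma measurable_cell_code : measurable_code cell_code.
Proof.
have mi i : measurable (cell_code @^-1` [set Some i]).
  by rewrite cell_code_preimage /cell; exact: measurable_itv.
case=> [i|]; first exact: mi.
rewrite [X in measurable X](_ : _ = ~` (\bigcup_i (cell_code @^-1` [set Some i]))).
  by apply: measurableC; apply: fin_bigcup_measurable => //; exact: finite_finset.
apply/seteqP; split=> x /=; first by move=> h [i _ /=]; rewrite h.
move=> h; case E: (cell_code x) => [i|//]; exfalso; apply: h.
by exists i.
Qed.

Lemma indic_cellE i x : \1_(@cell R n i) x = (cell_code x == Some i)%:R :> R.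
Proof. by rewrite indicE cell_codeP. Qed.

Lemma step_funE M :
  step_fun M = (fun x y => extend0 M (cell_code x) (cell_code y)).
Proof.
apply/funext => x; apply/funext => y; rewrite /step_fun /extend0.
under eq_bigr do under eq_bigr do rewrite !indic_cellE.
case: (cell_code x) => [i|]; last first.
  by rewrite big1 // => i _; rewrite big1 // => j _; rewrite /= mul0r mulr0.
rewrite (bigD1 i) //= [X in _ + X]big1 ?addr0 => [|k ki]; last first.
  rewrite big1// => j _; rewrite (_ : (Some i == Some k) = false) ?mul0r ?mulr0//.
  by apply/negP => /eqP[ik]; rewrite ik eqxx in ki.
rewrite eqxx; case: (cell_code y) => [j|]; last first.
  by rewrite big1 // => j _; rewrite /= !mulr0.
rewrite (bigD1 j) //= [X in _ + X]big1 ?addr0 => [|k kj]; last first.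
  rewrite (_ : (Some j == Some k) = false) ?mulr0//.
  by apply/negP => /eqP[jk]; rewrite jk eqxx in kj.
by rewrite eqxx !mulr1.
Qed.

Lemma cell_weight i : code_weight cell_code (Some i) = n%:R^-1.
Proof.
rewrite /code_weight cell_code_preimage /Rintegral.
rewrite integral_indic //; last by rewrite /cell; exact: measurable_itv.
rewrite (_ : cell i `&` I01 R = cell i); last first.
  apply/setIidPl => x; rewrite /cell /= !in_itv /= => /andP[x1 x2].
  rewrite (le_trans _ x1) ?divr_ge0//= (le_trans (ltW x2))//.
  by rewrite ler_pdivrMr// mul1r ler_nat.
have h := lebesgue_measure_itv `[(i%:R / n%:R : R), (i.+1%:R / n%:R : R)[.
rewrite /= lte_fin ltr_pM2r ?invr_gt0// ltr_nat ltnSn -EFinB -mulrBl -natrB// in h.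
rewrite subSnn mul1r in h.
exact: (congr1 fine h).
Qed.

Lemma sum_option (T : finType) (F : option T -> R) :
  \sum_a F a = F None + \sum_i F (Some i).
Proof.
rewrite (bigD1 None) //=; congr (_ + _).
rewrite (reindex_omap (fun i => Some i) id) => [|[]//].
by apply: eq_bigl => i; rewrite /= eqxx.
Qed.

(** The [n] cells already have total measure 1. *)
Lemma cell_weight_None : code_weight cell_code None = 0.
Proof.
have := sum_code_weight measurable_cell_code; rewrite sum_option.
under eq_bigr do rewrite cell_weight.
rewrite sumr_const card_ord -[X in _ + X]mulr_natr mulVf ?gt_eqF//.
by rewrite -{2}[1]add0r => /addIr.
Qed.

Lemma sum_cell_weight (F : option 'I_n -> R) :
  \sum_a code_weight cell_code a * F a = n%:R^-1 * \sum_i F (Some i).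
Proof.
rewrite sum_option cell_weight_None mul0r add0r mulr_sumr.
by apply: eq_bigr => i _; rewrite cell_weight.
Qed.

Lemma rate_step p M :
  rate p (step_fun M) = (n%:R ^+ 2)^-1 * \sum_i \sum_j I_ p (M i j).
Proof.
rewrite step_funE rate_code; last exact: measurable_cell_code.
under eq_bigr => a _ do under eq_bigr => b _ do rewrite -mulrA.
under eq_bigr => a _ do rewrite -mulr_sumr.
rewrite sum_cell_weight -exprVn expr2 -mulrA; congr (_ * _).
rewrite mulr_sumr; apply: eq_bigr => i _; rewrite sum_cell_weight.
by rewrite mulr_sumr.
Qed.

Lemma edge_density_step M :
  edge_density (step_fun M) = (n%:R ^+ 2)^-1 * \sum_i \sum_j M i j.
Proof.
rewrite step_funE edge_density_code; last exact: measurable_cell_code.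
under eq_bigr => a _ do under eq_bigr => b _ do rewrite -mulrA.
under eq_bigr => a _ do rewrite -mulr_sumr.
rewrite sum_cell_weight -exprVn expr2 -mulrA; congr (_ * _).
by rewrite mulr_sumr; apply: eq_bigr => i _; rewrite sum_cell_weight.
Qed.

Lemma triangle_density_step M :
  triangle_density (step_fun M) =
  (n%:R ^+ 3)^-1 * \sum_i \sum_j \sum_k M i j * M j k * M i k.
Proof.
rewrite step_funE triangle_density_code; last exact: measurable_cell_code.
under eq_bigr => a _ do under eq_bigr => b _ do under eq_bigr => d _ do
  rewrite -!mulrA.
under eq_bigr => a _ do under eq_bigr => b _ do rewrite -!mulr_sumr.
under eq_bigr => a _ do rewrite -!mulr_sumr.
rewrite sum_cell_weight -exprVn !exprS expr0 mulr1 -!mulrA; congr (_ * _).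
rewrite 2!mulr_sumr; apply: eq_bigr => i _; rewrite sum_cell_weight; congr (_ * _).
rewrite mulr_sumr; apply: eq_bigr => j _; rewrite sum_cell_weight; congr (_ * _).
by apply: eq_bigr => k _; rewrite mulrA.
Qed.

Lemma graphon_step M : (forall i j, M i j = M j i) ->
  (forall i j, 0 <= M i j <= 1) -> graphon (step_fun M).
Proof.
move=> Ms M01; rewrite step_funE; apply: graphon_code => //.
- exact: measurable_cell_code.
- by move=> [i|] [j|] //=.
- by move=> [i|] [j|] //=; rewrite ?lexx ?ler01.
Qed.

End step_graphons.

(** * Symmetric matrices indexed by the edges *)

Section symmetric_matrices.
Context {R : realType} {n : nat}.
Implicit Types (y : vpair n -> R).

(** The symmetric matrix with zero diagonal and given entries above it. As it is
    linear in [y], it commutes with averaging over graphs. *)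
Definition sym_mx y (i j : 'I_n) : R :=
  \sum_e y e * ((val e == (i, j)) || (val e == (j, i)))%:R.

Lemma sym_mxC y i j : sym_mx y i j = sym_mx y j i.
Proof. by apply: eq_bigr => e _; rewrite orbC. Qed.

Lemma sym_mxii y i : sym_mx y i i = 0.
Proof.
apply: big1 => e _; rewrite orbb; case: eqP => [ei|_]; last by rewrite mulr0.
by have := valP e; rewrite /= ei /= ltnn.
Qed.

Lemma sym_mx_val y (e : vpair n) : sym_mx y (val e).1 (val e).2 = y e.
Proof.
rewrite /sym_mx (bigD1 e) //= -surjective_pairing eqxx mulr1 big1 ?addr0//.
move=> e' e'e; rewrite val_eqE (negPf e'e) /=; case: eqP => [h|_]; last by rewrite mulr0.
by have := valP e'; rewrite /= h /= ltnNge ltnW//; exact: (valP e).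
Qed.

(** Case analysis on the relative position of the two indices. *)
Lemma sym_mx_ind y (P : 'I_n -> 'I_n -> R -> Prop) :
  (forall i, P i i 0) -> (forall e, P (val e).1 (val e).2 (y e)) ->
  (forall e, P (val e).2 (val e).1 (y e)) -> forall i j, P i j (sym_mx y i j).
Proof.
move=> P0 P1 P2 i j; have [ij|ji|/val_inj <-] := ltngtP i j.
- pose e : vpair n := exist _ (i, j) ij.
  have -> : sym_mx y i j = y e by exact: (sym_mx_val y e).
  exact: (P1 e).
- pose e : vpair n := exist _ (j, i) ji.
  have -> : sym_mx y i j = y e by rewrite sym_mxC; exact: (sym_mx_val y e).
  exact: (P2 e).
- by rewrite sym_mxii.
Qed.

Lemma sym_mx01 y : (forall e, 0 <= y e <= 1) -> forall i j, 0 <= sym_mx y i j <= 1.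
Proof.
move=> y01 i j; apply: (sym_mx_ind (P := fun _ _ x => is_true (0 <= x <= 1))) => //.
by move=> k; rewrite lexx ler01.
Qed.

Lemma sum_vpair (F : 'I_n -> 'I_n -> R) :
  \sum_(i < n) \sum_(j < n | (i < j)%N) F i j = \sum_(e : vpair n) F (val e).1 (val e).2.
Proof.
rewrite pair_big_dep /=.
rewrite (reindex_omap (fun e : vpair n => val e) insub) => [|z z12]; last first.
  by rewrite insubT.
apply: eq_bigl => e /=; rewrite valK eqxx andbT; exact: (valP e).
Qed.

Lemma sum_sym_mx y (F : R -> R) :
  \sum_i \sum_j F (sym_mx y i j) = 2 * \sum_e F (y e) + n%:R * F 0.
Proof.
have split i : \sum_j F (sym_mx y i j) =
    \sum_(j < n | (i < j)%N) F (sym_mx y i j)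
    + \sum_(j < n | (j < i)%N) F (sym_mx y i j) + F 0.
  rewrite (bigD1 i) //= sym_mxii addrC; congr (_ + _).
  rewrite (bigID (fun j : 'I_n => (i < j)%N)) /=; congr (_ + _); apply: eq_bigl => j.
    by rewrite -val_eqE /=; case: ltngtP.
  by rewrite -val_eqE /=; case: ltngtP.
under eq_bigr do rewrite split.
rewrite !big_split /= sumr_const card_ord !mulr_natl; congr (_ + _).
rewrite [X in _ + X](exchange_big_dep predT) //=.
under [X in _ + X]eq_bigr => i _ do under eq_bigr => j _ do rewrite sym_mxC.
rewrite (sum_vpair (fun i j => F (sym_mx y i j))).
have -> : \sum_(e : vpair n) F (sym_mx y (\val e).1 (\val e).2) = \sum_e F (y e).
  by apply: eq_bigr => e _; rewrite sym_mx_val.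
by rewrite mulr2n.
Qed.

(** The adjacency matrix of a graph is the symmetric matrix of its indicator. *)
Lemma adjE (X : Omega n) i j : (adj X i j)%:R = sym_mx (fun e => (X e)%:R) i j.
Proof.
move: i j; apply: (sym_mx_ind (P := fun i j x => (adj X i j)%:R = x)).
- move=> i; rewrite /adj (_ : [exists e, _] = false)//.
  apply/negbTE/existsPn => e; rewrite orbb negb_and; apply/orP; right.
  by apply/eqP => ei; have := valP e; rewrite /= ei /= ltnn.
- move=> e; congr (_ %:R); congr nat_of_bool; rewrite /adj.
  apply/existsP/idP => [[e' /andP[Xe' /orP[]]]|Xe].
  + by rewrite -surjective_pairing => /eqP/val_inj <-.
  + by move=> /eqP h; have := valP e'; rewrite /= h /= ltnNge ltnW//; exact: (valP e).
  + by exists e; rewrite Xe -surjective_pairing eqxx.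
- move=> e; congr (_ %:R); congr nat_of_bool; rewrite /adj.
  apply/existsP/idP => [[e' /andP[Xe' /orP[]]]|Xe].
  + by move=> /eqP h; have := valP e'; rewrite /= h /= ltnNge ltnW//; exact: (valP e).
  + by rewrite -surjective_pairing => /eqP/val_inj <-.
  + by exists e; rewrite Xe -surjective_pairing eqxx orbT.
Qed.

Lemma card_vpair_le : (#|{: vpair n}| <= n ^ 2)%N.
Proof.
rewrite card_sig; apply: leq_trans (max_card _) _.
by rewrite card_prod card_ord mulnn.
Qed.

End symmetric_matrices.

(** * Densities of graphs and the second moment *)

Section graph_functionals.
Context {R : realType} {n : nat} (n0 : (0 < n)%N).
Implicit Types (X : Omega n) (y : vpair n -> R) (p : R).

Definition tdens X : R := triangle_density (graphon_of X : R -> R -> R).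

Lemma graphon_ofE X : graphon_of X = step_fun (sym_mx (fun e => (X e)%:R : R)).
Proof.
apply/funext => u; apply/funext => v; apply: eq_bigr => i _; apply: eq_bigr => j _.
by rewrite adjE.
Qed.

Lemma edge_indic01 X e : 0 <= ((X e)%:R : R) <= 1.
Proof. by case: (X e); rewrite ?lexx ?ler01. Qed.

Lemma graphon_sym_mx y : (forall e, 0 <= y e <= 1) -> graphon (step_fun (sym_mx y)).
Proof.
by move=> y01; apply: graphon_step => //; [exact: sym_mxC|exact: sym_mx01].
Qed.

Lemma graphon_graph X : graphon (graphon_of X : R -> R -> R).
Proof. by rewrite graphon_ofE; apply: graphon_sym_mx; exact: edge_indic01. Qed.

Lemma triangle_density_sym_mx y :
  triangle_density (step_fun (sym_mx y)) = (n%:R ^+ 3)^-1 * triangles (sym_mx y).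
Proof. exact: triangle_density_step. Qed.

Lemma triangle_density_sym_mx01 y : (forall e, 0 <= y e <= 1) ->
  0 <= triangle_density (step_fun (sym_mx y)) <= 1.
Proof.
move=> y01; rewrite triangle_density_sym_mx.
have n3 : 0 < n%:R ^+ 3 :> R by rewrite exprn_gt0// ltr0n.
have M01 := sym_mx01 y01.
have t01 i j k : 0 <= sym_mx y i j * sym_mx y j k * sym_mx y i k <= 1.
  have /andP[a0 a1] := M01 i j; have /andP[b0 b1] := M01 j k.
  have /andP[c0 c1] := M01 i k.
  by rewrite !mulr_ge0 //= mulr_ile1 ?mulr_ge0 ?mulr_ile1.
apply/andP; split.
  apply: mulr_ge0; first by rewrite invr_ge0 ltW.
  apply: sumr_ge0 => i _; apply: sumr_ge0 => j _; apply: sumr_ge0 => k _.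
  by have /andP[] := t01 i j k.
rewrite mulrC ler_pdivrMr// mul1r.
apply: (@le_trans _ _ (\sum_(i < n) \sum_(j < n) \sum_(k < n) 1)).
  apply: ler_sum => i _; apply: ler_sum => j _; apply: ler_sum => k _.
  by have /andP[] := t01 i j k.
by rewrite !sumr_const !card_ord -!mulrnA -natrX !expnS expn0 muln1.
Qed.

Lemma tdens01 X : 0 <= tdens X <= 1.
Proof.
rewrite /tdens graphon_ofE; apply: triangle_density_sym_mx01; exact: edge_indic01.
Qed.

(** The zero diagonal contributes the term in [I_ p 0], which is of order [1 / n]
    after normalization. *)
Lemma rate_sym_mx p y : rate p (step_fun (sym_mx y)) =
  (n%:R ^+ 2)^-1 * (\sum_e 2 * I_ p (y e) + n%:R * I_ p 0).
Proof. by rewrite rate_step// sum_sym_mx mulr_sumr. Qed.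

Lemma edge_density_graph X :
  edge_density (graphon_of X : R -> R -> R) = (n%:R ^+ 2)^-1 * (2 * \sum_e (X e)%:R).
Proof.
rewrite graphon_ofE edge_density_step//.
by rewrite (sum_sym_mx (fun e => (X e)%:R : R) id) mulr0 addr0.
Qed.

(** The density of the tilted measure with respect to the random graph, up to
    normalization. *)
Definition tilt (beta alpha : R) X : R :=
  expR (n%:R ^+ 2 * (beta / 6 * (tdens X `^ alpha))).

(** The edge term with [h = logit p] turns the uniform measure into the random
    graph of parameter [p]. *)
Lemma gibbs_weightE p beta alpha X : 0 < p < 1 ->
  gibbs_weight (logit p) beta alpha X =
  gnp p X * tilt beta alpha X / (1 - p) ^+ #|{: vpair n}|.
Proof.
move=> /andP[p0 p1]; have q0 : 0 < 1 - p by rewrite subr_gt0.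
rewrite /gibbs_weight mulrDr expRD [RHS]mulrAC; congr (_ * _).
rewrite edge_density_graph.
have n1 : n%:R != 0 :> R by rewrite gt_eqF// ltr0n.
have -> : n%:R ^+ 2 * (logit p / 2 * ((n%:R ^+ 2)^-1 * (2 * \sum_e (X e)%:R)))
   = logit p * \sum_e (X e)%:R by field.
rewrite mulr_sumr expR_sum /gnp -prodr_const -prodf_div; apply: eq_bigr => e _.
rewrite /logit; case: (X e) => /=.
  by rewrite mulr1 lnK// posrE divr_gt0.
by rewrite mulr0 expR0 divff// gt_eqF.
Qed.

Lemma gnp_gt0 p X : 0 < p < 1 -> 0 < gnp p X.
Proof. by move=> p01; exact: (bern_prod_gt0 X (fun=> p01)). Qed.

(** The likelihood ratio is [Z / tilt], with [Z] the first factor; its square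
    integrated against the tilted measure leaves one factor [1 / tilt]. *)
Lemma second_momentE p t beta alpha : 0 < p < 1 ->
  second_moment p t (gibbs (logit p) beta alpha (n := n)) =
  (\sum_X gnp p X * tilt beta alpha X) *
  \sum_(X | t ^+ 3 <= tdens X) gnp p X / tilt beta alpha X.
Proof.
move=> p01; have /andP[p0 p1] := p01.
set c := (1 - p) ^+ #|{: vpair n}|.
have c0 : c != 0 by rewrite gt_eqF// exprn_gt0// subr_gt0.
set Z := \sum_X gnp p X * tilt beta alpha X.
have Z0 : 0 < Z.
  rewrite /Z (bigD1 [ffun=> true]) //= ltr_pwDl ?mulr_gt0 ?expR_gt0 ?gnp_gt0//.
  by apply: sumr_ge0 => X _; rewrite mulr_ge0 ?expR_ge0// ltW// gnp_gt0.
have QE X : gibbs (logit p) beta alpha X = gnp p X * tilt beta alpha X / Z.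
  rewrite /gibbs; under eq_bigr do rewrite gibbs_weightE//.
  rewrite gibbs_weightE// -/c -mulr_suml -/Z.
  by field; rewrite c0 (gt_eqF Z0).
rewrite /second_moment mulr_sumr [RHS]big_mkcond; apply: eq_bigr => X _ /=.
rewrite indicE; have -> : (graphon_of X \in W_ t) = (t ^+ 3 <= tdens X).
  apply/idP/idP => [/set_mem[]//|h]; apply/mem_set; split => //.
  exact: graphon_graph.
case: ifPn => _ /=; last by rewrite mul0r expr0n mulr0.
have g0 := gt_eqF (gnp_gt0 X p01); have t0 := gt_eqF (expR_gt0 (n%:R ^+ 2 *
  (beta / 6 * (tdens X `^ alpha)))).
rewrite mul1r QE /tilt; field.
by rewrite g0 t0 gt_eqF.
Qed.

End graph_functionals.

(** * Approximation in the mean by coded functions *)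

Section square_mean.
Context {R : realType}.
Local Notation mu := (@lebesgue_measure R).
Local Notation J h := (\int[mu]_(x in I01 R) h x).
Implicit Types F G : R * R -> R.

Definition square_mean F : R := J (fun x => J (fun y => F (x, y))).

Let bm_section F x : bounded_measurable F -> bounded_measurable (fun y => F (x, y)).
Proof. exact: bounded_measurable_section. Qed.

Let bm_mean F : bounded_measurable F -> bounded_measurable (fun x => J (fun y => F (x, y))).
Proof. exact: bounded_measurable_mean. Qed.

Lemma square_mean_le F G : bounded_measurable F -> bounded_measurable G ->
  (forall z, F z <= G z) -> square_mean F <= square_mean G.
Proof.
move=> bF bG FG; apply: mean_le; [exact: bm_mean|exact: bm_mean|move=> x _].
by apply: mean_le; [exact: bm_section|exact: bm_section|move=> y _].
Qed.

Lemma square_meanD F G : bounded_measurable F -> bounded_measurable G ->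
  square_mean (fun z => F z + G z) = square_mean F + square_mean G.
Proof.
move=> bF bG; rewrite /square_mean -meanD; [|exact: bm_mean|exact: bm_mean].
by apply: eq_Rintegral => x _; rewrite meanD//; exact: bm_section.
Qed.

Lemma square_meanZ c F : bounded_measurable F ->
  square_mean (fun z => c * F z) = c * square_mean F.
Proof.
move=> bF; rewrite /square_mean -meanZ; last exact: bm_mean.
by apply: eq_Rintegral => x _; rewrite meanZ//; exact: bm_section.
Qed.

Lemma square_mean_cst (c : R) : square_mean (fun=> c) = c.
Proof. by rewrite /square_mean mean_cst; rewrite mean_cst. Qed.

(** A function of the classes of both coordinates. *)
Definition coded (K : finType) (c : R -> K) (G : K -> K -> R) (z : R * R) : R :=
  G (c z.1) (c z.2).

(** L1-approximability on the unit square by functions of the classes of the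
    coordinates. The same partition serves both coordinates, since it will become
    the set of vertex classes of a graph. *)
Definition approximable F := forall e : R, 0 < e ->
  exists (K : finType) (c : R -> K) (G : K -> K -> R),
    measurable_code c /\ square_mean (fun z => `|F z - coded c G z|) <= e.

Lemma bounded_measurable_coded (K : finType) (c : R -> K) (G : K -> K -> R) :
  measurable_code c -> bounded_measurable (coded c G).
Proof. exact: bounded_measurable_code2. Qed.

Let bm_dist F G : bounded_measurable F -> bounded_measurable G ->
  bounded_measurable (fun z => `|F z - G z|).
Proof.
by move=> bF bG; apply: bounded_measurable_norm; exact: bounded_measurableB.
Qed.

Lemma approximable_coded (K : finType) (c : R -> K) (G : K -> K -> R) :
  measurable_code c -> approximable (coded c G).
Proof.
move=> mc e e0; exists K, c, G; split => //.
have -> : (fun z => `|coded c G z - coded c G z|) = (fun=> 0).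
  by apply/funext => z; rewrite subrr normr0.
by rewrite square_mean_cst ltW.
Qed.

Lemma measurable_code_pair (K K' : finType) (c : R -> K) (c' : R -> K') :
  measurable_code c -> measurable_code c' -> measurable_code (fun x => (c x, c' x)).
Proof.
move=> mc mc' [a a'].
rewrite [X in measurable X](_ : _ = c @^-1` [set a] `&` c' @^-1` [set a']).
  exact: measurableI.
by apply/seteqP; split=> x /= => [[-> ->]|[-> ->]].
Qed.

(** The common refinement of the two partitions carries the combination. *)
Lemma approximable_lin a b F G : bounded_measurable F -> bounded_measurable G ->
  approximable F -> approximable G -> approximable (fun z => a * F z + b * G z).
Proof.
move=> bF bG aF aG e e0.
pose s := `|a| + `|b| + 1.
have s0 : 0 < s by rewrite /s ltr_wpDl// addr_ge0.
have es : 0 < e / s by rewrite divr_gt0.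
have [K [c [H [mc hH]]]] := aF _ es; have [K' [c' [H' [mc' hH']]]] := aG _ es.
pose c2 x := (c x, c' x).
pose H2 (u v : K * K') := a * H u.1 v.1 + b * H' u.2 v.2.
have mc2 : measurable_code c2 by exact: measurable_code_pair.
exists (K * K')%type, c2, H2; split => //.
have bH := bounded_measurable_coded H mc.
have bH' := bounded_measurable_coded H' mc'.
have bc k : bounded_measurable (fun _ : R * R => k : R) by exact: bounded_measurable_cst.
apply: (@le_trans _ _ (square_mean (fun z =>
    `|a| * `|F z - coded c H z| + `|b| * `|G z - coded c' H' z|))).
  apply: square_mean_le.
  - apply: bm_dist; last exact: bounded_measurable_coded.
    by apply: bounded_measurableD; exact: bounded_measurableM.
  - by apply: bounded_measurableD; apply: bounded_measurableM => //; exact: bm_dist.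
  - move=> z; rewrite -!normrM; apply: le_trans (ler_normD _ _).
    by rewrite /coded /H2 /= le_eqVlt; apply/orP; left; apply/eqP; congr `|_|; ring.
rewrite square_meanD; last 2 first.
- by apply: bounded_measurableM => //; exact: bm_dist.
- by apply: bounded_measurableM => //; exact: bm_dist.
rewrite !square_meanZ; [|exact: bm_dist|exact: bm_dist].
apply: (@le_trans _ _ (`|a| * (e / s) + `|b| * (e / s))).
  by apply: lerD; rewrite ler_wpM2l.
rewrite -mulrDl -[leRHS](divfK (lt0r_neq0 s0)) [leRHS]mulrC ler_pM2r//.
by rewrite /s lerDl.
Qed.

Lemma approximable_lim F : bounded_measurable F ->
  (forall e : R, 0 < e -> exists2 G, bounded_measurable G /\ approximable G &
     square_mean (fun z => `|F z - G z|) <= e) -> approximable F.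
Proof.
move=> bF h e e0; have e2 : 0 < e / 2 by rewrite divr_gt0.
have [G [bG aG] FG] := h _ e2.
have [K [c [H [mc hH]]]] := aG _ e2; exists K, c, H; split => //.
have bH := bounded_measurable_coded H mc.
rewrite [e]splitr; apply: le_trans (lerD FG hH).
rewrite -square_meanD; [|exact: bm_dist|exact: bm_dist].
apply: square_mean_le; first exact: bm_dist.
- by apply: bounded_measurableD; exact: bm_dist.
- move=> z; apply: le_trans (ler_normD _ _).
  by rewrite le_eqVlt; apply/orP; left; apply/eqP; congr `|_|; ring.
Qed.

(** Continuity from above of the product measure. *)
Lemma square_mean_indic_cvg0 (A : (set (R * R))^nat) :
  (forall n, measurable (A n)) -> nonincreasing_seq A -> \bigcap_n A n = set0 ->
  forall e : R, 0 < e -> exists n, square_mean (\1_(A n)) <= e.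
Proof.
move=> mA ndA A0 e e0.
pose B n := A n `&` (I01 R `*` I01 R).
have mD : measurable (I01 R `*` I01 R) by apply: measurableX; exact: measurable_I01.
have mB n : measurable (B n) by exact: measurableI.
have B0 : \bigcap_n B n = set0.
  apply/seteqP; split=> x // h; rewrite -A0 => n _.
  by have [] := h n I.
pose nu := (mu \x mu)%E.
have nuB n : nu (B n) = (square_mean (\1_(A n)))%:E.
  exact: (esym (mean_indic_square (mA n))).
have : (nu \o B @ \oo --> nu (\bigcap_n B n)).
  apply: nonincreasing_cvg_mu => //.
  - by change (nu (B 0%N) < +oo)%E; rewrite nuB ltry.
  - by rewrite B0.
  - move=> m n mn; apply/subsetPset => x [Ax Dx]; split => //.
    by have /subsetPset := ndA _ _ mn; apply.
have nu0 : nu set0 = 0%E by exact: measure0.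
rewrite B0 nu0 => /fine_cvgP[_] /cvgrPdist_le/(_ e e0)[N _ /(_ N (leqnn N))].
rewrite /= sub0r normrN nuB /= => h; exists N.
by apply: le_trans h; rewrite ler_norm.
Qed.

(** By the pi-lambda theorem it suffices to treat rectangles. The lambda-system
    properties only require linear combinations and limits in the mean, so that
    no unions of approximants have to be formed. *)
Lemma approximable_indic (A : set (R * R)) : measurable A -> approximable (\1_A).
Proof.
move=> mA.
pose rects := [set X `*` Y | X in @measurable _ R & Y in @measurable _ R].
suff : (@measurable _ (R * R)%type) `<=`
    [set A | measurable A /\ approximable (\1_A)].
  by move=> /(_ A mA)[].
rewrite [X in X `<=` _](measurable_prod_measurableType R R) -/rects.
apply: lambda_system_subset => //.
- move=> _ _ [X mX [Y mY <-]] [X' mX' [Y' mY' <-]].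
  exists (X `&` X'); first exact: measurableI.
  exists (Y `&` Y'); first exact: measurableI.
  by rewrite setXI.
- split.
  + by [].
  + split; first exact: measurableT.
    have -> : (\1_[set: R * R] : R * R -> R) = coded (fun=> tt) (fun _ _ => 1).
      by apply/funext => z; rewrite indicE in_setT.
    apply: approximable_coded => -[].
    rewrite [X in measurable X](_ : _ = setT); first exact: measurableT.
    by apply/seteqP; split.
  + move=> X Y YX [mX aX] [mY aY]; split; first exact: measurableD.
    have -> : (\1_(X `\` Y) : R * R -> R) = (fun z => 1 * \1_X z + (-1) * \1_Y z).
      apply/funext => z; rewrite !indicE mul1r mulN1r.
      have [Yz|Yz] := pselect (Y z).
        rewrite (memNset (A := X `\` Y)) => [|[]//].
        by rewrite !mem_set ?subrr//; exact: YX.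
      have [Xz|Xz] := pselect (X z).
        by rewrite (mem_set Xz) (memNset Yz) mem_set// subr0.
      by rewrite (memNset Xz) (memNset Yz) memNset ?subr0// => -[].
    by apply: approximable_lin => //; exact: bounded_measurable_indic.
  + move=> F ndF mF; have mU : measurable (\bigcup_i F i).
      by apply: bigcupT_measurable => i; case: (mF i).
    split => //; apply: approximable_lim; first exact: bounded_measurable_indic.
    move=> e e0.
    have [|||n hn] := @square_mean_indic_cvg0 (fun n => \bigcup_i F i `\` F n) _ _ _ _ e0.
    * by move=> n; apply: measurableD => //; case: (mF n).
    * move=> m n mn; apply/subsetPset => x [Ux Fx]; split => // Fmx; apply: Fx.
      by have /subsetPset := ndF _ _ mn; apply.
    * apply/seteqP; split=> x // h; have [[i _ Fix] _] := h 0%N I.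
      by have [_ []] := h i I.
    exists (\1_(F n)); first by have [mFn aFn] := mF n; split => //; exact: bounded_measurable_indic.
    suff -> : (fun z => `|\1_(\bigcup_i F i) z - \1_(F n) z|) =
       (\1_(\bigcup_i F i `\` F n) : R * R -> R) by [].
    apply/funext => z; rewrite !indicE.
    have [Fz|Fz] := pselect (F n z).
      rewrite (memNset (A := _ `\` F n)) => [|[]//].
      by rewrite !mem_set ?subrr ?normr0//; exists n.
    have [Uz|Uz] := pselect ((\bigcup_i F i) z).
      by rewrite (mem_set Uz) (memNset Fz) mem_set// subr0 normr1.
    by rewrite (memNset Uz) (memNset Fz) memNset ?subr0 ?normr0// => -[].
- move=> _ [X mX [Y mY <-]]; split; first exact: measurableX.
  have -> : (\1_(X `*` Y) : R * R -> R) =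
      coded (fun x => (x \in X, x \in Y)) (fun u v => (u.1 && v.2)%:R).
    apply/funext => -[x y]; rewrite indicE /coded /=; congr (_%:R).
    congr nat_of_bool; apply/idP/andP => [/set_mem[]|[/set_mem ? /set_mem ?]].
      by split; exact/mem_set.
    by apply/mem_set; split.
  apply: approximable_coded.
  have mb (Z : set R) : measurable Z -> measurable_code (fun x => x \in Z).
    move=> mZ [].
      rewrite [X in measurable X](_ : _ = Z)//.
      by apply/seteqP; split=> x /= => [/set_mem|/mem_set ->].
    rewrite [X in measurable X](_ : _ = ~` Z); first exact: measurableC.
    apply/seteqP; split=> x /=; first by move=> h Zx; rewrite mem_set in h.
    by move=> Zx; rewrite memNset.
  by apply: measurable_code_pair; exact: mb.
Qed.

(** Layer-cake approximation: the average of the indicators of the level sets of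
    height [k / N] is uniformly within [1 / N] of [F]. *)
Lemma approximable_unit F : measurable_fun [set: R * R] F ->
  (forall z, 0 <= F z <= 1) -> approximable F.
Proof.
move=> mF F01; have bF := bounded_measurable_unit mF F01.
apply: approximable_lim => // e e0.
(* A resolution with 1 / N <= e. *)
pose N := (Num.trunc e^-1).+1.
have N0 : 0 < N%:R :> R by rewrite ltr0n.
have Ne : N%:R^-1 <= e.
  by rewrite -[e]invrK lef_pV2 ?posrE ?invr_gt0// ltW// truncnS_gt.
pose A (k : nat) := [set z : R * R | k.+1%:R / N%:R <= F z].
have mA k : measurable (A k).
  rewrite [X in measurable X](_ : _ = F @^-1` `[k.+1%:R / N%:R, +oo[%classic).
    by rewrite -[X in measurable X]setTI; apply: mF => //; exact: measurable_itv.
  by apply/seteqP; split=> z /=; rewrite in_itv /= andbT.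
pose G m z : R := \sum_(k < m) N%:R^-1 * \1_(A k) z.
have bG m : bounded_measurable (G m).
  apply: bounded_measurable_sum => k; apply: bounded_measurableM.
    exact: bounded_measurable_cst.
  exact: bounded_measurable_indic.
have aG m : approximable (G m).
  elim: m => [|m IH].
    have -> : G 0%N = coded (fun=> tt) (fun _ _ => 0).
      by apply/funext => z; rewrite /G big_ord0.
    apply: approximable_coded => -[].
    rewrite [X in measurable X](_ : _ = setT); first exact: measurableT.
    by apply/seteqP; split.
  have -> : G m.+1 = (fun z => 1 * G m z + N%:R^-1 * \1_(A m) z).
    by apply/funext => z; rewrite /G big_ord_recr /= mul1r.
  apply: approximable_lin => //; first exact: bounded_measurable_indic.
  exact: approximable_indic.
exists (G N); first by split.
rewrite -[e]square_mean_cst; apply: square_mean_le; first exact: bm_dist.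
  exact: bounded_measurable_cst.
move=> z; apply: le_trans Ne.
have /andP[F0 F1] := F01 z.
pose m := Num.trunc (F z * N%:R).
have FN0 : 0 <= F z * N%:R by rewrite mulr_ge0// ltW.
have /andP[m1 m2] : m%:R <= F z * N%:R < m.+1%:R by exact: truncn_itv.
have mN : (m <= N)%N.
  by rewrite -(ler_nat R) (le_trans m1)// ler_piMl// ltW.
have -> : G N z = m%:R / N%:R.
  rewrite /G -mulr_sumr mulrC; congr (_ / _).
  have -> : \sum_(k < N) \1_(A k) z = \sum_(k < N | (k < m)%N) (1 : R).
    rewrite [RHS]big_mkcond; apply: eq_bigr => k _; rewrite indicE /A.
    have E : (k.+1%:R / N%:R <= F z) = (k < m)%N.
      rewrite ler_pdivrMr//; apply/idP/idP => h.
        by rewrite -ltnS -(ltr_nat R) (le_lt_trans h).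
      by rewrite (le_trans _ m1)// ler_nat.
    case: ifPn => km; first by rewrite mem_set//= E.
    by rewrite memNset//= E; exact/negP.
  by rewrite (big_ord_narrow mN) /= sumr_const card_ord.
rewrite ler_norml; apply/andP; split.
  rewrite (@le_trans _ _ 0) ?oppr_le0 ?invr_ge0 ?ler0n// subr_ge0.
  by rewrite ler_pdivrMr.
rewrite lerBlDr -{1}[N%:R^-1]mul1r -mulrDl ler_pdivlMr// nat1r.
exact: ltW.
Qed.

End square_mean.

(** * Means over the unit cube *)

Section cube_mean.
Context {R : realType}.
Local Notation mu := (@lebesgue_measure R).
Local Notation J h := (\int[mu]_(x in I01 R) h x).
Implicit Types F G : R * R * R -> R.

Definition cube_mean F : R := square_mean (fun z => J (fun w => F (z, w))).

Let bm_mean F : bounded_measurable F -> bounded_measurable (fun z => J (fun w => F (z, w))).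
Proof. exact: bounded_measurable_mean. Qed.

Let bm_section F z : bounded_measurable F -> bounded_measurable (fun w => F (z, w)).
Proof. exact: bounded_measurable_section. Qed.

Lemma cube_mean_le F G : bounded_measurable F -> bounded_measurable G ->
  (forall z, F z <= G z) -> cube_mean F <= cube_mean G.
Proof.
move=> bF bG FG; apply: square_mean_le; [exact: bm_mean|exact: bm_mean|move=> z].
by apply: mean_le; [exact: bm_section|exact: bm_section|move=> y _].
Qed.

Lemma cube_meanD F G : bounded_measurable F -> bounded_measurable G ->
  cube_mean (fun z => F z + G z) = cube_mean F + cube_mean G.
Proof.
move=> bF bG; rewrite /cube_mean -square_meanD; [|exact: bm_mean|exact: bm_mean].
congr square_mean; apply/funext => z.
by rewrite meanD//; exact: bm_section.
Qed.

Lemma cube_meanZ c F : bounded_measurable F ->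
  cube_mean (fun z => c * F z) = c * cube_mean F.
Proof.
move=> bF; rewrite /cube_mean -square_meanZ; last exact: bm_mean.
congr square_mean; apply/funext => z.
by rewrite meanZ//; exact: bm_section.
Qed.

Lemma cube_mean_cst (c : R) : cube_mean (fun=> c) = c.
Proof.
transitivity (square_mean (fun _ : R * R => c)); last exact: square_mean_cst.
by congr square_mean; apply/funext => z; exact: mean_cst.
Qed.

Implicit Types L : R * R -> R.

Lemma cube_mean12 L : cube_mean (fun u => L u.1) = square_mean L.
Proof. by congr square_mean; apply/funext => z; exact: (mean_cst (L z)). Qed.

Lemma cube_mean23 L : cube_mean (fun u => L (u.1.2, u.2)) = square_mean L.
Proof. exact: (mean_cst (square_mean L)). Qed.

Lemma cube_mean13 L : cube_mean (fun u => L (u.1.1, u.2)) = square_mean L.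
Proof.
by apply: eq_Rintegral => x _; exact: (mean_cst (J (fun w => L (x, w)))).
Qed.

Let m1 : measurable_fun [set: R * R * R] (fun u => u.1.1).
Proof. exact: (measurableT_comp measurable_fst). Qed.
Let m2 : measurable_fun [set: R * R * R] (fun u => u.1.2).
Proof. exact: (measurableT_comp measurable_snd). Qed.

Lemma bounded_measurable12 L : bounded_measurable L ->
  bounded_measurable (fun u : R * R * R => L u.1).
Proof. by move=> bL; apply: bounded_measurable_comp. Qed.

Lemma bounded_measurable23 L : bounded_measurable L ->
  bounded_measurable (fun u : R * R * R => L (u.1.2, u.2)).
Proof. by move=> bL; apply: bounded_measurable_comp => //; exact: measurable_fun_pair. Qed.

Lemma bounded_measurable13 L : bounded_measurable L ->
  bounded_measurable (fun u : R * R * R => L (u.1.1, u.2)).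
Proof. by move=> bL; apply: bounded_measurable_comp => //; exact: measurable_fun_pair. Qed.

(** The integrand of the triangle density. *)
Definition triangle_fun L (u : R * R * R) : R := L u.1 * L (u.1.2, u.2) * L (u.1.1, u.2).

Lemma bounded_measurable_triangle L : bounded_measurable L ->
  bounded_measurable (triangle_fun L).
Proof.
move=> bL; apply: bounded_measurableM; last exact: bounded_measurable13.
by apply: bounded_measurableM; [exact: bounded_measurable12|exact: bounded_measurable23].
Qed.

End cube_mean.

(** * Coded approximation of a graphon *)

Section graphon_approximation.
Context {R : realType}.
Local Notation mu := (@lebesgue_measure R).
Local Notation J h := (\int[mu]_(x in I01 R) h x).
Implicit Types (f : R -> R -> R) (F : R * R -> R) (p : R).

(** Extending by 0 outside of the unit square makes the conditions global, which
    relieves the integration lemmas of all domain conditions. *)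
Lemma graphon_extension f : graphon f -> exists F, [/\ measurable_fun [set: R * R] F,
  forall z, 0 <= F z <= 1, forall x y, F (x, y) = F (y, x) &
  forall x y, I01 R x -> I01 R y -> f x y = F (x, y)].
Proof.
move=> [mf fs f01]; have mD : measurable (I01 R `*` I01 R).
  by apply: measurableX; exact: measurable_I01.
have inD x y : ((x, y) \in I01 R `*` I01 R) = (x \in I01 R) && (y \in I01 R).
  apply/idP/andP => [/set_mem[]|[/set_mem ? /set_mem ?]].
    by split; exact/mem_set.
  by apply/mem_set; split.
exists ((fun z => f z.1 z.2) \_ (I01 R `*` I01 R)); split.
- exact/(measurable_restrictT _ mD).
- move=> [x y]; rewrite patchE inD; case: ifPn => [/andP[/set_mem xI /set_mem yI]|_].
    exact: f01.
  by rewrite lexx ler01.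
- move=> x y; rewrite !patchE !inD andbC.
  by case: ifPn => // /andP[/set_mem yI /set_mem xI]; exact: fs.
- by move=> x y xI yI; rewrite patchE inD !mem_set.
Qed.

Section extended.
Context (f : R -> R -> R) (F : R * R -> R).
Context (fF : forall x y, I01 R x -> I01 R y -> f x y = F (x, y)).

Lemma rate_square_mean p : rate p f = square_mean (fun z => I_ p (F z)).
Proof.
apply: eq_Rintegral => x /set_mem xI; apply: eq_Rintegral => y /set_mem yI.
by rewrite fF.
Qed.

Lemma edge_density_square_mean : edge_density f = square_mean F.
Proof.
apply: eq_Rintegral => x /set_mem xI; apply: eq_Rintegral => y /set_mem yI.
by rewrite fF.
Qed.

Lemma triangle_density_cube_mean : triangle_density f = cube_mean (triangle_fun F).
Proof.
apply: eq_Rintegral => x /set_mem xI; apply: eq_Rintegral => y /set_mem yI.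
by apply: eq_Rintegral => z /set_mem zI; rewrite !fF.
Qed.

End extended.

Lemma midpoint_unit (u v : R) : 0 <= u <= 1 -> 0 <= v <= 1 -> 0 <= 2^-1 * (u + v) <= 1.
Proof. lra. Qed.

Lemma midpoint_le (u v e : R) : u <= e -> v <= e -> 2^-1 * (u + v) <= e.
Proof. lra. Qed.

(** Truncation to [0, 1] and symmetrization do not increase the distance to a
    symmetric function with values in [0, 1]. *)
Lemma symmetric_approximation F (e : R) : measurable_fun [set: R * R] F ->
  (forall z, 0 <= F z <= 1) -> (forall x y, F (x, y) = F (y, x)) -> 0 < e ->
  exists (K : finType) (c : R -> K) (G : K -> K -> R),
    [/\ measurable_code c, forall a b, G a b = G b a, forall a b, 0 <= G a b <= 1
      & square_mean (fun z => `|F z - coded c G z|) <= e].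
Proof.
move=> mF F01 Fs e0; have bF := bounded_measurable_unit mF F01.
have [K [c [H [mc hH]]]] := approximable_unit mF F01 e0.
pose clamp (v : R) := Num.max 0 (Num.min 1 v).
have clamp01 v : 0 <= clamp v <= 1.
  by rewrite /clamp le_max lexx /= ge_max ler01 /= ge_min lexx.
have clampE u v : 0 <= u <= 1 -> `|u - clamp v| <= `|u - v|.
  move=> /andP[u0 u1]; rewrite /clamp.
  case: (leP 1 v) => v1.
    rewrite max_r// ler0_norm ?subr_le0// ler0_norm ?subr_le0 ?(le_trans u1)//.
    by rewrite lerN2 lerD2l lerN2.
  case: (leP 0 v) => // v0.
  by rewrite subr0 !ger0_norm ?subr_ge0 ?(le_trans (ltW v0))// lerDl oppr_ge0 ltW.
pose H1 a b := clamp (H a b).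
pose G a b := 2^-1 * (H1 a b + H1 b a).
have H101 a b : 0 <= H1 a b <= 1 by exact: clamp01.
have bd (L : K -> K -> R) : bounded_measurable (fun z => `|F z - coded c L z|).
  by apply: bounded_measurable_norm; apply: bounded_measurableB => //;
     exact: bounded_measurable_coded.
have h1 : square_mean (fun z => `|F z - coded c H1 z|) <= e.
  apply: le_trans hH; apply: square_mean_le => // z; exact: clampE.
have h2 : square_mean (fun z => `|F z - coded c (fun a b => H1 b a) z|) <= e.
  apply: le_trans h1; rewrite le_eqVlt; apply/orP; left; apply/eqP.
  transitivity (J (fun y => J (fun x => `|F (x, y) - coded c (fun a b => H1 b a) (x, y)|))).
    exact: (mean_exchange (bd _)).
  apply: eq_Rintegral => x _; apply: eq_Rintegral => y _.
  by rewrite Fs.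
exists K, c, G; split; first exact: mc.
- by move=> a b; rewrite /G addrC.
- by move=> a b; exact: midpoint_unit.
- have b1 := bd H1; have b2 := bd (fun a b => H1 b a).
  apply: (@le_trans _ _ (square_mean (fun z => 2^-1 * (`|F z - coded c H1 z| +
       `|F z - coded c (fun a b => H1 b a) z|)))).
    apply: square_mean_le => //.
      apply: bounded_measurableM; first exact: bounded_measurable_cst.
      exact: bounded_measurableD.
    move=> z; have -> : F z - coded c G z =
       2^-1 * ((F z - coded c H1 z) + (F z - coded c (fun a b => H1 b a) z)).
      by rewrite /coded /G; field.
    rewrite normrM (ger0_norm (_ : 0 <= 2^-1)) ?invr_ge0// ler_pM2l ?invr_gt0//.
    exact: ler_normD.
  rewrite square_meanZ ?square_meanD//; last exact: bounded_measurableD.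
  exact: midpoint_le.
Qed.

Lemma mul3_le_distances (x1 x2 x3 y1 y2 y3 : R) :
  0 <= x1 <= 1 -> 0 <= x2 <= 1 -> 0 <= x3 <= 1 ->
  0 <= y1 <= 1 -> 0 <= y2 <= 1 -> 0 <= y3 <= 1 ->
  x1 * x2 * x3 <= y1 * y2 * y3 + (`|x1 - y1| + `|x2 - y2| + `|x3 - y3|).
Proof.
move=> /andP[a0 a1] /andP[b0 b1] /andP[c0 c1] /andP[d0 d1] /andP[e0 e1] /andP[f0 f1].
have h1 := ler_norm (x1 - y1); have h2 := ler_norm (x2 - y2).
have h3 := ler_norm (x3 - y3).
have n1 := normr_ge0 (x1 - y1); have n2 := normr_ge0 (x2 - y2).
have n3 := normr_ge0 (x3 - y3).
have k1 : (x1 - y1) * (x2 * x3) <= `|x1 - y1|.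
  apply: (@le_trans _ _ (`|x1 - y1| * (x2 * x3))); first by rewrite ler_wpM2r ?mulr_ge0.
  by rewrite ler_piMr ?mulr_ile1.
have k2 : (x2 - y2) * (y1 * x3) <= `|x2 - y2|.
  apply: (@le_trans _ _ (`|x2 - y2| * (y1 * x3))); first by rewrite ler_wpM2r ?mulr_ge0.
  by rewrite ler_piMr ?mulr_ile1.
have k3 : (x3 - y3) * (y1 * y2) <= `|x3 - y3|.
  apply: (@le_trans _ _ (`|x3 - y3| * (y1 * y2))); first by rewrite ler_wpM2r ?mulr_ge0.
  by rewrite ler_piMr ?mulr_ile1.
have -> : x1 * x2 * x3 = y1 * y2 * y3 + ((x1 - y1) * (x2 * x3) +
   (x2 - y2) * (y1 * x3) + (x3 - y3) * (y1 * y2)) by ring.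
by rewrite lerD2l; apply: lerD => //; apply: lerD.
Qed.

(** Expand the right-hand side: each product of fewer than three of the [v] is at
    least their full product, and the term without any [v] is [d ^+ 3]. *)
Lemma mul3_mix_ge (v1 v2 v3 d : R) : 0 <= d <= 1 ->
  0 <= v1 <= 1 -> 0 <= v2 <= 1 -> 0 <= v3 <= 1 ->
  (1 - d ^+ 3) * (v1 * v2 * v3) + d ^+ 3 <=
  ((1 - d) * v1 + d) * ((1 - d) * v2 + d) * ((1 - d) * v3 + d).
Proof.
move=> /andP[d0 d1] /andP[a0 a1] /andP[b0 b1] /andP[c0 c1].
set P := v1 * v2 * v3.
have P0 : 0 <= P by rewrite !mulr_ge0.
have p12 : P <= v1 * v2 by rewrite /P ler_piMr ?mulr_ge0.
have p13 : P <= v1 * v3 by rewrite /P mulrAC ler_piMr ?mulr_ge0.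
have p23 : P <= v2 * v3 by rewrite /P -mulrA ler_piMl ?mulr_ge0.
have p1 : P <= v1 by apply: (le_trans p12); rewrite ler_piMr.
have p2 : P <= v2 by apply: (le_trans p23); rewrite ler_piMr.
have p3 : P <= v3 by apply: (le_trans p23); rewrite ler_piMl.
have e0 : 0 <= 1 - d by rewrite subr_ge0.
set w := 1 - d in e0 *.
have -> : (w * v1 + d) * (w * v2 + d) * (w * v3 + d) =
  w ^+ 3 * P + w ^+ 2 * d * (v1 * v2 + v1 * v3 + v2 * v3) +
  w * d ^+ 2 * (v1 + v2 + v3) + d ^+ 3 by rewrite /P; ring.
have c2 : 0 <= w ^+ 2 * d by rewrite mulr_ge0// sqr_ge0.
have c1' : 0 <= w * d ^+ 2 by rewrite mulr_ge0// sqr_ge0.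
have h2 : w ^+ 2 * d * (3 * P) <= w ^+ 2 * d * (v1 * v2 + v1 * v3 + v2 * v3).
  by rewrite ler_wpM2l//; lra.
have h1 : w * d ^+ 2 * (3 * P) <= w * d ^+ 2 * (v1 + v2 + v3).
  by rewrite ler_wpM2l//; lra.
have -> : (1 - d ^+ 3) * P + d ^+ 3 =
  w ^+ 3 * P + w ^+ 2 * d * (3 * P) + w * d ^+ 2 * (3 * P) + d ^+ 3.
  by rewrite /w; ring.
by rewrite lerD2r; apply: lerD => //; apply: lerD.
Qed.

Lemma measurable_I_ p : measurable_fun [set: R] (I_ p).
Proof.
have m1 : measurable_fun [set: R] (fun u : R => 1 - u) by exact: measurable_funB.
have mV c : measurable_fun [set: R] (fun u : R => u / c) by exact: measurable_funM.
apply: measurable_funM => //; apply: measurable_funD; apply: measurable_funM => //.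
  by apply: measurableT_comp => //; exact: mV.
apply: measurableT_comp => //.
exact: (measurableT_comp (mV (1 - p)) m1).
Qed.

Lemma I_le_ends p v : 0 < p < 1 -> 0 <= v <= 1 -> I_ p v <= I_ p 1 + I_ p 0.
Proof.
move=> p01 /andP[]; rewrite le_eqVlt => /predU1P[<- _|v0].
  by rewrite lerDr I_ge0// ler01 lexx.
rewrite le_eqVlt => /predU1P[->|v1]; first by rewrite lerDl I_ge0// lexx ler01.
have /andP[p0 p1] := p01.
have := @I_mix_le _ p p 0 v (1 - v) p01; rewrite mul0r add0r I_pp// add0r.
move=> /(_ _ _ _ _ _ _)/le_trans; apply; rewrite ?(ltW p0) ?(ltW p1) ?(ltW v0)//.
- by rewrite subr_ge0 ltW.
- by lra.
- by rewrite v0 v1.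
- have i1 : 0 <= I_ p 1 by rewrite I_ge0// ler01 lexx.
  have i0 : 0 <= I_ p 0 by rewrite I_ge0// ler01 lexx.
  by apply: lerD; rewrite ler_piMl//; lra.
Qed.

Lemma bounded_measurable_I p F : 0 < p < 1 -> measurable_fun [set: R * R] F ->
  (forall z, 0 <= F z <= 1) -> bounded_measurable (fun z => I_ p (F z)).
Proof.
move=> p01 mF F01; split; first exact: (measurableT_comp (measurable_I_ p) mF).
exists (I_ p 1 + I_ p 0) => z; rewrite ger0_norm ?I_ge0//; exact: I_le_ends.
Qed.

(** Away from 0 and 1 the slope is bounded, hence [I_ p] is Lipschitz there. *)
Lemma norm_I_slope_le p lo hi w : 0 < p < 1 -> 0 < lo -> hi < 1 -> lo <= w <= hi ->
  `|I_slope p w| <= - ln lo - ln (1 - hi) - ln p - ln (1 - p).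
Proof.
move=> /andP[p0 p1] lo0 hi1 /andP[low whi].
have w0 : 0 < w by exact: lt_le_trans low.
have w1 : w < 1 by exact: le_lt_trans hi1.
rewrite /I_slope !ln_div ?posrE ?subr_gt0//.
have a1 : ln lo <= ln w by rewrite ler_ln ?posrE.
have a2 : ln (1 - hi) <= ln (1 - w) by rewrite ler_ln ?posrE ?subr_gt0// lerD2l lerN2.
have b1 : ln w <= 0 by rewrite ln_le0// ltW.
have b2 : ln (1 - w) <= 0 by rewrite ln_le0// gerBl ltW.
have b3 : ln p <= 0 by rewrite ln_le0// ltW.
have b4 : ln (1 - p) <= 0 by rewrite ln_le0// gerBl ltW.
by rewrite ler_norml; apply/andP; split; lra.
Qed.

Implicit Types a d u v : R.

(** Move [v] first towards 1 by the fraction [d], then towards 0 by the fraction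
    [1 - a]. The first move strictly increases the triangle density, the second
    one keeps the values away from 1; together they map [0, 1] into a compact
    part of ]0, 1[. *)
Definition shrink (a d v : R) : R := a * ((1 - d) * v + d).

Lemma shrink_range a d v : 0 < a -> 0 < d <= 2^-1 -> 0 <= v <= 1 ->
  a * d <= shrink a d v <= a.
Proof.
move=> a0 /andP[d0 d1] /andP[v0 v1]; rewrite /shrink; apply/andP; split.
  by rewrite ler_pM2l// lerDr mulr_ge0//; lra.
by rewrite ger_pMr//; nra.
Qed.

Lemma shrink_in a d v : 0 < a < 1 -> 0 < d <= 2^-1 -> 0 <= v <= 1 ->
  0 < shrink a d v < 1.
Proof.
move=> /andP[a0 a1] d01 v01; have /andP[h1 h2] := shrink_range a0 d01 v01.
have /andP[d0 _] := d01; rewrite (lt_le_trans _ h1) ?mulr_gt0//=.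
exact: le_lt_trans a1.
Qed.

Lemma shrink_dist a d u v : 0 < a < 1 -> 0 < d <= 2^-1 ->
  `|shrink a d u - shrink a d v| <= `|u - v|.
Proof.
move=> /andP[a0 a1] /andP[d0 d1].
have -> : shrink a d u - shrink a d v = a * (1 - d) * (u - v) by rewrite /shrink; ring.
have e0 : 0 <= 1 - d by lra.
rewrite normrM ler_piMl// ger0_norm ?mulr_ge0 ?(ltW a0)//.
by rewrite mulr_ile1 ?ltW//; lra.
Qed.

(** Only the shrunken approximant [shrink a d v] has to be in the range where
    [I_ p] is Lipschitz: the tangent at this point compares its value with
    the one at [shrink a d u], which convexity compares with [I_ p u]. *)
Lemma I_shrink_le p a d u v : 0 < p < 1 -> 0 < a < 1 -> 0 < d <= 2^-1 ->
  0 <= u <= 1 -> 0 <= v <= 1 ->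
  I_ p (shrink a d v) <= I_ p u + (d * I_ p 1 + (1 - a) * I_ p 0
    + (- ln (a * d) - ln (1 - a) - ln p - ln (1 - p)) * `|u - v|).
Proof.
move=> p01 a01 d01 u01 v01; have /andP[a0 a1] := a01; have /andP[d0 d1] := d01.
set C := - ln _ - _ - _ - _.
have i1 : 0 <= I_ p 1 by rewrite I_ge0// ler01 lexx.
have unit_of (w : R) : 0 < w < 1 -> 0 <= w <= 1 by move=> /andP[? ?]; rewrite !ltW.
have tg := I_tangent p01 (shrink_in a01 d01 v01) (unit_of _ (shrink_in a01 d01 u01)).
have sl : - (C * `|u - v|) <= I_slope p (shrink a d v) * (shrink a d u - shrink a d v).
  rewrite lerNl -mulrN; apply: le_trans (ler_norm _) _; rewrite normrM normrN.
  apply: ler_pM => //; last exact: shrink_dist.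
  exact: (norm_I_slope_le p01 (mulr_gt0 a0 d0) a1 (shrink_range a0 d01 v01)).
have mix : I_ p (shrink a d u) <= I_ p u + a * d * I_ p 1 + (1 - a) * I_ p 0.
  have e : shrink a d u = a * (1 - d) * u + a * d by rewrite /shrink; ring.
  have := shrink_in a01 d01 u01; rewrite e => uu; apply: I_mix_le => //.
  - by rewrite mulr_ge0 ?(ltW a0)// subr_ge0 (le_trans d1)// invf_le1// ler1n.
  - by rewrite mulr_ge0 ?ltW.
  - by rewrite subr_ge0 ltW.
  - by ring.
have m1 : a * d * I_ p 1 <= d * I_ p 1 by rewrite ler_wpM2r// ger_pMl// ltW.
move: tg sl mix m1; clear.
set x := I_ p (shrink a d v); set y := I_slope _ _ * _; set z := I_ p (shrink a d u).
set q := C * _; set w := I_ p u; set b := a * d * _; set c := (1 - a) * _.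
by set b' := d * _; lra.
Qed.

(** The last right-hand side is what shrinking guarantees for a graphon of triangle
    density at least [t ^+ 3]. Moving towards 1 gains [d ^+ 3 * (1 - t ^+ 3)], and
    [a] is chosen so that the move towards 0 loses at most half of this. *)
Lemma shrink_parameters t (M eta : R) : 0 <= t < 1 -> 0 < M -> 0 < eta ->
  exists a d g : R, [/\ 0 < a < 1, 0 < d <= 2^-1, d * M + (1 - a) * M <= eta, 0 < g
    & t ^+ 3 + g <= a ^+ 3 * ((1 - d ^+ 3) * t ^+ 3 + d ^+ 3)].
Proof.
move=> /andP[t0 t1] M0 eta0.
have : 0 < 1 - t ^+ 3 by rewrite subr_gt0 exprn_ilt1.
have : 0 <= t ^+ 3 by rewrite exprn_ge0.
move: (t ^+ 3) => T T0 T1.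
pose r := eta / (2 * M).
have r0 : 0 < r by rewrite divr_gt0// mulr_gt0.
have rM : r * M = eta / 2 by rewrite /r; field; rewrite gt_eqF.
pose d := Num.min 2^-1 r.
have d0 : 0 < d by rewrite /d lt_min r0 invr_gt0 ltr0n.
have dr : d <= r by rewrite /d ge_min lexx orbT.
have d2 : d <= 2^-1 by rewrite /d ge_min lexx.
have c0 : 0 < d ^+ 3 by rewrite exprn_gt0.
have c1 : d ^+ 3 < 1 by rewrite exprn_ilt1 ?(ltW d0)//; lra.
pose g := d ^+ 3 * (1 - T).
have g0 : 0 < g by rewrite mulr_gt0.
have g1 : T + g <= 1 by rewrite /g; nra.
pose s := Num.min r (g / 6).
have s0 : 0 < s by rewrite /s lt_min r0 divr_gt0.
have sr : s <= r by rewrite /s ge_min lexx.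
have sg : s <= g / 6 by rewrite /s ge_min lexx orbT.
exists (1 - s), d, (g / 2); split.
- by apply/andP; split; lra.
- by rewrite d0 d2.
- have -> : 1 - (1 - s) = s by ring.
  have -> : eta = r * M + r * M by rewrite rM; field.
  by apply: lerD; rewrite ler_pM2r.
- by rewrite divr_gt0.
- have -> : (1 - d ^+ 3) * T + d ^+ 3 = T + g by rewrite /g; ring.
  have a3 : 1 - 3 * s <= (1 - s) ^+ 3.
    have -> : (1 - s) ^+ 3 = 1 - 3 * s + s ^+ 2 * (3 - s) by ring.
    by rewrite lerDl mulr_ge0 ?sqr_ge0//; lra.
  have Tg : 0 <= T + g by rewrite addr_ge0// ltW.
  apply: le_trans (ler_wpM2r Tg a3).
  by clear a3 c0 c1 dr d2 d0 r0 rM sr; nra.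
Qed.

Lemma triangle_shrink_ge F (K : finType) (c : R -> K) (G0 : K -> K -> R) a d :
  measurable_fun [set: R * R] F -> (forall z, 0 <= F z <= 1) ->
  measurable_code c -> (forall x y, 0 <= G0 x y <= 1) ->
  0 < a < 1 -> 0 < d <= 2^-1 ->
  a ^+ 3 * ((1 - d ^+ 3) * cube_mean (triangle_fun F) + d ^+ 3) <=
  cube_mean (triangle_fun (coded c (fun x y => shrink a d (G0 x y))))
  + 3 * square_mean (fun z => `|F z - coded c G0 z|).
Proof.
move=> mF F01 mc G01 a01 d01; have /andP[a0 a1] := a01; have /andP[d0 d1] := d01.
have bF := bounded_measurable_unit mF F01.
set G := fun x y => shrink a d (G0 x y).
have bG0 := bounded_measurable_coded G0 mc.
have bG := bounded_measurable_coded G mc.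
pose D z := `|F z - coded c G0 z|.
have bD : bounded_measurable D.
  by apply: bounded_measurable_norm; exact: bounded_measurableB.
pose D3 (u : R * R * R) := D u.1 + D (u.1.2, u.2) + D (u.1.1, u.2).
have b12 := bounded_measurable12 bD; have b23 := bounded_measurable23 bD.
have b13 := bounded_measurable13 bD.
have bD2 := bounded_measurableD b12 b23.
have bD3 : bounded_measurable D3 by exact: bounded_measurableD.
have bT := bounded_measurable_triangle bF.
have bTG := bounded_measurable_triangle bG.
have bc k : bounded_measurable (fun _ : R * R * R => k : R).
  exact: bounded_measurable_cst.
have bl := bounded_measurableM (bc (a ^+ 3 * (1 - d ^+ 3))) bT.
have Aw v : 0 <= v <= 1 -> 0 <= shrink a d v <= 1.
  by move=> v01; have /andP[? ?] := shrink_in a01 d01 v01; rewrite !ltW.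
have point (u : R * R * R) : a ^+ 3 * (1 - d ^+ 3) * triangle_fun F u + a ^+ 3 * d ^+ 3 <=
    triangle_fun (coded c G) u + D3 u.
  rewrite /triangle_fun /D3.
  have u1 := F01 u.1; have u2 := F01 (u.1.2, u.2); have u3 := F01 (u.1.1, u.2).
  have h1 := mul3_le_distances (Aw _ u1) (Aw _ u2) (Aw _ u3)
    (Aw _ (G01 (c u.1.1) (c u.1.2))) (Aw _ (G01 (c u.1.2) (c u.2)))
    (Aw _ (G01 (c u.1.1) (c u.2))).
  have d01' : 0 <= d <= 1 by rewrite (ltW d0) (le_trans d1)// invf_le1// ler1n.
  have h2 := mul3_mix_ge d01' u1 u2 u3.
  have a3 : 0 <= a ^+ 3 by rewrite exprn_ge0// ltW.
  have {h2} := ler_wpM2l a3 h2.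
  set X := F u.1; set Y := F (_, _); set Z := F (_, _) => h2.
  have -> : a ^+ 3 * (1 - d ^+ 3) * (X * Y * Z) + a ^+ 3 * d ^+ 3 =
     a ^+ 3 * ((1 - d ^+ 3) * (X * Y * Z) + d ^+ 3) by ring.
  apply: (le_trans h2).
  have -> : a ^+ 3 * (((1 - d) * X + d) * ((1 - d) * Y + d) * ((1 - d) * Z + d)) =
    shrink a d X * shrink a d Y * shrink a d Z by rewrite /shrink; ring.
  apply: (le_trans h1); rewrite lerD2l.
  by apply: lerD; [apply: lerD|]; exact: shrink_dist.
have := cube_mean_le (bounded_measurableD bl (bc _)) (bounded_measurableD bTG bD3) point.
rewrite (cube_meanD bl (bc _)) (cube_meanD bTG bD3) (cube_meanD bD2 b13).
rewrite (cube_meanD b12 b23) (cube_meanZ _ bT) cube_mean_cst.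
rewrite cube_mean12 cube_mean23 cube_mean13 -/G -/D.
set x := cube_mean _; set y := cube_mean _; set z := square_mean _.
by move=> h; rewrite (_ : a ^+ 3 * _ = a ^+ 3 * (1 - d ^+ 3) * x + a ^+ 3 * d ^+ 3);
  [rewrite (_ : 3 * z = z + z + z)//; ring|ring].
Qed.

Lemma rate_shrink_le p F (K : finType) (c : R -> K) (G0 : K -> K -> R) a d :
  0 < p < 1 -> measurable_fun [set: R * R] F -> (forall z, 0 <= F z <= 1) ->
  measurable_code c -> (forall x y, 0 <= G0 x y <= 1) ->
  0 < a < 1 -> 0 < d <= 2^-1 ->
  square_mean (fun z => I_ p (coded c (fun x y => shrink a d (G0 x y)) z)) <=
  square_mean (fun z => I_ p (F z)) + (d * I_ p 1 + (1 - a) * I_ p 0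
    + (- ln (a * d) - ln (1 - a) - ln p - ln (1 - p)) *
      square_mean (fun z => `|F z - coded c G0 z|)).
Proof.
move=> p01 mF F01 mc G01 a01 d01.
have bF := bounded_measurable_unit mF F01.
have bG0 := bounded_measurable_coded G0 mc.
set C := - ln _ - _ - _ - _; set q := d * _ + _.
pose D z := `|F z - coded c G0 z|.
have bD : bounded_measurable D.
  by apply: bounded_measurable_norm; exact: bounded_measurableB.
have bI := bounded_measurable_I p01 mF F01.
have bIG : bounded_measurable (fun z => I_ p (coded c (fun x y => shrink a d (G0 x y)) z)).
  exact: (bounded_measurable_coded (fun x y => I_ p (shrink a d (G0 x y))) mc).
have bc k : bounded_measurable (fun _ : R * R => k : R) by exact: bounded_measurable_cst.
have bCD := bounded_measurableM (bc C) bD.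
have bS := bounded_measurableD (bc q) bCD.
have point z : I_ p (coded c (fun x y => shrink a d (G0 x y)) z) <=
    I_ p (F z) + (q + C * D z) by exact: I_shrink_le.
apply: le_trans (square_mean_le bIG (bounded_measurableD bI bS) point) _.
have E := square_meanD bI bS; rewrite {}E.
have E := square_meanD (bc q) bCD; rewrite {}E.
have E := square_meanZ C bD; rewrite {}E.
by have E := square_mean_cst q; rewrite {}E.
Qed.

(** The constant of the Lipschitz bound depends on the shrinking parameters only.
    So these are chosen first, and the accuracy of the L1-approximation next. *)
Lemma coded_approximation p t f (eta : R) : 0 < p < 1 -> 0 <= t < 1 ->
  graphon f -> t ^+ 3 <= triangle_density f -> 0 < eta ->
  exists (K : finType) (c : R -> K) (G : K -> K -> R),
    [/\ measurable_code c, forall x y, G x y = G y x, forall x y, 0 < G x y < 1,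
      t ^+ 3 < triangle_density (fun x y => G (c x) (c y)) &
      rate p (fun x y => G (c x) (c y)) <= rate p f + eta].
Proof.
move=> p01 t01 gf Tf eta0.
have [F [mF F01 Fs fF]] := graphon_extension gf.
rewrite (rate_square_mean fF); rewrite (triangle_density_cube_mean fF) in Tf.
have i1 : 0 <= I_ p 1 by rewrite I_ge0// ler01 lexx.
have i0 : 0 <= I_ p 0 by rewrite I_ge0// ler01 lexx.
pose M := I_ p 1 + I_ p 0 + 1.
have M0 : 0 < M by rewrite ltr_wpDl// addr_ge0.
have eta2 : 0 < eta / 2 by rewrite divr_gt0.
have [a [d [g [a01 d01 dM g0 Tg]]]] := shrink_parameters t01 M0 eta2.
have /andP[a0 a1] := a01; have /andP[d0 d1] := d01.
pose C := - ln (a * d) - ln (1 - a) - ln p - ln (1 - p).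
have C0 : 0 <= C.
  have lohi : a * d <= a <= a.
    by rewrite lexx andbT ger_pMr// (le_trans d1)// invf_le1// ler1n.
  exact: le_trans (normr_ge0 _) (norm_I_slope_le p01 (mulr_gt0 a0 d0) a1 lohi).
have C1 : 0 < C + 1 by rewrite ltr_wpDl.
(* The first bound keeps 3 e below the gain g, the second keeps C e below eta / 2. *)
pose e := Num.min (g / 4) (eta / (2 * (C + 1))).
have e0 : 0 < e by rewrite /e lt_min !divr_gt0// mulr_gt0.
have eg : e <= g / 4 by rewrite /e ge_min lexx.
have eC : C * e <= eta / 2.
  apply: (@le_trans _ _ ((C + 1) * e)); first by rewrite ler_pM2r// lerDl.
  have : e <= eta / (2 * (C + 1)) by rewrite /e ge_min lexx orbT.
  rewrite !ler_pdivlMr ?mulr_gt0//.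
  by rewrite (_ : (C + 1) * e * 2 = e * (2 * (C + 1)))//; ring.
have [K [c [G0 [mc Gs G01 hG]]]] := symmetric_approximation mF F01 Fs e0.
(* Shrinking the approximant instead of f keeps it coded. *)
pose G x y := shrink a d (G0 x y).
exists K, c, G; split; first exact: mc.
- by move=> x y; rewrite /G Gs.
- by move=> x y; apply: shrink_in.
- rewrite (triangle_density_cube_mean (f := fun x y => G (c x) (c y)) (F := coded c G)
    (fun _ _ _ _ => erefl)).
  have key := triangle_shrink_ge mF F01 mc G01 a01 d01.
  have d3 : 0 <= 1 - d ^+ 3.
    by rewrite subr_ge0 exprn_ile1 ?(ltW d0)// (le_trans d1)// invf_le1// ler1n.
  have a3 : 0 <= a ^+ 3 by rewrite exprn_ge0// ltW.
  have Td : a ^+ 3 * ((1 - d ^+ 3) * t ^+ 3 + d ^+ 3) <=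
      a ^+ 3 * ((1 - d ^+ 3) * cube_mean (triangle_fun F) + d ^+ 3).
    by rewrite ler_wpM2l// lerD2r ler_wpM2l.
  have := le_trans (le_trans Tg Td) key; move: g0 eg hG; clear.
  set x := cube_mean _; set y := square_mean _; set u := t ^+ 3.
  by move: x y u e => x y u e; lra.
- rewrite (rate_square_mean (f := fun x y => G (c x) (c y)) (F := coded c G)
    (fun _ _ _ _ => erefl)).
  apply: le_trans (rate_shrink_le p01 mF F01 mc G01 a01 d01) _; rewrite lerD2l -/C.
  rewrite [leRHS]splitr; apply: lerD; last first.
    by apply: le_trans eC; rewrite ler_wpM2l.
  apply: le_trans dM; apply: lerD.
    by rewrite ler_pM2l// /M -addrA lerDl addr_ge0.
  by rewrite ler_wpM2l// ?subr_ge0 ?(ltW a1)// /M -addrA addrC -addrA lerDl addr_ge0.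
Qed.

End graphon_approximation.

(** * Vertices distributed over classes in given proportions *)

Section vertex_classes.
Context {R : realType} {K : finType}.
Implicit Types (w : K -> R) (n : nat).

Definition class_size n (k : 'I_n -> K) a := #|[set i | k i == a]%SET|.

Lemma sum_classes n (k : 'I_n -> K) (h : K -> R) :
  \sum_i h (k i) = \sum_a (class_size k a)%:R * h a.
Proof.
rewrite (partition_big k predT) //=; apply: eq_bigr => a _.
rewrite (eq_bigr (fun=> h a)) => [|i /eqP -> //].
rewrite sumr_const mulr_natl; congr (_ *+ _).
by apply: eq_card => i; rewrite inE.
Qed.

(** The pairs of a class and a position in it inject into the vertices as soon as
    there are enough vertices. *)
Lemma assign_classes n (m : K -> nat) (a0 : K) : (\sum_a m a <= n)%N ->
  exists k : 'I_n -> K, forall a, (m a <= class_size k a)%N.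
Proof.
move=> mn; pose T := {a : K & 'I_(m a)}.
have cT : (#|{: T}| <= n)%N.
  by rewrite card_tagged sumnE big_map big_enum /=; under eq_bigr do rewrite card_ord.
pose k (i : 'I_n) := if insub (i : nat) is Some r then tag (enum_val (r : 'I_#|{: T}|))
  else a0.
exists k => a; rewrite -[leqLHS]card_ord.
pose j (l : 'I_(m a)) := widen_ord cT (enum_rank (Tagged (fun a => 'I_(m a)) l : T)).
have jinj : injective j.
  move=> l l' /(congr1 val) /= /val_inj /enum_rank_inj h.
  by move/eqP: h; rewrite eq_Tagged => /eqP.
rewrite -(card_imset _ jinj); apply: subset_leq_card; apply/fintype.subsetP => _ /imsetP[l _ ->].
pose r : 'I_#|{: T}| := enum_rank (Tagged (fun a => 'I_(m a)) l : T).
have jr : insub (j l : nat) = Some r by exact: (valK r).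
by rewrite inE /k jr enum_rankK.
Qed.

(** Give the class [a] the integer part of [n%:R * w a] vertices and distribute
    the rest arbitrarily. The lower bounds for all classes imply the upper bounds
    because the sizes add up to [n]. *)
Lemma proportional_classes w n : (forall a, 0 <= w a) -> \sum_a w a = 1 ->
  exists k : 'I_n -> K, forall a,
    `|(class_size k a)%:R - n%:R * w a| <= #|K|%:R.
Proof.
move=> w0 w1.
have [a0 _] : exists a0 : K, true.
  apply/existsP; apply: contraT => /existsPn h; move: w1.
  by rewrite big1 => [/eqP|a]; [rewrite eq_sym oner_eq0|have := h a].
pose m a := Num.trunc (n%:R * w a).
have mE a : (m a)%:R <= n%:R * w a < (m a).+1%:R.
  by apply: truncn_itv; rewrite mulr_ge0 ?ler0n.
have mn : (\sum_a m a <= n)%N.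
  rewrite -(ler_nat R) natr_sum -[leRHS]mulr1 -[X in _ <= _ * X]w1 mulr_sumr; apply: ler_sum => a _.
  by have /andP[] := mE a.
have [k hk] := assign_classes a0 mn; exists k => a.
have lo b : n%:R * w b - 1 <= (class_size k b)%:R.
  have /andP[_] := mE b; rewrite -natr1 => h.
  have : (m b)%:R <= (class_size k b)%:R :> R by rewrite ler_nat.
  lra.
have tot : \sum_b (class_size k b)%:R = n%:R :> R.
  have := sum_classes k (fun=> 1); rewrite sumr_const card_ord => ->.
  by apply: eq_bigr => b _; rewrite mulr1.
have K1 : (1 : R) <= #|K|%:R.
  by rewrite ler1n; apply/card_gt0P; exists a0.
rewrite ler_norml; apply/andP; split; first by have := lo a; lra.
move: tot; rewrite (bigD1 a) //= => tot.
have : \sum_(b | b != a) (n%:R * w b - 1) <= \sum_(b | b != a) (class_size k b)%:R.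
  by apply: ler_sum => b _.
rewrite sumrB -mulr_sumr => h.
have w1' : \sum_(b | b != a) w b = 1 - w a by rewrite -w1 [in RHS](bigD1 a) //= addrAC subrr add0r.
rewrite w1' in h.
have cK : \sum_(b | b != a) 1 <= #|K|%:R :> R.
  by rewrite sumr_const ler_nat; exact: max_card.
lra.
Qed.

Lemma double_class_sum (x w : K -> R) (b : R) (F : K -> K -> R) :
  (forall a, 0 <= x a <= 1) -> (forall a, 0 <= w a <= 1) ->
  (forall a, `|x a - w a| <= b) -> (forall a a', 0 <= F a a') ->
  \sum_a \sum_a' x a * x a' * F a a' <=
  \sum_a \sum_a' w a * w a' * F a a' + 2 * b * \sum_a \sum_a' F a a'.
Proof.
move=> x01 w01 xw F0.
rewrite mulr_sumr -big_split; apply: ler_sum => a _ /=.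
rewrite mulr_sumr -big_split; apply: ler_sum => a' _ /=.
rewrite -mulrDl ler_wpM2r//.
have := xw a; have := xw a'; rewrite !ler_norml => /andP[? ?] /andP[? ?].
have /andP[? ?] := x01 a; have /andP[? ?] := w01 a'.
have b0 : 0 <= b by exact: le_trans (normr_ge0 _) (xw a).
have : x a * (x a' - w a') <= x a * b by rewrite ler_wpM2l.
have : w a' * (x a - w a) <= w a' * b by rewrite ler_wpM2l.
have : x a * b <= b by rewrite ler_piMl.
have : w a' * b <= b by rewrite ler_piMl.
lra.
Qed.

Lemma triple_class_sum (x w : K -> R) (b : R) (F : K -> K -> K -> R) :
  (forall a, 0 <= x a <= 1) -> (forall a, 0 <= w a <= 1) ->
  (forall a, `|x a - w a| <= b) -> (forall a a' a'', 0 <= F a a' a'') ->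
  \sum_a \sum_a' \sum_a'' w a * w a' * w a'' * F a a' a'' <=
  \sum_a \sum_a' \sum_a'' x a * x a' * x a'' * F a a' a''
    + 3 * b * \sum_a \sum_a' \sum_a'' F a a' a''.
Proof.
move=> x01 w01 xw F0.
rewrite mulr_sumr -big_split; apply: ler_sum => a _ /=.
rewrite mulr_sumr -big_split; apply: ler_sum => a' _ /=.
rewrite mulr_sumr -big_split; apply: ler_sum => a'' _ /=.
rewrite -mulrDl ler_wpM2r//.
have := mul3_le_distances (w01 a) (w01 a') (w01 a'') (x01 a) (x01 a') (x01 a'').
have := xw a; have := xw a'; have := xw a''; rewrite -!(distrC (w _)).
lra.
Qed.

End vertex_classes.

(** * Triangles of an inhomogeneous random graph *)

Section random_triangles.
Context {R : realType} {n : nat} (n0 : (0 < n)%N).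
Implicit Types (y : vpair n -> R) (B : 'I_n -> 'I_n -> R).

Lemma sum_vpair_le B : (forall i j, B i j = B j i) -> (forall i j, 0 <= B i j) ->
  \sum_(e : vpair n) 2 * B (val e).1 (val e).2 <= \sum_i \sum_j B i j.
Proof.
move=> Bs B0; rewrite -mulr_sumr -(sum_vpair B) mulrDl mul1r.
rewrite [X in _ + X](_ : _ = \sum_(i < n) \sum_(j < n | (j < i)%N) B i j); last first.
  rewrite [LHS](exchange_big_dep predT)//=; apply: eq_bigr => i _.
  by apply: eq_bigr => j _; rewrite Bs.
rewrite -big_split; apply: ler_sum => i _ /=.
rewrite [leRHS](bigID (fun j : 'I_n => (i < j)%N)) /= lerD2l.
rewrite [leLHS]big_mkcond [leRHS]big_mkcond; apply: ler_sum => j _.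
by case: ltngtP => //= _; rewrite ?B0.
Qed.

Lemma sym_mx_edge (i j : 'I_n) : i != j -> exists e, forall y', sym_mx y' i j = y' e :> R.
Proof.
move=> nij; have [ij|ji|/val_inj h] := ltngtP i j.
- by exists (exist _ (i, j) ij) => y'; exact: (sym_mx_val y' (exist _ (i, j) ij)).
- by exists (exist _ (j, i) ji) => y'; rewrite sym_mxC; exact: (sym_mx_val y' (exist _ (j, i) ji)).
- by rewrite h eqxx in nij.
Qed.

(** The edges may coincide: then the product of their indicators involves fewer
    factors [y e <= 1], and its mean is only larger. *)
Lemma expected_edges_ge y (e1 e2 e3 : vpair n) : (forall e, 0 <= y e <= 1) ->
  y e1 * y e2 * y e3 <=
  \sum_(X : {ffun vpair n -> bool}) bern_prod y X *
    ((X e1)%:R * (X e2)%:R * (X e3)%:R).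
Proof.
move=> y01; pose S := (e1 |: (e2 |: [set e3]))%SET.
have y0 e : 0 <= y e by have /andP[] := y01 e.
have addS e (Q : {set vpair n}) :
    y e * \prod_(i in Q) y i <= \prod_(i in (e |: Q)%SET) y i.
  have [eQ|eQ] := boolP (e \in Q); last by rewrite big_setU1.
  rewrite (finset.setUidPr _) ?finset.sub1set// ler_piMl ?prodr_ge0//.
  by have /andP[] := y01 e.
have -> : \sum_(X : {ffun vpair n -> bool}) bern_prod y X *
    ((X e1)%:R * (X e2)%:R * (X e3)%:R) =
  \sum_(X : {ffun vpair n -> bool}) \prod_e (bern (y e) (X e) * (if e \in S then (X e)%:R else 1)).
  apply: eq_bigr => X _; rewrite big_split /=; congr (_ * _).
  rewrite -big_mkcond /=.
  have -> : \prod_(e in S) (X e)%:R = (\prod_(e in S) (X e : nat))%:R :> R.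
    by rewrite natr_prod.
  rewrite -!natrM; congr (_%:R).
  have -> : (\prod_(e in S) (X e : nat) = [forall (e | e \in S), X e])%N.
    case: (boolP [forall (e | e \in S), X e]) => [/forallP h|].
      by apply: big1 => e eS; have := h e; rewrite eS /= => ->.
    rewrite negb_forall => /existsP[e]; rewrite negb_imply => /andP[eS Xe].
    by rewrite (bigD1 e) //= (negPf Xe).
  rewrite !mulnb; congr nat_of_bool; apply/idP/forallP => [/andP[/andP[h1 h2] h3] e|h].
    by apply/implyP; rewrite !inE => /or3P[] /eqP ->.
  by have := h e1; have := h e2; have := h e3; rewrite !inE !eqxx ?orbT /= => -> -> ->.
rewrite (sum_prod_ffun (fun e b => bern (y e) b * (if e \in S then b%:R else 1))).
have -> : \prod_e (bern (y e) true * (if e \in S then true%:R else 1) +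
     bern (y e) false * (if e \in S then false%:R else 1)) = \prod_(e in S) y e.
  rewrite [RHS]big_mkcond; apply: eq_bigr => e _ /=; case: ifP => _ /=; ring.
rewrite -mulrA; apply: le_trans (addS _ _); rewrite ler_wpM2l//.
by apply: le_trans (addS _ _); rewrite ler_wpM2l// big_set1.
Qed.

Lemma expected_triangles_ge y : (forall e, 0 <= y e <= 1) ->
  triangle_density (step_fun (sym_mx y)) <=
  \sum_(X : Omega n) bern_prod y X * (tdens X : R).
Proof.
move=> y01; rewrite triangle_density_sym_mx//.
have -> : \sum_(X : Omega n) bern_prod y X * (tdens X : R) =
    (n%:R ^+ 3)^-1 * \sum_i \sum_j \sum_k \sum_(X : Omega n) bern_prod y X *
      (sym_mx (fun e => (X e)%:R) i j * sym_mx (fun e => (X e)%:R) j k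
       * sym_mx (fun e => (X e)%:R) i k).
  transitivity (\sum_(X : Omega n) (n%:R ^+ 3)^-1 * \sum_i \sum_j \sum_k
      bern_prod y X * (sym_mx (fun e => (X e)%:R) i j *
       sym_mx (fun e => (X e)%:R) j k * sym_mx (fun e => (X e)%:R) i k) : R).
    apply: eq_bigr => X _; rewrite /tdens graphon_ofE triangle_density_sym_mx//.
    rewrite mulrCA; congr (_ * _); rewrite /triangles mulr_sumr; apply: eq_bigr => i _.
    rewrite mulr_sumr; apply: eq_bigr => j _.
    by rewrite mulr_sumr; apply: eq_bigr => k _.
  rewrite -mulr_sumr; congr (_ * _); rewrite exchange_big; apply: eq_bigr => i _ /=.
  rewrite exchange_big; apply: eq_bigr => j _ /=.
  by rewrite exchange_big; apply: eq_bigr => k _ /=.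
rewrite ler_wpM2l ?invr_ge0 ?exprn_ge0//.
apply: ler_sum => i _; apply: ler_sum => j _; apply: ler_sum => k _.
have pos : 0 <= \sum_(X : Omega n) bern_prod y X *
   (sym_mx (fun e => (X e)%:R) i j * sym_mx (fun e => (X e)%:R) j k
     * sym_mx (fun e => (X e)%:R) i k) :> R.
  apply: sumr_ge0 => X _; rewrite mulr_ge0 ?bern_prod_ge0//.
  have X01 := sym_mx01 (edge_indic01 (R := R) X).
  by rewrite !mulr_ge0//; [have /andP[] := X01 i j|have /andP[] := X01 j k
    |have /andP[] := X01 i k].
have [ij|ij] := eqVneq i j; first by move: pos; rewrite ij !sym_mxii !mul0r.
have [jk|jk] := eqVneq j k; first by move: pos; rewrite jk !sym_mxii !mulr0 !mul0r.
have [ik|ik] := eqVneq i k; first by move: pos; rewrite ik !sym_mxii !mulr0.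
have [e1 h1] := sym_mx_edge ij; have [e2 h2] := sym_mx_edge jk.
have [e3 h3] := sym_mx_edge ik.
rewrite !h1 !h2 !h3; under eq_bigr do rewrite h1 h2 h3.
exact: expected_edges_ge.
Qed.

(** A reversed Markov inequality. It makes a concentration estimate for the
    triangle density superfluous. *)
Lemma probability_ge_of_mean (q T : {ffun vpair n -> bool} -> R) (s eta : R) :
  (forall X, 0 <= q X) -> \sum_X q X = 1 -> 0 <= s -> (forall X, T X <= 1) ->
  s + eta <= \sum_X q X * T X -> eta <= \sum_(X | s <= T X) q X.
Proof.
move=> q0 q1 s0 T1 h; rewrite -(lerD2l s); apply: (le_trans h).
rewrite -[X in _ <= X + _]mulr1 -[X in _ <= _ * X + _]q1 mulr_sumr [X in _ + X]big_mkcond -big_split.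
apply: ler_sum => X _ /=; case: ifPn => [sT|].
  apply: (@le_trans _ _ (q X)); first by rewrite ler_piMr.
  by rewrite lerDr mulr_ge0.
by rewrite -ltNge addr0 => /ltW h'; rewrite mulrC ler_wpM2r.
Qed.

(** A triple of vertices contributes to the difference only if two of them
    coincide. *)
Lemma triangles_off_diagonal B y : (forall i j, 0 <= B i j <= 1) ->
  (forall i j, i != j -> sym_mx y i j = B i j) -> (forall e, 0 <= y e <= 1) ->
  triangles B <= triangles (sym_mx y) + 3 * n%:R ^+ 2.
Proof.
move=> B01 yB y01; have M01 := sym_mx01 y01.
have d1 (i : 'I_n) : \sum_j (i == j)%:R = 1 :> R.
  by rewrite (bigD1 i)//= eqxx big1 ?addr0// => j /negPf ji; rewrite eq_sym ji.
have diag2 : \sum_(i < n) \sum_(j < n) \sum_(k < n) (i == j)%:R = n%:R ^+ 2 :> R.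
  transitivity (\sum_(i < n) (n%:R : R)).
    apply: eq_bigr => i _; under eq_bigr do rewrite sumr_const card_ord.
    by rewrite sumrMnl d1.
  by rewrite sumr_const card_ord -mulrnA mulnn natrX.
have diag3 : \sum_(i < n) \sum_(j < n) \sum_(k < n) (j == k)%:R = n%:R ^+ 2 :> R.
  under eq_bigr => i _ do under eq_bigr => j _ do rewrite d1.
  by rewrite !sumr_const !card_ord -mulrnA mulnn natrX.
have diag1 : \sum_(i < n) \sum_(j < n) \sum_(k < n) (i == k)%:R = n%:R ^+ 2 :> R.
  by under eq_bigr => i _ do rewrite exchange_big; exact: diag2.
have -> : 3 * n%:R ^+ 2 = \sum_(i < n) \sum_(j < n) \sum_(k < n)
    ((i == j)%:R + (j == k)%:R + (i == k)%:R) :> R.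
  under [RHS]eq_bigr => i _ do under eq_bigr => j _ do rewrite !big_split.
  under [RHS]eq_bigr => i _ do rewrite !big_split.
  by rewrite !big_split /= diag1 diag2 diag3; ring.
rewrite /triangles -big_split; apply: ler_sum => i _ /=.
rewrite -big_split; apply: ler_sum => j _ /=.
rewrite -big_split; apply: ler_sum => k _ /=.
have le1 : B i j * B j k * B i k <= 1.
  have /andP[? ?] := B01 i j; have /andP[? ?] := B01 j k; have /andP[? ?] := B01 i k.
  by rewrite !mulr_ile1 ?mulr_ge0// mulr_ile1.
have ge0 : 0 <= sym_mx y i j * sym_mx y j k * sym_mx y i k.
  by rewrite !mulr_ge0//; [have /andP[] := M01 i j|have /andP[] := M01 j k
    |have /andP[] := M01 i k].
have [ij|ij] := eqVneq i j.
  apply: (le_trans le1); rewrite -[leLHS]add0r; apply: lerD => //.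
  by rewrite -addrA lerDl addr_ge0.
have [jk|jk] := eqVneq j k.
  apply: (le_trans le1); rewrite -[leLHS]add0r; apply: lerD => //.
  by rewrite add0r lerDl.
have [ik|ik] := eqVneq i k.
  by apply: (le_trans le1); rewrite -[leLHS]add0r; apply: lerD => //; rewrite !add0r.
by rewrite !yB// !addr0.
Qed.

End random_triangles.

(** * Lower bound for the probability of many triangles *)

Section asymptotic_helpers.
Context {R : realType}.
Implicit Types a c s eps : R.

Lemma eventually_div_le c eps : 0 < eps ->
  exists N, forall n, (N <= n)%N -> c / n%:R <= eps.
Proof.
move=> e0; exists (Num.trunc (c / eps)).+1 => n Nn.
have n0 : 0 < n%:R :> R by rewrite ltr0n; exact: leq_trans Nn.
rewrite ler_pdivrMr// mulrC -ler_pdivrMr// ltW// (lt_le_trans (truncnS_gt _))//.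
by rewrite ler_nat.
Qed.

Lemma eventually_expR_le a s : 0 < a -> 0 < s ->
  exists N, forall n, (N <= n)%N -> expR (- (n%:R ^+ 2 * a)) <= s.
Proof.
move=> a0 s0; have as0 : 0 < a * s by rewrite mulr_gt0.
have [N hN] := eventually_div_le 1 as0.
exists (maxn N 1) => n; rewrite geq_max => /andP[/hN h n1].
have n0 : 1 <= n%:R :> R by rewrite ler1n.
have n0' : 0 < n%:R :> R by exact: lt_le_trans n0.
rewrite expRN invf_ple ?posrE ?expR_gt0//; apply: le_trans (expR_ge1Dx _).
move: h; rewrite ler_pdivrMr// => h.
apply: (@le_trans _ _ (n%:R * a)); last first.
  apply: (@le_trans _ _ (n%:R ^+ 2 * a)); last by rewrite lerDr.
  by rewrite ler_pM2r// expr2 ler_peMl// ltW.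
rewrite -[leLHS]mul1r ler_pdivrMr//; apply: (le_trans h).
by rewrite mulrC mulrA.
Qed.

End asymptotic_helpers.

Section lower_bound.
Context {R : realType}.
Implicit Types (p t eps : R) (f : R -> R -> R).

(** The edge probabilities between two vertices depend on their classes only. All
    errors are of order [1 / n]: from the rounding of the class sizes and from the
    missing diagonal. *)
Lemma blow_up p (K : finType) (w : K -> R) (G : K -> K -> R) n : (0 < n)%N ->
  0 < p < 1 -> (forall a, 0 <= w a) -> \sum_a w a = 1 ->
  (forall a b, G a b = G b a) -> (forall a b, 0 < G a b < 1) ->
  exists y : vpair n -> R, [/\ forall e, exists ab : K * K, y e = G ab.1 ab.2,
    \sum_e 2 * I_ p (y e) <= n%:R ^+ 2 *
      (\sum_a \sum_b w a * w b * I_ p (G a b)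
       + (2 * #|K|%:R * \sum_a \sum_b I_ p (G a b)) / n%:R)
  & \sum_a \sum_b \sum_d w a * w b * w d * (G a b * G b d * G a d)
      - (3 * #|K|%:R * (\sum_a \sum_b \sum_d G a b * G b d * G a d) + 3) / n%:R
    <= triangle_density (step_fun (sym_mx y))].
Proof.
move=> n0 p01 w0 w1 Gs G01.
have n0' : 0 < n%:R :> R by rewrite ltr0n.
have G01' a b : 0 <= G a b <= 1 by have /andP[? ?] := G01 a b; rewrite !ltW.
have [k hk] := proportional_classes n w0 w1.
pose x a : R := (class_size k a)%:R / n%:R.
have x01 a : 0 <= x a <= 1.
  rewrite divr_ge0//= ler_pdivrMr// mul1r ler_nat.
  by rewrite -[leqRHS]card_ord; exact: max_card.
have w01 a : 0 <= w a <= 1.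
  by rewrite w0 -w1 (bigD1 a)//= lerDl sumr_ge0.
pose b : R := #|K|%:R / n%:R.
have xw a : `|x a - w a| <= b.
  have -> : x a - w a = ((class_size k a)%:R - n%:R * w a) / n%:R.
    by rewrite /x; field; rewrite gt_eqF.
  by rewrite normrM (@ger0_norm _ n%:R^-1) ?invr_ge0// ler_pM2r ?invr_gt0.
pose Bm (i j : 'I_n) := G (k i) (k j).
pose y (e : vpair n) := Bm (val e).1 (val e).2.
have y01 e : 0 <= y e <= 1 by exact: G01'.
have xE a : (class_size k a)%:R = n%:R * x a by rewrite /x mulrC divfK// gt_eqF.
exists y; split.
- by move=> e; exists (k (val e).1, k (val e).2).
- apply: (@le_trans _ _ (\sum_i \sum_j I_ p (Bm i j))).
    apply: (sum_vpair_le (B := fun i j => I_ p (Bm i j))).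
      by move=> i j; rewrite /Bm Gs.
    by move=> i j; rewrite I_ge0// G01'.
  rewrite (sum_classes k (fun a => \sum_j I_ p (G a (k j)))).
  under eq_bigr do rewrite (sum_classes k (fun c => I_ p (G _ c))).
  rewrite [leLHS](_ : _ = n%:R ^+ 2 * \sum_a \sum_a' x a * x a' * I_ p (G a a')); last first.
    rewrite mulr_sumr; apply: eq_bigr => a _; rewrite !mulr_sumr.
    by apply: eq_bigr => a' _; rewrite !xE; ring.
  rewrite ler_pM2l ?exprn_gt0//.
  apply: le_trans (double_class_sum x01 w01 xw _) _.
    by move=> a a'; rewrite I_ge0// G01'.
  by rewrite lerD2l /b le_eqVlt; apply/orP; left; apply/eqP; field; rewrite gt_eqF.
- rewrite triangle_density_sym_mx// lerBlDr.
  have h1 : triangles Bm <= triangles (sym_mx y) + 3 * n%:R ^+ 2.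
    have off : forall i j, i != j -> sym_mx y i j = Bm i j.
      move=> i j; apply: (sym_mx_ind (P := fun i j v => i != j -> v = Bm i j)).
      + by move=> i'; rewrite eqxx.
      + by [].
      + by move=> e' _; rewrite /y /Bm Gs.
    by apply: triangles_off_diagonal => // i j; exact: G01'.
  have h2 : triangles Bm = n%:R ^+ 3 * \sum_a \sum_a' \sum_a''
      x a * x a' * x a'' * (G a a' * G a' a'' * G a a'').
    rewrite /triangles /Bm.
    rewrite (sum_classes k (fun a => \sum_j \sum_l G a (k j) * G (k j) (k l) * G a (k l))).
    rewrite mulr_sumr; apply: eq_bigr => a _.
    rewrite (sum_classes k (fun a' => \sum_l G a a' * G a' (k l) * G a (k l))).
    rewrite !mulr_sumr; apply: eq_bigr => a' _.
    rewrite (sum_classes k (fun a'' => G a a' * G a' a'' * G a a'')).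
    rewrite !mulr_sumr; apply: eq_bigr => a'' _.
    by rewrite !xE; ring.
  have h3 := triple_class_sum x01 w01 xw
    (F := fun a a' a'' => G a a' * G a' a'' * G a a'').
  apply: le_trans (h3 _) _.
    move=> a a' a''; have /andP[? _] := G01' a a'; have /andP[? _] := G01' a' a''.
    by have /andP[? _] := G01' a a''; rewrite !mulr_ge0.
  have n3 : 0 < n%:R ^+ 3 :> R by rewrite exprn_gt0.
  have e2 : 3 * n%:R ^+ 2 = n%:R ^+ 3 * (3 / n%:R) :> R by field; rewrite gt_eqF.
  rewrite h2 e2 -lerBlDr -mulrBr -ler_pdivlMl// in h1.
  move: h1; rewrite /b; set S := \sum_a \sum_b \sum_d _ * _; set T := \sum_a _.
  set V := _ * triangles _ => h1.
  have -> : (3 * #|K|%:R * T + 3) / n%:R = 3 * (#|K|%:R / n%:R) * T + 3 / n%:R.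
    by field; rewrite gt_eqF.
  by rewrite (addrC (3 * _ * T)) addrA lerD2r -lerBlDr.
Qed.

(** For the blown-up edge probabilities the event has probability at least
    [g / 2], where [g] is the excess of the triangle density; this is weighed
    against a Chernoff bound which tends to 0. *)
Lemma large_deviation_lower_bound p t f eps : 0 < p < 1 -> 0 <= t < 1 ->
  W_ t f -> 0 < eps -> exists N, forall n, (N <= n)%N -> (0 < n)%N ->
  expR (- (n%:R ^+ 2 * (rate p f + eps))) <=
  \sum_(X : Omega n | t ^+ 3 <= tdens X) gnp p X.
Proof.
move=> p01 t01 [gf Tf] eps0; have /andP[t0 t1] := t01.
have e4 : 0 < eps / 4 by rewrite divr_gt0.
have [K [c [G [mc Gs G01 TG RG]]]] := coded_approximation p01 t01 gf Tf e4.
rewrite triangle_density_code// in TG; rewrite rate_code// in RG.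
set w := code_weight c in TG RG.
have w0 a : 0 <= w a by exact: code_weight_ge0.
have w1 : \sum_a w a = 1 by exact: sum_code_weight.
set tau := \sum_a _ in TG; set rc := \sum_a _ in RG.
pose g := tau - t ^+ 3.
have g0 : 0 < g by rewrite subr_gt0.
pose L a b := `|ln (bern (G a b) true / bern p true)| +
  `|ln (bern (G a b) false / bern p false)|.
have L0 a b : 0 <= L a b by rewrite addr_ge0.
pose C := \sum_a \sum_b L a b.
have C0 : 0 <= C by apply: sumr_ge0 => a _; apply: sumr_ge0 => b _.
have CG a b v : `|ln (bern (G a b) v / bern p v)| <= C.
  have term_le (F : K -> R) i : (forall j, 0 <= F j) -> F i <= \sum_j F j.
    by move=> F0; rewrite (bigD1 i)//= lerDl sumr_ge0.
  apply: le_trans (le_trans (term_le (L a) b (L0 a))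
    (term_le (fun a => \sum_b L a b) a (fun a => sumr_ge0 _ (fun b _ => L0 a b)))).
  by case: v; rewrite /L ?lerDl ?lerDr.
(* The Chernoff parameter: the last bound makes the quadratic term of the exponent
   at most half of the linear one, th * (eps / 4). *)
have [th [th0 thC thd]] : exists th : R, [/\ 0 < th, 4 * C * th <= 1 &
    8 * C ^+ 2 * th <= eps / 8].
  have C1 : 0 < 4 * C + 1 by rewrite ltr_wpDl// mulr_ge0.
  have C2 : 0 < 64 * C ^+ 2 + 1 by rewrite ltr_wpDl// mulr_ge0// sqr_ge0.
  exists (Num.min (4 * C + 1)^-1 (eps / (64 * C ^+ 2 + 1))); split.
  - by rewrite lt_min invr_gt0 C1 divr_gt0.
  - apply: (@le_trans _ _ (4 * C * (4 * C + 1)^-1)).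
      by rewrite ler_wpM2l ?mulr_ge0// ge_min lexx.
    by rewrite ler_pdivrMr// mul1r lerDl.
  - apply: (@le_trans _ _ (8 * C ^+ 2 * (eps / (64 * C ^+ 2 + 1)))).
      by rewrite ler_wpM2l ?mulr_ge0 ?sqr_ge0// ge_min lexx orbT.
    have e0 := ltW eps0; have C3 := sqr_ge0 C.
    rewrite mulrA ler_pdivrMr//; move: (C ^+ 2) C3 e0; clear => D D0 e0; nra.
have the : 0 < th * (eps / 8) by rewrite mulr_gt0// divr_gt0.
have g2 : 0 < g / 2 by rewrite divr_gt0.
have g4 : 0 < g / 4 by rewrite divr_gt0.
have [N1 hN1] := eventually_div_le
  (3 * #|K|%:R * (\sum_a \sum_b \sum_d G a b * G b d * G a d) + 3) g2.
have [N2 hN2] := eventually_div_le (2 * #|K|%:R * \sum_a \sum_b I_ p (G a b)) e4.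
have [N3 hN3] := eventually_expR_le the g4.
have [N4 hN4] := eventually_expR_le e4 g4.
exists (maxn (maxn N1 N2) (maxn N3 N4)) => n; rewrite !geq_max.
move=> /andP[/andP[/hN1 n1 /hN2 n2] /andP[/hN3 n3 /hN4 n4]] n0.
have [y [yG yI yT]] := blow_up n0 p01 w0 w1 Gs G01.
have y01 e : 0 < y e < 1 by have [ab ->] := yG e.
have y01' e : 0 <= y e <= 1 by have /andP[? ?] := y01 e; rewrite !ltW.
have yC e v : `|ln (bern (y e) v / bern p v)| <= C by have [ab ->] := yG e.
have ET := expected_triangles_ge n0 y01'.
have mean_ge : t ^+ 3 + g / 2 <= \sum_(X : {ffun vpair n -> bool}) bern_prod y X * tdens X.
  apply: le_trans ET; apply: le_trans yT.
  rewrite -/tau lerBrDr -lerBrDl; apply: (le_trans n1).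
  rewrite (_ : tau = t ^+ 3 + g); last by rewrite /g addrC subrK.
  by rewrite opprD addrACA subrr add0r {2}[g]splitr addrK.
have q_ge : g / 2 <= \sum_(X : {ffun vpair n -> bool} | t ^+ 3 <= tdens X) bern_prod y X.
  apply: probability_ge_of_mean mean_ge.
  - by move=> X; exact: bern_prod_ge0.
  - exact: sum_bern_prod.
  - by rewrite exprn_ge0.
  - by move=> X; have /andP[] := tdens01 (R := R) n0 X.
pose A : {set {ffun vpair n -> bool}} := [set X | t ^+ 3 <= tdens X :> R]%SET.
have sA (q : {ffun vpair n -> bool} -> R) :
    \sum_(X in A) q X = \sum_(X | t ^+ 3 <= tdens X :> R) q X.
  by apply: eq_bigl => X; rewrite inE.
have TB := tilting_lower_bound A (n%:R ^+ 2 * (eps / 4)) p01 y01 yC (ltW th0) thC.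
rewrite !sA in TB; apply: le_trans TB.
have small : expR (8 * C ^+ 2 * th ^+ 2 * #|{: vpair n}|%:R - th * (n%:R ^+ 2 * (eps / 4)))
    <= g / 4.
  apply: le_trans n3; rewrite ler_expR.
  have cn : #|{: vpair n}|%:R <= n%:R ^+ 2 :> R.
    by rewrite -natrX ler_nat card_vpair_le.
  have k0 : 0 <= 8 * C ^+ 2 * th ^+ 2 by rewrite mulr_ge0 ?sqr_ge0// mulr_ge0 ?sqr_ge0.
  have h1 := ler_wpM2l k0 cn.
  have h2 : 8 * C ^+ 2 * th ^+ 2 * n%:R ^+ 2 <= n%:R ^+ 2 * (th * (eps / 8)).
    rewrite [leRHS]mulrC ler_wpM2r ?sqr_ge0//.
    rewrite (_ : 8 * C ^+ 2 * th ^+ 2 = th * (8 * C ^+ 2 * th)); last by ring.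
    by rewrite ler_wpM2l// ltW.
  rewrite lerBlDr; apply: (le_trans h1); apply: (le_trans h2).
  rewrite le_eqVlt; apply/orP; left; apply/eqP; by field.
apply: (@le_trans _ _ (g / 4 * expR (- (n%:R ^+ 2 * (rate p f + eps * (3 / 4)))))).
  have -> : - (n%:R ^+ 2 * (rate p f + eps)) =
     - (n%:R ^+ 2 * (eps / 4)) + - (n%:R ^+ 2 * (rate p f + eps * (3 / 4))) by field.
  by rewrite expRD ler_pM2r ?expR_gt0.
apply: ler_pM; [exact: ltW|exact: expR_ge0| |].
  rewrite lerBrDr; apply: le_trans q_ge.
  by rewrite (_ : g / 2 = g / 4 + g / 4) ?lerD2l//; field.
rewrite ler_expR -opprD lerN2.
have n2' : 0 <= n%:R ^+ 2 :> R by exact: sqr_ge0.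
have h := le_trans yI (ler_wpM2l n2' (lerD RG n2)).
apply: le_trans (lerD (lexx _) h) _.
rewrite (_ : n%:R ^+ 2 * (rate p f + eps * (3 / 4)) =
  n%:R ^+ 2 * (eps / 4) + n%:R ^+ 2 * (rate p f + eps / 4 + eps / 4))//.
by field.
Qed.

End lower_bound.

(** * Upper bound for the second moment *)

Section cut_cells.
Context {R : realType} {n : nat} (n0 : (0 < n)%N).
Implicit Types (p e : R) (X : Omega n).

Definition graph_mx X : 'I_n -> 'I_n -> R := sym_mx (fun i => (X i)%:R).

Lemma tdensE X : (tdens X : R) = (n%:R ^+ 3)^-1 * triangles (graph_mx X).
Proof. by rewrite /tdens graphon_ofE triangle_density_sym_mx. Qed.

(** The graphon [g] is the step graphon of the mean of the adjacency matrices over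
    [A], weighted by [P]. Being a mean, it lies in the same cut-norm ball around
    [D] as the members of [A], hence at distance at most [2 * e] from each of
    them. *)
Lemma cut_cell_bound p e (D : 'I_n -> 'I_n -> R) (A : {set {ffun vpair n -> bool}}) :
  0 < p < 1 -> A != finset.set0 ->
  (forall X, X \in A -> cut_small e (fun i j => graph_mx X i j - D i j)) ->
  exists g, [/\ graphon g, 0 <= triangle_density g <= 1,
    \sum_(X in A) gnp p X <= expR (- (n%:R ^+ 2 * rate p g) + n%:R * I_ p 0) &
    forall X, X \in A -> tdens X <= triangle_density g + 6 * e /\
       triangle_density g <= tdens X + 6 * e].
Proof.
move=> p01 A0 AD; have [] := relative_entropy_bound p01 A0.
set P := bern_prod _; set PA := \sum_(X in A) P X.
set y := fun i : vpair n => PA^-1 * \sum_(X in A) P X * (X i)%:R.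
move=> y01 PAle.
have PA0 : 0 < PA.
  have /finset.set0Pn[X0 X0A] := A0.
  rewrite /PA (bigD1 X0) //= ltr_pwDl ?bern_prod_gt0// sumr_ge0// => X _.
  by rewrite ltW// bern_prod_gt0.
have P0 X : 0 <= P X by rewrite ltW// bern_prod_gt0.
have mixE i j : sym_mx y i j = PA^-1 * \sum_(X in A) P X * graph_mx X i j.
  rewrite /graph_mx; case: (eqVneq i j) => [->|ij].
    rewrite sym_mxii big1 ?mulr0// => X _; by rewrite sym_mxii mulr0.
  have [e' he'] := @sym_mx_edge R n i j ij; rewrite he' /y; congr (_ * _).
  by apply: eq_bigr => X _; rewrite he'.
have yD : cut_small e (fun i j => sym_mx y i j - D i j).
  move=> S T; have -> : cut_sum (fun i j => sym_mx y i j - D i j) S T =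
      PA^-1 * \sum_(X in A) P X * cut_sum (fun i j => graph_mx X i j - D i j) S T.
    transitivity (\sum_(i in S) \sum_(j in T) PA^-1 * \sum_(X in A)
        P X * (graph_mx X i j - D i j)).
      apply: eq_bigr => i _; apply: eq_bigr => j _; rewrite mixE.
      under [in RHS]eq_bigr do rewrite mulrBr.
      by rewrite sumrB mulrBr -mulr_suml -/PA mulKf// gt_eqF.
    under eq_bigr do rewrite -mulr_sumr; rewrite -mulr_sumr; congr (_ * _).
    under [RHS]eq_bigr do rewrite mulr_sumr.
    rewrite [RHS]exchange_big; apply: eq_bigr => i _ /=.
    under [RHS]eq_bigr do rewrite mulr_sumr.
    by rewrite [RHS]exchange_big.
  rewrite normrM ger0_norm ?invr_ge0 ?(ltW PA0)// ler_pdivrMl//.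
  apply: le_trans (ler_norm_sum _ _ _) _; rewrite /PA mulr_suml; apply: ler_sum => X XA.
  by rewrite normrM ger0_norm// ler_wpM2l//; exact: AD.
exists (step_fun (sym_mx y)); split.
- exact: graphon_sym_mx.
- exact: triangle_density_sym_mx01.
- apply: le_trans PAle _; rewrite ler_expR rate_sym_mx// mulrA divff; last first.
    by rewrite gt_eqF// exprn_gt0// ltr0n.
  by rewrite mul1r opprD -addrA addNr addr0.
- move=> X XA; have M01 := sym_mx01 y01.
  have X01 := sym_mx01 (edge_indic01 (R := R) X).
  have n3 : 0 < n%:R ^+ 3 :> R by rewrite exprn_gt0// ltr0n.
  have c1 := cut_small_trans (AD X XA) (cut_small_sym yD).
  have c2 := cut_small_sym c1.
  rewrite tdensE triangle_density_sym_mx//.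
  have e6 : 6 * e = (n%:R ^+ 3)^-1 * (3 * (e + e) * n%:R ^+ 3).
    by field; rewrite pnatr_eq0 -lt0n.
  rewrite e6 -!mulrDr !ler_pM2l ?invr_gt0//.
  by split; apply: triangles_cut_le.
Qed.

Lemma graph_mx_sqr X : \sum_i \sum_j graph_mx X i j ^+ 2 <= n%:R ^+ 2.
Proof.
apply: (@le_trans _ _ (\sum_(i < n) \sum_(j < n) 1)).
  apply: ler_sum => i _; apply: ler_sum => j _.
  by have /andP[? ?] := sym_mx01 (edge_indic01 (R := R) X) i j; rewrite exprn_ile1.
by rewrite !sumr_const !card_ord -mulrnA mulnn natrX.
Qed.

Lemma cut_cells e (m : nat) : 0 < e -> 1 <= m%:R * e ^+ 2 ->
  exists code : Omega n -> m.-tuple ({set 'I_n} * {set 'I_n} * bool),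
  forall X, cut_small e (fun i j => graph_mx X i j - rect_sum e (code X) i j).
Proof.
move=> e0 me; suff /choice[code hcode] : forall X, exists s :
    m.-tuple ({set 'I_n} * {set 'I_n} * bool),
    cut_small e (fun i j => graph_mx X i j - rect_sum e s i j) by exists code.
move=> X; apply: weak_regularity => //.
by apply: le_trans (graph_mx_sqr X) _; rewrite ler_peMl// sqr_ge0.
Qed.

(** The number of cells is at most the number of lists of [m] signed rectangles,
    which is only exponential in [n]. *)
Lemma sum_cells (m : nat)
    (code : Omega n -> m.-tuple ({set 'I_n} * {set 'I_n} * bool))
    (Q : pred (Omega n)) (f : Omega n -> R) (B : R) : 0 <= B ->
  (forall s, \sum_(X | Q X && (code X == s)) f X <= B) ->
  \sum_(X | Q X) f X <= expR (3 * n%:R * m%:R) * B.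
Proof.
move=> B0 hB; rewrite (partition_big code predT)//=.
apply: le_trans (ler_sum _ (fun s _ => hB s)) _.
rewrite sumr_const -[leLHS]mulr_natl ler_wpM2r//.
rewrite card_tuple !card_prod card_bool -cardsT -powersetT !card_powerset cardsT card_ord.
rewrite -expnD -expnSr -expnM natrX mulrC.
have e2 : 2 <= expR 1 :> R by apply: le_trans (expR_ge1Dx _).
have -> : m%:R * (3 * n%:R) = (3 * n * m)%:R * 1 :> R.
  by rewrite !natrM; ring.
rewrite expRM_natl; apply: (@le_trans _ _ (expR 1 ^+ ((n + n).+1 * m))).
  by rewrite lerXn2r// nnegrE ?expR_ge0.
rewrite ler_weXn2l//; first by apply: le_trans e2; rewrite ler1n.
by rewrite leq_mul2r; apply/orP; right; rewrite -addn1 !mulSn mul0n addn0 addnA leq_add2l.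
Qed.

End cut_cells.

Section upper_bound.
Context {R : realType}.

(** The exponent of a cell in [Z]: [x] and [y] stand for psi at a graph and at the
    mean of its cell, [r] for the rate of the latter. *)
Lemma tilt_gain_le (x y r c o : R) : x <= y + o -> c + y <= r -> x <= r - (c - o).
Proof. lra. Qed.

(** The exponent of a cell in [V], where in addition psi is at least [q] on the
    event. *)
Lemma tilt_loss_le (x y q r c o : R) : q <= y + o -> c + y <= r -> q <= x ->
  - x <= r - (c + 2 * q - o).
Proof. lra. Qed.

(** In each cell the hypothesis bounds the rate of the mean from below; the terms
    psi(T) then cancel in the first factor and add up in the second one, and the
    product leaves [2 * phit]. *)
Lemma second_moment_upper_bound (p t beta alpha phit eps : R) :
  0 < p < 1 -> 0 <= t -> 0 <= beta -> 0 <= alpha <= 1 ->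
  (forall g, graphon g -> 0 <= triangle_density g <= 1 ->
    phit + beta / 6 * (triangle_density g `^ alpha - (t ^+ 3) `^ alpha) <= rate p g) ->
  0 < eps -> exists N, forall n, (N <= n)%N -> (0 < n)%N ->
  second_moment p t (gibbs (logit p) beta alpha (n := n)) <=
    expR (- (n%:R ^+ 2 * (2 * phit - eps))).
Proof.
move=> p01 t0 beta0 alpha01 H eps0.
set b := beta / 6; have b0 : 0 <= b by rewrite divr_ge0.
have b1 : 0 < b + 1 by rewrite ltr_wpDl.
(* om is the admissible oscillation of T ^ alpha in a cell; e is then the radius of
   the cells, for which T oscillates by at most e' = 6 e, and m the number of
   rectangles needed to reach this radius. *)
pose om := eps / (4 * (b + 1)).
have om0 : 0 < om by rewrite divr_gt0// mulr_gt0.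
have bom : b * om <= eps / 4.
  apply: (@le_trans _ _ ((b + 1) * om)); first by rewrite ler_pM2r// lerDl.
  by rewrite (_ : (b + 1) * om = eps / 4)// /om; field; rewrite gt_eqF.
have [e' e'0 modulus] := powR_modulus alpha01 om0.
pose e := e' / 6; have e0 : 0 < e by rewrite divr_gt0.
have e6 : 6 * e = e' by rewrite /e; field.
pose m := (Num.trunc (e ^+ 2)^-1).+1.
have me : 1 <= m%:R * e ^+ 2.
  rewrite -ler_pdivrMr ?exprn_gt0// mul1r ltW//; exact: truncnS_gt.
have eps2 : 0 < eps / 2 by rewrite divr_gt0.
have [N hN] := eventually_div_le (2 * I_ p 0 + 6 * m%:R) eps2.
exists N => n /hN nN n0; have n0' : 0 < n%:R :> R by rewrite ltr0n.
have n2 : 0 <= n%:R ^+ 2 :> R by exact: sqr_ge0.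
have [code hcode] := cut_cells (n := n) e0 me.
set tau := (t ^+ 3) `^ alpha in H *.
pose c0 := phit - b * tau.
have Hc g : graphon g -> 0 <= triangle_density g <= 1 ->
    c0 + b * triangle_density g `^ alpha <= rate p g.
  by move=> gg T01; apply: le_trans (H g gg T01); rewrite /c0 -/b mulrBr -addrA (addrC (- _)).
pose k := n%:R * I_ p 0.
have cell (Q : pred (Omega n)) s (f : Omega n -> R) (u : R) :
    (forall X, Q X && (code X == s) -> 0 <= f X) ->
    (forall g X, graphon g -> 0 <= triangle_density g <= 1 ->
      Q X && (code X == s) -> tdens X <= triangle_density g + e' ->
      triangle_density g <= tdens X + e' ->
      f X <= gnp p X * expR (n%:R ^+ 2 * (rate p g - u))) ->
    \sum_(X | Q X && (code X == s)) f X <= expR (- (n%:R ^+ 2 * u) + k).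
  move=> f0 hf; pose A : {set {ffun vpair n -> bool}} := [set X | Q X && (code X == s)]%SET.
  have sA (h : Omega n -> R) : \sum_(X | Q X && (code X == s)) h X = \sum_(X in A) h X.
    by apply: eq_bigl => X; rewrite inE.
  have [A0|A0] := eqVneq A finset.set0.
    by rewrite sA A0 big_set0 expR_ge0.
  have [|g [gg T01 PA TA]] := cut_cell_bound n0 p01 A0 (D := rect_sum e s) (e := e).
    by move=> X; rewrite inE => /andP[_ /eqP <-].
  rewrite e6 in TA; rewrite sA.
  apply: (@le_trans _ _ (\sum_(X in A) gnp p X * expR (n%:R ^+ 2 * (rate p g - u)))).
    apply: ler_sum => X XA; have [T1 T2] := TA X XA.
    by apply: hf => //; rewrite inE in XA.
  rewrite -mulr_suml; apply: le_trans (ler_wpM2r (expR_ge0 _) PA) _.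
  rewrite -expRD ler_expR -/k le_eqVlt; apply/orP; left; apply/eqP; ring.
have Zb : \sum_(X : Omega n) gnp p X * tilt beta alpha X <=
    expR (3 * n%:R * m%:R) * expR (- (n%:R ^+ 2 * (c0 - b * om)) + k).
  apply: (@sum_cells R n n0 m code (fun=> true)) => [|s]; first exact: expR_ge0.
  apply: (cell (fun=> true)) => [X _|g X gg T01 _ TX _].
    by rewrite mulr_ge0 ?expR_ge0// ltW// gnp_gt0.
  rewrite ler_pM2l ?gnp_gt0// /tilt ler_expR ler_wpM2l// -/b.
  have /andP[T0 _] := T01; have /andP[X0 _] := tdens01 (R := R) n0 X.
  have h1 := ler_wpM2l b0 (modulus _ _ X0 T0 TX); have h2 := Hc g gg T01.
  by rewrite mulrDr in h1; exact: tilt_gain_le h1 h2.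
have Vb : \sum_(X : Omega n | t ^+ 3 <= tdens X) gnp p X / tilt beta alpha X <=
    expR (3 * n%:R * m%:R) * expR (- (n%:R ^+ 2 * (c0 + 2 * (b * tau) - b * om)) + k).
  apply: (@sum_cells R n n0 m code (fun X => t ^+ 3 <= tdens X)) => [|s]; first exact: expR_ge0.
  apply: (cell (fun X => t ^+ 3 <= tdens X)) => [X _|g X gg T01 /andP[tX _] TX _].
    by rewrite divr_ge0 ?expR_ge0// ltW// gnp_gt0.
  rewrite ler_pM2l ?gnp_gt0// /tilt -expRN ler_expR -mulrN ler_wpM2l// -/b.
  have /andP[T0 _] := T01; have /andP[X0 _] := tdens01 (R := R) n0 X.
  have t30 : 0 <= t ^+ 3 by rewrite exprn_ge0.
  have h1 := ler_wpM2l b0 (modulus _ _ t30 T0 (le_trans tX TX)).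
  have h2 := Hc g gg T01; have /andP[al0 _] := alpha01.
  have h3 : b * tau <= b * tdens X `^ alpha.
    apply: (ler_wpM2l b0); apply: (ge0_ler_powR al0); rewrite ?nnegrE.
    - exact: t30.
    - exact: X0.
    - exact: tX.
  by rewrite -/tau mulrDr in h1; exact: tilt_loss_le h1 h2 h3.
rewrite second_momentE//.
apply: le_trans (ler_pM _ _ Zb Vb) _.
- by apply: sumr_ge0 => X _; rewrite mulr_ge0 ?expR_ge0// ltW// gnp_gt0.
- by apply: sumr_ge0 => X _; rewrite divr_ge0 ?expR_ge0// ltW// gnp_gt0.
rewrite -!expRD ler_expR.
have hn : n%:R * (2 * I_ p 0 + 6 * m%:R) <= n%:R ^+ 2 * (eps / 2).
  by move: nN; rewrite ler_pdivrMr// => h; rewrite expr2 -mulrA ler_pM2l// [leRHS]mulrC.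
have hb : n%:R ^+ 2 * (b * om) <= n%:R ^+ 2 * (eps / 4) by rewrite ler_wpM2l.
rewrite [leLHS](_ : _ = - (n%:R ^+ 2 * (2 * phit)) + 2 * (n%:R ^+ 2 * (b * om))
   + n%:R * (2 * I_ p 0 + 6 * m%:R)); last by rewrite /k /c0; ring.
rewrite (_ : - (n%:R ^+ 2 * (2 * phit - eps)) =
   - (n%:R ^+ 2 * (2 * phit)) + 2 * (n%:R ^+ 2 * (eps / 4)) + n%:R ^+ 2 * (eps / 2)).
  by apply: lerD => //; rewrite lerD2l ler_pM2l.
by field.
Qed.

End upper_bound.

(** * The variational problem *)

Section variational_problem.
Context {R : realType}.
Implicit Types (p t u w : R) (f g : R -> R -> R).

Lemma graphon_cst u : 0 <= u <= 1 -> graphon (fun _ _ : R => u).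
Proof. by move=> u01; split => //; exact: measurable_cst. Qed.

Lemma triangle_density_cst u : triangle_density (fun _ _ : R => u) = u ^+ 3.
Proof.
rewrite /triangle_density mean_cst; rewrite mean_cst; rewrite mean_cst.
by rewrite !exprS expr0 mulr1 mulrA.
Qed.

Lemma rate_cst p u : rate p (fun _ _ : R => u) = I_ p u.
Proof. by rewrite /rate mean_cst; rewrite mean_cst. Qed.

Lemma rate_ge0 p f : 0 < p < 1 -> graphon f -> 0 <= rate p f.
Proof.
move=> p01 [_ _ f01]; apply: Rintegral_ge0 => x xI; apply: Rintegral_ge0 => y yI.
by rewrite I_ge0// f01.
Qed.

Lemma triangle_density_le_edge_density f : graphon f ->
  triangle_density f <= edge_density f <= 1.
Proof.
move=> gf; have [F [mF F01 Fs fF]] := graphon_extension gf.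
have bF := bounded_measurable_unit mF F01.
rewrite (triangle_density_cube_mean fF) (edge_density_square_mean fF).
rewrite -[X in _ <= X <= _](cube_mean12 F) -[X in _ <= _ <= X](cube_mean_cst 1).
have b1 : bounded_measurable (fun _ : R * R * R => 1 : R) := bounded_measurable_cst 1.
apply/andP; split; apply: cube_mean_le.
- exact: bounded_measurable_triangle.
- exact: bounded_measurable12.
- move=> z; have /andP[? ?] := F01 z.1; have /andP[? ?] := F01 (z.1.2, z.2).
  have /andP[? ?] := F01 (z.1.1, z.2).
  by rewrite /triangle_fun -mulrA ler_piMr// mulr_ile1.
- exact: bounded_measurable12.
- exact: b1.
- by move=> z; have /andP[] := F01 z.1.
Qed.

(** Jensen's inequality at the mean edge density, in tangent form. *)
Lemma rate_tangent p w f : 0 < p < 1 -> 0 < w < 1 -> graphon f ->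
  I_ p w + I_slope p w * (edge_density f - w) <= rate p f.
Proof.
move=> p01 w01 gf; have [F [mF F01 Fs fF]] := graphon_extension gf.
have bF := bounded_measurable_unit mF F01.
rewrite (rate_square_mean fF) (edge_density_square_mean fF).
have bI := bounded_measurable_I p01 mF F01.
have bc k : bounded_measurable (fun _ : R * R => k : R) := bounded_measurable_cst k.
have bS := bounded_measurableM (bc (I_slope p w)) bF.
have point z : (I_ p w - I_slope p w * w) + I_slope p w * F z <= I_ p (F z).
  apply: le_trans (I_tangent p01 w01 (F01 z)).
  by rewrite le_eqVlt; apply/orP; left; apply/eqP; ring.
have := square_mean_le (bounded_measurableD (bc _) bS) bI point.
have E := square_meanD (bc (I_ p w - I_slope p w * w)) bS; rewrite {}E.
have E := square_meanZ (I_slope p w) bF; rewrite {}E.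
have E := square_mean_cst (I_ p w - I_slope p w * w); rewrite {}E.
apply: le_trans; rewrite le_eqVlt; apply/orP; left; apply/eqP; ring.
Qed.

Lemma phi_ge0 p u : 0 < p < 1 -> (0 <= phi p u)%E.
Proof.
move=> p01; apply: le_ereal_inf_tmp => _ [f [gf _] <-]; rewrite lee_fin.
exact: rate_ge0.
Qed.

Lemma phi_le_rate p u f : graphon f -> triangle_density f = u ^+ 3 ->
  (phi p u <= (rate p f)%:E)%E.
Proof. by move=> gf Tf; apply: ereal_inf_lbound; exists f. Qed.

Lemma phi_fin_num p u : 0 < p < 1 -> 0 <= u <= 1 -> phi p u \is a fin_num.
Proof.
move=> p01 u01; rewrite ge0_fin_numE ?phi_ge0//.
apply: le_lt_trans (phi_le_rate p (graphon_cst u01) (triangle_density_cst u)) _.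
exact: ltry.
Qed.

(** For a graphon [g] take [u] with [u ^+ 3 = triangle_density g]: the variational
    function at [u] is at most the rate of [g]. *)
Lemma maximizer_inequality p t beta alpha : 0 < p < 1 -> 0 <= t <= 1 -> 0 <= beta ->
  (forall u : R, 0 <= u <= 1 ->
    ((beta / 6 * (u `^ (3 * alpha)))%:E - phi p u - (2^-1 * ln (1 - p))%:E <=
     (beta / 6 * (t `^ (3 * alpha)))%:E - phi p t - (2^-1 * ln (1 - p))%:E)%E) ->
  forall g, graphon g -> 0 <= triangle_density g <= 1 ->
  fine (phi p t) + beta / 6 * (triangle_density g `^ alpha - (t ^+ 3) `^ alpha)
   <= rate p g.
Proof.
move=> p01 t01 beta0 H g gg /andP[T0 T1].
pose u := triangle_density g `^ (3^-1).
have u0 : 0 <= u by exact: powR_ge0.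
have u1 : u <= 1.
  have -> : 1 = 1 `^ 3^-1 :> R by rewrite powR1.
  by apply: ge0_ler_powR; rewrite ?invr_ge0 ?nnegrE.
have u3 : triangle_density g = u ^+ 3.
  by rewrite -powR_mulrn// /u -powRrM mulVf ?powRr1// pnatr_eq0.
have u01 : 0 <= u <= 1 by rewrite u0 u1.
have e3 v : 0 <= v -> v `^ (3 * alpha) = (v ^+ 3) `^ alpha.
  by move=> v0; rewrite powRrM -powR_mulrn.
have := H u u01; have /andP[t0 _] := t01.
rewrite (e3 u u0) (e3 t t0) -u3.
have := phi_le_rate p gg u3.
rewrite -(fineK (phi_fin_num p01 u01)) -(fineK (phi_fin_num p01 t01)) /=.
rewrite lee_fin -!EFinB lee_fin lerD2r.
move: (fine _) (fine _) (rate p g) => x y r h1 h2.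
by rewrite mulrBr; move: (beta / 6 * _) (beta / 6 * _) h2 => a b; lra.
Qed.

Lemma inf_rate_le_phi p t : (ereal_inf [set (rate p f)%:E | f in W_ t] <= phi p t)%E.
Proof.
by apply: le_ereal_inf => _ [f [gf Tf] <-]; exists f => //; split => //; rewrite Tf.
Qed.

Lemma inf_rate_ge0 p t : 0 < p < 1 ->
  (0 <= ereal_inf [set (rate p f)%:E | f in W_ t])%E.
Proof.
move=> p01; apply: le_ereal_inf_tmp => _ [f [gf _] <-]; rewrite lee_fin.
exact: rate_ge0.
Qed.

(** Compare 1 with the constant graphon [w] for [w < 1]. A graphon of triangle
    density 1 has edge density 1, so its rate is at least
    [I_ p w + I_slope p w * (1 - w)]; maximality at 1 would thus bound the slope by
    [beta / 2] for all such [w]. *)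
Lemma no_maximum_at_1 p beta alpha : 0 < p < 1 -> 0 <= beta -> 0 <= alpha <= 1 ->
  ~ (forall g, graphon g -> 0 <= triangle_density g <= 1 ->
  fine (phi p 1) + beta / 6 * (triangle_density g `^ alpha - (1 ^+ 3) `^ alpha)
   <= rate p g).
Proof.
move=> p01 beta0 /andP[al0 al1] H; have /andP[p0 p1] := p01.
have q0 : 0 < 1 - p by rewrite subr_gt0.
(* With 1 - w = r the slope of I_p at w is at least (beta + 1) / 2. *)
pose r := (1 - p) * expR (- (beta + 1)).
have r0 : 0 < r by rewrite mulr_gt0// expR_gt0.
have rq : r < 1 - p.
  by rewrite /r gtr_pMr// expR_lt1 oppr_lt0 ltr_wpDl.
pose w := 1 - r.
have pw : p < w by rewrite /w ltrBrDr -ltrBrDl.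
have w1 : w < 1 by rewrite /w gtrBl.
have w0 : 0 < w by exact: lt_trans pw.
have w01 : 0 < w < 1 by rewrite w0 w1.
have w01' : 0 <= w <= 1 by rewrite !ltW.
have lower : I_ p w + I_slope p w * (1 - w) <= fine (phi p 1).
  have one01 : 0 <= (1 : R) <= 1 by rewrite ler01 lexx.
  rewrite -lee_fin fineK ?phi_fin_num//.
  apply: le_ereal_inf_tmp => _ [f [gf Tf] <-]; rewrite lee_fin.
  rewrite expr1n in Tf.
  have /andP[e1 e2] := triangle_density_le_edge_density gf.
  have -> : (1 : R) = edge_density f by apply/eqP; rewrite eq_le e2 -Tf e1.
  exact: rate_tangent.
have w3 : w ^+ 3 <= 1 by rewrite exprn_ile1// ltW.
have w30 : 0 < w ^+ 3 by rewrite exprn_gt0.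
have := H _ (graphon_cst w01'); rewrite triangle_density_cst rate_cst expr1n powR1.
rewrite (ltW w30) w3 => /(_ isT) upper.
have pow : w ^+ 3 <= (w ^+ 3) `^ alpha by apply: ger1_powR; rewrite ?w30.
have slope : I_slope p w <= beta / 2.
  have c0 : 0 < 1 - w by rewrite subr_gt0.
  rewrite -(ler_pM2r c0).
  have h3 : 1 - w ^+ 3 <= 3 * (1 - w).
    have -> : 1 - w ^+ 3 = (1 - w) * (1 + w + w ^+ 2) by ring.
    rewrite mulrC ler_pM2r//; have : w ^+ 2 <= 1 by rewrite exprn_ile1// ltW.
    by move: w1; clear; lra.
  have b6 : 0 <= beta / 6 by rewrite divr_ge0.
  have h4 : beta / 6 * (1 - (w ^+ 3) `^ alpha) <= beta / 6 * (3 * (1 - w)).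
    by rewrite ler_wpM2l//; apply: le_trans h3; rewrite lerD2l lerN2.
  have -> : beta / 2 * (1 - w) = beta / 6 * (3 * (1 - w)) by field.
  apply: le_trans h4; move: lower upper.
  move: (I_ p w) (I_slope p w * _) (fine _) ((w ^+ 3) `^ alpha) => a b c d; clear.
  by rewrite !mulrBr; lra.
have : (beta + 1) / 2 <= I_slope p w.
  rewrite /I_slope.
  have -> : (1 - w) / (1 - p) = expR (- (beta + 1)).
    by rewrite /w /r opprB addrC subrK mulrC mulKf// gt_eqF.
  rewrite expRK opprK mulrC ler_pM2l ?invr_gt0//.
  by rewrite lerDr ln_ge0// ler_pdivlMr// mul1r ltW.
move: slope; clear; lra.
Qed.

End variational_problem.

(** * Asymptotic optimality *)

Section conclusion.
Context {R : realType}.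

(** Cauchy-Schwarz for the vectors of entries the square roots of [m x * w x] and
    [m x / w x], proved by optimizing a square so that no square root appears. *)
Lemma sum_weighted_cauchy (T : finType) (P Q : pred T) (m w : T -> R) :
  (forall x, 0 < m x) -> (forall x, 0 < w x) -> (forall x, Q x -> P x) ->
  (\sum_(x | Q x) m x) ^+ 2 <= (\sum_(x | P x) m x * w x) * \sum_(x | Q x) m x / w x.
Proof.
move=> m0 w0 QP; set S := \sum_(x | Q x) m x; set V := \sum_(x | Q x) m x / w x.
set Z := \sum_(x | P x) _; pose A := \sum_(x | Q x) m x * w x.
have AZ : A <= Z.
  rewrite /A /Z big_mkcond [leRHS]big_mkcond; apply: ler_sum => x _.
  case: ifPn => [/QP -> //|_]; case: ifP => // _.
  by rewrite mulr_ge0// ltW.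
have V0 : 0 <= V by apply: sumr_ge0 => x _; rewrite divr_ge0// ltW.
apply: le_trans (ler_wpM2r V0 AZ).
have A0 : 0 <= A by apply: sumr_ge0 => x _; rewrite mulr_ge0// ltW.
have quad l : 2 * l * S <= l ^+ 2 * A + V.
  rewrite /S /A /V !mulr_sumr -big_split; apply: ler_sum => x _ /=.
  have := m0 x; have := w0 x; move: (m x) (w x) => a b b0 a0.
  rewrite -subr_ge0.
  have -> : l ^+ 2 * (a * b) + a / b - 2 * l * a = a / b * (l * b - 1) ^+ 2.
    by field; rewrite gt_eqF.
  by rewrite mulr_ge0 ?sqr_ge0// divr_ge0// ltW.
move: A0; rewrite le_eqVlt => /predU1P[A0|A0].
  have Q0 x : Q x -> False.
    move=> Qx; have : 0 < A.
      rewrite /A (bigD1 x)//= ltr_pwDl ?mulr_gt0// sumr_ge0// => y _.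
      by rewrite mulr_ge0// ltW.
    by rewrite -A0 ltxx.
  rewrite -A0 mul0r /S big_pred0 ?expr0n// => x.
  by apply/negP => /Q0.
(* The minimizer of the quadratic. *)
have h := quad (S / A); rewrite -(ler_pM2l A0) in h.
have e1 : A * (2 * (S / A) * S) = 2 * S ^+ 2 by field; rewrite gt_eqF.
have e2 : A * ((S / A) ^+ 2 * A + V) = S ^+ 2 + A * V by field; rewrite gt_eqF.
by rewrite e1 e2 in h; lra.
Qed.

Lemma ln_over_square_bounds (s I eps : R) (n : nat) : (0 < n)%N ->
  expR (- (n%:R ^+ 2 * (2 * I + eps))) <= s <= expR (- (n%:R ^+ 2 * (2 * I - eps))) ->
  `|- (2 * I) - (n%:R ^+ 2)^-1 * ln s| <= eps.
Proof.
move=> n0 /andP[lo up]; have s0 : 0 < s by exact: lt_le_trans (expR_gt0 _) lo.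
have n2 : 0 < n%:R ^+ 2 :> R by rewrite exprn_gt0// ltr0n.
rewrite -ler_ln ?posrE ?expR_gt0// expRK in lo.
rewrite -ler_ln ?posrE ?expR_gt0// expRK in up.
rewrite -[ln s](mulVKf (lt0r_neq0 n2)) in lo up.
rewrite -mulrN ler_pM2l// in lo; rewrite -mulrN ler_pM2l// in up.
by move: lo up; move: (_^-1 * ln s) => v; rewrite ler_norml => lo up; apply/andP; split; lra.
Qed.

End conclusion.

Theorem proposition3p3 (R : realType) (p t beta alpha : R)
  (hp : 0 < p < 1) (hpt : p < t) (ht : t <= 1)
  (hbeta : 0 <= beta) (halpha : 0 <= alpha <= 1)
  (hsup :
    let L := fun u : R =>
      ((beta / 6 * (u `^ (3 * alpha)))%:E - phi p u
        - (2^-1 * ln (1 - p))%:E)%E in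
    ereal_sup [set L u | u in [set u : R | 0 <= u <= 1]] = L t) :
  asymptotically_optimal p t (gibbs (logit p) beta alpha).
Proof.
have /andP[p0 p1] := hp; have t0 : 0 < t by exact: lt_trans hpt.
have t01 : 0 <= t <= 1 by rewrite (ltW t0).
have H := maximizer_inequality hp t01 hbeta (alpha := alpha).
have {hsup}{}H : forall g, graphon g -> 0 <= triangle_density g <= 1 ->
  fine (phi p t) + beta / 6 * (triangle_density g `^ alpha - (t ^+ 3) `^ alpha)
   <= rate p g.
  by apply: H => u u01; rewrite -hsup; apply: ereal_sup_ubound; exists u.
move: ht; rewrite le_eqVlt => /predU1P[t1|t1].
  by exfalso; rewrite t1 in H; exact: no_maximum_at_1 H.
set inf := ereal_inf [set (rate p f)%:E | f in W_ t].
have gt : W_ t (fun _ _ : R => t).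
  by split; [exact: graphon_cst|rewrite triangle_density_cst].
have inf_fin : inf \is a fin_num.
  rewrite ge0_fin_numE ?inf_rate_ge0//; apply: le_lt_trans (inf_rate_le_phi p t) _.
  by have := phi_fin_num hp t01; rewrite ge0_fin_numE ?phi_ge0.
pose I := fine inf.
have I_le : I <= fine (phi p t).
  by rewrite -lee_fin !fineK ?phi_fin_num//; exact: inf_rate_le_phi.
have t01' : 0 <= t < 1 by rewrite (ltW t0).
pose s n := second_moment p t (gibbs (logit p) beta alpha (n := n)).
have bounds eps : 0 < eps -> exists N, forall n, (N <= n)%N -> (0 < n)%N ->
    expR (- (n%:R ^+ 2 * (2 * I + eps))) <= s n <=
    expR (- (n%:R ^+ 2 * (2 * I - eps))).
  move=> eps0; have e4 : 0 < eps / 4 by rewrite divr_gt0.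
  have [_ [f Wf <-] fI] : exists2 v, [set (rate p f)%:E | f in W_ t] v & (v < inf + (eps / 4)%:E)%E.
    exact: lb_ereal_inf_adherent.
  have {}fI : rate p f <= I + eps / 4.
    by move/ltW: fI; rewrite -{1}(fineK inf_fin) -EFinD lee_fin.
  have [N1 h1] := large_deviation_lower_bound hp t01' Wf e4.
  have [N2 h2] := second_moment_upper_bound hp (ltW t0) hbeta halpha H eps0.
  exists (maxn N1 N2) => n; rewrite geq_max => /andP[/h1 {}h1 /h2 {}h2] n0.
  have n2 : 0 <= n%:R ^+ 2 :> R by exact: sqr_ge0.
  apply/andP; split; last first.
    apply: le_trans (h2 n0) _; rewrite ler_expR lerN2 ler_wpM2l//.
    by rewrite lerD2r ler_pM2l.
  rewrite /s second_momentE//.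
  have cs := @sum_weighted_cauchy R (Omega n) (fun=> true)
    (fun X => t ^+ 3 <= tdens X) (fun X => gnp p X) (fun X => tilt beta alpha X)
    (fun X => gnp_gt0 X hp) (fun X => expR_gt0 _) (fun _ _ => isT).
  apply: le_trans cs.
  apply: (@le_trans _ _ (expR (- (n%:R ^+ 2 * (rate p f + eps / 4))) ^+ 2)).
    rewrite -expRM_natl ler_expR mulrN lerN2 mulrCA ler_wpM2l//.
    by move: fI; clear; lra.
  by rewrite lerXn2r ?nnegrE ?expR_ge0 ?h1//; apply: sumr_ge0 => X _; rewrite ltW// gnp_gt0.
rewrite /asymptotically_optimal -/inf -(fineK inf_fin) -/I -EFinM -EFinN.
have value n : 0 < s n ->
    (((n%:R ^+ 2)^-1)%:E * lne (s n)%:E)%E = ((n%:R ^+ 2)^-1 * ln (s n))%:E.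
  by move=> sn; rewrite lne_EFin// EFinM.
apply/fine_cvgP; split.
  have [N hN] := bounds 1 ltr01; exists N.+1 => // n /= Nn.
  have n0 : (0 < n)%N by exact: leq_trans Nn.
  have /andP[lo _] := hN n (ltnW Nn) n0.
  by rewrite -/(s n) value// (lt_le_trans _ lo)// expR_gt0.
apply/cvgrPdist_le => eps eps0; have [N hN] := bounds eps eps0.
exists N.+1 => // n /= Nn; have n0 : (0 < n)%N by exact: leq_trans Nn.
have B := hN n (ltnW Nn) n0; have /andP[lo _] := B.
rewrite -/(s n) value ?(lt_le_trans (expR_gt0 _) lo)//=.
exact: ln_over_square_bounds.
Qed.
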